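(* The following problem is solvable in polynomial time: given a graph $G$, decide whether the full house $\widehat{K_4}$ is an induced minor of $G$.
   Context: All graphs are finite, simple and undirected. $H$ is an induced minor of $G$ if $H$ can be obtained from $G$ by deleting vertices and contracting edges. The full house $\widehat{K_4}$ is the graph obtained from the complete graph $K_4$ by adding a new vertex adjacent to exactly two vertices of the $K_4$. *)

(* Defs.v *)
From mathcomp Require Import all_boot.

Set Implicit Arguments.
Unset Strict Implicit.
Unset Printing Implicit Defensive.

(** * Finite simple graphs *)

Record sgraph := SGraph {
  vertex :> finType;
  edge : rel vertex;
  edge_sym : symmetric edge;
  edge_irr : irreflexive edge }.

Definition isomorphic (G H : sgraph) : Prop :=
  exists2 f : G -> H, bijective f & forall u v, edge (f u) (f v) = edge u v.

Section Operations.

Variable G : sgraph.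

Section DeleteVertex.

Variable x : G.

Definition delete_edge : rel {u : G | u != x} :=
  fun u v => edge (val u) (val v).

Fact delete_edge_sym : symmetric delete_edge.
Proof. by move=> u v; exact: edge_sym. Qed.

Fact delete_edge_irr : irreflexive delete_edge.
Proof. by move=> u; exact: edge_irr. Qed.

Definition delete_vertex : sgraph := SGraph delete_edge_sym delete_edge_irr.

End DeleteVertex.

Section ContractEdge.

(* Contracting the edge [x y]: [y] is removed and the surviving vertex [x]
   stands for the merged vertex, so it inherits the neighbours of [y].
   No loop or multiple edge is created. *)
Variables x y : G.

Definition contract_edge : rel {u : G | u != y} := fun u v =>
  (u != v) && [|| edge (val u) (val v),
                  (val u == x) && edge y (val v) |
                  (val v == x) && edge y (val u)].

Fact contract_edge_sym : symmetric contract_edge.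
Proof.
by move=> u v; rewrite /contract_edge eq_sym edge_sym [X in _ || X]orbC.
Qed.

Fact contract_edge_irr : irreflexive contract_edge.
Proof. by move=> u; rewrite /contract_edge eqxx. Qed.

Definition contract : sgraph := SGraph contract_edge_sym contract_edge_irr.

End ContractEdge.

Section AddVertex.

Variable N : {set G}.

Definition add_edge : rel (option G) := fun u v =>
  match u, v with
  | Some u, Some v => edge u v
  | Some u, None | None, Some u => u \in N
  | None, None => false
  end.

Fact add_edge_sym : symmetric add_edge.
Proof. by case=> [u|] [v|] //=; exact: edge_sym. Qed.

Fact add_edge_irr : irreflexive add_edge.
Proof. by case=> [u|] //=; exact: edge_irr. Qed.

(* [None] is the new vertex; its neighbourhood is [N]. *)
Definition add_vertex : sgraph := SGraph add_edge_sym add_edge_irr.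

End AddVertex.

End Operations.

(* [induced_minor H G]: [H] is an induced minor of [G]. *)
Inductive induced_minor (H : sgraph) : sgraph -> Prop :=
| induced_minor_iso (G : sgraph) :
    isomorphic G H -> induced_minor H G
| induced_minor_delete (G : sgraph) (x : G) :
    induced_minor H (delete_vertex x) -> induced_minor H G
| induced_minor_contract (G : sgraph) (x y : G) :
    edge x y -> induced_minor H (contract x y) -> induced_minor H G.

Section Complete.

Variable n : nat.

Definition complete_edge : rel 'I_n := fun i j => i != j.

Fact complete_edge_sym : symmetric complete_edge.
Proof. by move=> i j; rewrite /complete_edge eq_sym. Qed.

Fact complete_edge_irr : irreflexive complete_edge.
Proof. by move=> i; rewrite /complete_edge eqxx. Qed.

Definition complete : sgraph := SGraph complete_edge_sym complete_edge_irr.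

End Complete.

Definition full_house : sgraph :=
  @add_vertex (complete 4) [set i : 'I_4 | i < 2].

(** * Polynomial time

   The machine model is the random access machine with unit cost.  The only
   arithmetic is addition and truncated subtraction: an arithmetic step
   increases the largest bit length by at most one, so polynomial time on this
   machine is polynomial time on Turing machines (Cook and Reckhow, Time
   bounded random access machines, 1973).  Multiplication as a unit-cost
   instruction would break this. *)

Inductive instr :=
| IConst (d c : nat)    (* R[d] := c *)
| IAdd (d a b : nat)    (* R[d] := R[a] + R[b] *)
| ISub (d a b : nat)    (* R[d] := R[a] - R[b], or 0 if negative *)
| ILoad (d a : nat)     (* R[d] := R[R[a]] *)
| IStore (a b : nat)    (* R[R[a]] := R[b] *)
| IJumpZ (a l : nat).   (* if R[a] = 0 then goto l *)

Definition program := seq instr.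

Definition memory := nat -> nat.

(* Program counter and register contents. *)
Definition config := (nat * memory)%type.

Definition update (m : memory) (a v : nat) : memory :=
  fun i => if i == a then v else m i.

Definition exec (i : instr) (s : config) : config :=
  let: (pc, m) := s in
  match i with
  | IConst d c => (pc.+1, update m d c)
  | IAdd d a b => (pc.+1, update m d (m a + m b))
  | ISub d a b => (pc.+1, update m d (m a - m b))
  | ILoad d a => (pc.+1, update m d (m (m a)))
  | IStore a b => (pc.+1, update m (m a) (m b))
  | IJumpZ a l => (if m a == 0 then l else pc.+1, m)
  end.

(* The machine halts by moving the program counter outside the program. *)
Definition step (p : program) (s : config) : config :=
  if onth p s.1 is Some i then exec i s else s.

Definition halted (p : program) (s : config) : bool := size p <= s.1.

(* The input word [w] is stored in registers 1, ..., size w, its length in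
   register 0; all other registers contain 0. *)
Definition init (w : seq bool) : config :=
  (0, fun i => if i is j.+1 then nat_of_bool (nth false w j) else size w).

Definition run (p : program) (w : seq bool) (t : nat) : config :=
  iter t (step p) (init w).

(* The answer of a halted machine is yes iff register 0 is nonzero. *)
Definition accepting (s : config) : bool := s.2 0 != 0.

(* The problem "given x : I, does P x hold?", instances being presented as
   words through [encode]. *)
Definition polytime_decidable (I : Type) (encode : I -> seq bool)
    (P : I -> Prop) : Prop :=
  exists (p : program) (c k : nat), forall x : I, exists t : nat,
    [/\ t <= c * size (encode x) ^ k + c,
        halted p (run p (encode x) t) &
        accepting (run p (encode x) t) <-> P x].

(* Adjacency matrix, row by row.  As [sgraph] ranges over all finite types of
   vertices, every adjacency matrix of every graph is an instance: a reordering
   of the vertices is a relabelled graph on an ordinal type. *)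
Definition adjacency_word (G : sgraph) : seq bool :=
  [seq edge u v | u <- enum G, v <- enum G].

(* Main.v *)
(* The full house is an induced minor of [G] iff five disjoint connected bags of
   vertices touch each other exactly as its vertices do.  A set of vertices
   with a [K_4] minor that is minimal for inclusion, together with a connected
   set attached to it at two vertices, contains such bags unless it is complete
   multipartite or the join of [K_2 + K_1] with an independent set.  Growing it
   through a 2-connected graph shows that such a graph [B] has a full house iff
   for some vertex [v] the graph [B - v] has a [K_4] minor and some edge avoids
   the closed neighbourhood of [v].  As the bags of a minimal full house lie
   in one block of [G], it suffices to test every block, given by one of its
   edges.  A [K_4] minor is recognised by repeatedly eliminating a vertex of
   degree at most 2 and joining its neighbours: a nonempty graph of minimum
   degree at least 3 has a [K_4] minor.

   All these tests are loops over vertices whose bodies redefine a binary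
   relation by a first-order formula; such programs run in polynomial time on
   the random access machine. *)

From Stdlib Require Import Classical.
Require Import Defs.
From mathcomp Require Import all_boot fingroup perm zify.

Set Implicit Arguments.
Unset Strict Implicit.
Unset Printing Implicit Defensive.

(** The difficulty is exactness: a vertex [v] attached to a [K_4] minor may touch three or four bags
    for every choice of the bags. Two obstructions explain this. In a complete multipartite graph no
    edge avoids the closed neighbourhood of a vertex. In the join of [K_2 + K_1] with an independent
    set an edge may avoid it, but then deleting the vertex destroys every [K_4] minor.

    That there is no other obstruction is a bounded problem. Edges inside bags are contracted as
    long as [v] keeps two neighbours, and contractions are undone one at a time. A minimal [K_4]
    minor has at most 6 vertices in the first class and 5 in the second, so together with [v] an
    obstruction has at most 7 vertices and undoing one contraction gives at most 8. These graphs are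
    enumerated by computation: each contains a full house or is again an obstruction.

    2-connectedness matters because it supplies, for every proper subset with two vertices, a
    connected set outside that is attached to it at two vertices. *)

Definition bag (T : finType) (f : T -> nat) i := [set u | f u == i].

(** * Minor models *)

Section Connectivity.

Variable G : sgraph.
Implicit Types (X Y S : {set G}) (f : G -> nat).

(** Closure form of connectedness, which spares paths. It holds of the empty set, so the bags of a
    model are required to be nonempty separately. *)
Definition conn X := forall S, (exists2 u, u \in X & u \in S) ->
  (forall u v, u \in X -> v \in X -> edge u v -> u \in S -> v \in S) ->
  X \subset S.

Definition touch X Y := [exists u in X, exists v in Y, edge u v].

Lemma touchP X Y :
  reflect (exists u v, [/\ u \in X, v \in Y & edge u v]) (touch X Y).
Proof.
apply: (iffP exists_inP) => [[u uX /exists_inP[v vY uv]]|[u [v [uX vY uv]]]].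
  by exists u, v.
by exists u => //; apply/exists_inP; exists v.
Qed.

Lemma touchC X Y : touch X Y = touch Y X.
Proof. by apply/touchP/touchP => -[u [v [? ? ?]]]; exists v, u; rewrite edge_sym. Qed.

Lemma touchS X X' Y Y' :
  X \subset X' -> Y \subset Y' -> touch X Y -> touch X' Y'.
Proof.
move=> /subsetP XX /subsetP YY /touchP[u [v [uX vY uv]]].
by apply/touchP; exists u, v; split; auto.
Qed.

Lemma conn1 x : conn [set x].
Proof.
move=> S [u /set1P-> xS] _; apply/subsetP => v /set1P-> //.
Qed.

Lemma connU X Y : conn X -> conn Y -> touch X Y -> conn (X :|: Y).
Proof.
move=> cX cY /touchP[a [b [aX bY ab]]] S [u uXY uS] clS.
have hX : (exists2 u, u \in X & u \in S) -> X \subset S.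
  by move/cX; apply=> ? ? ? ?; apply: clS; rewrite inE; apply/orP; left.
have hY : (exists2 u, u \in Y & u \in S) -> Y \subset S.
  by move/cY; apply=> ? ? ? ?; apply: clS; rewrite inE; apply/orP; right.
have aXY : a \in X :|: Y by rewrite inE aX.
have bXY : b \in X :|: Y by rewrite inE bY orbT.
rewrite subUset; case/setUP: uXY => [uX|uY].
  have sX : X \subset S by apply: hX; exists u.
  rewrite sX hY //; exists b => //.
  exact: (clS a b aXY bXY ab (subsetP sX _ aX)).
have sY : Y \subset S by apply: hY; exists u.
rewrite sY hX //; exists a => //.
by apply: (clS b a bXY aXY _ (subsetP sY _ bY)); rewrite edge_sym.
Qed.

Lemma conn2 x y : edge x y -> conn [set x; y].
Proof.
move=> xy; apply: connU; try exact: conn1.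
by apply/touchP; exists x, y; rewrite !inE !eqxx.
Qed.

Lemma conn_cross X S : conn X -> (exists2 u, u \in X & u \in S) ->
  ~~ (X \subset S) ->
  exists u v, [/\ u \in X, v \in X, u \in S, v \notin S & edge u v].
Proof.
move=> cX hu nXS.
case: (boolP [exists u, exists v, [&& u \in X, v \in X, u \in S, v \notin S & edge u v]]).
  by move=> /existsP[u /existsP[v /and5P[? ? ? ? ?]]]; exists u, v.
move=> /existsPn H1; case/negP: nXS; apply: (cX S hu) => u v uX vX uv uS.
apply: contraT => vS; have /existsPn /(_ v) := H1 u.
by rewrite uX vX uS vS uv.
Qed.

End Connectivity.

Section Models.

Variable G : sgraph.
Implicit Types (X Y S : {set G}) (f : G -> nat).

Definition k4 X := exists f,
  [/\ forall u, f u < 4 -> u \in X,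
      forall i, i < 4 -> bag f i != set0,
      forall i, i < 4 -> conn (bag f i) &
      forall i j, i < j -> j < 4 -> touch (bag f i) (bag f j)].

(** Read for [i < j]: label 4 is the added vertex, which misses labels 2 and 3. *)
Definition house_edge i j := ~~ ((j == 4) && (1 < i)).

Definition house := exists f : G -> nat,
  [/\ forall i, i < 5 -> bag f i != set0,
      forall i, i < 5 -> conn (bag f i) &
      forall i j, i < j -> j < 5 -> touch (bag f i) (bag f j) = house_edge i j].

Lemma k4S X Y : X \subset Y -> k4 X -> k4 Y.
Proof.
by move=> /subsetP XY [f [fX f0 fc ft]]; exists f; split=> // u /fX /XY.
Qed.

End Models.

Arguments k4 {G} X.

(** * Quotients by connected fibers *)

Section Quotient.

Variables (G F : sgraph) (g : G -> option F).

Definition fiber t := [set u | g u == Some t].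
Definition pre (Y : {set F}) := [set u | if g u is Some t then t \in Y else false].

(** It makes [F] an induced minor of [G]: vertices sent to [None] are deleted and fibers are
    contracted. Vertex deletion, edge contraction, induced subgraphs and the contraction of a
    connected set are all instances, so models are transported only once. *)
Definition qmap :=
  [/\ forall t, fiber t != set0, forall t, conn (fiber t) &
      forall t t', t != t' -> edge t t' = touch (fiber t) (fiber t')].

Hypothesis qg : qmap.
Implicit Types (Y : {set F}) (t : F).

Lemma in_pre u Y : u \in pre Y -> exists2 t, g u = Some t & t \in Y.
Proof. by rewrite inE; case: (g u) => // t tY; exists t. Qed.

Lemma fiber_pre t Y : t \in Y -> fiber t \subset pre Y.
Proof. by move=> tY; apply/subsetP=> u; rewrite !inE => /eqP->. Qed.

Lemma fiberP t : exists u, g u = Some t.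
Proof. by have [/(_ t)/set0Pn[u]] := qg; rewrite inE => /eqP; exists u. Qed.

Lemma pre_neq0 Y : Y != set0 -> pre Y != set0.
Proof.
case/set0Pn=> t tY; have [u gu] := fiberP t.
by apply/set0Pn; exists u; rewrite inE gu.
Qed.

Lemma conn_pre Y : conn Y -> conn (pre Y).
Proof.
move=> cY S [u /in_pre[t gu tY] uS] clS; have [_ cf ef] := qg.
have hf t' v : t' \in Y -> g v = Some t' -> v \in S -> fiber t' \subset S.
  move=> tY' gv vS; apply: cf; first by exists v => //; rewrite inE gv.
  by move=> a b af bf; apply: clS; apply: (subsetP (fiber_pre tY')).
suff /subsetP sY : Y \subset [set t' | fiber t' \subset S].
  apply/subsetP => v /in_pre[t' gv tY']; have := sY _ tY'.
  by rewrite inE => /subsetP; apply; rewrite inE gv.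
apply: cY; first by exists t => //; rewrite inE (hf _ u).
move=> a b aY bY ab; rewrite !inE => sa.
have nab : a != b by apply: contraTneq ab => ->; rewrite edge_irr.
move: ab; rewrite (ef _ _ nab) => /touchP[p [q [pa qb pq]]].
have gq : g q = Some b by move: qb; rewrite inE => /eqP.
apply: (hf b q) => //; apply: (clS p q) => //; last exact: (subsetP sa).
  exact: (subsetP (fiber_pre aY)).
exact: (subsetP (fiber_pre bY)).
Qed.

Lemma conn_preK Y : conn (pre Y) -> conn Y.
Proof.
move=> cY S [t tY tS] clS; have [_ _ ef] := qg.
have sub : pre Y \subset pre S.
  apply: cY.
    by have [u gu] := fiberP t; exists u; rewrite inE gu.
  move=> u v /in_pre[a ga aY] /in_pre[b gb bY] uv; rewrite !inE ga gb => aS.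
  have [<-//|nab] := eqVneq a b; apply: (clS a b) => //; rewrite ef //.
  by apply/touchP; exists u, v; rewrite !inE ga gb !eqxx.
apply/subsetP=> a aY; have [u gu] := fiberP a.
by have := subsetP sub u; rewrite !inE gu; apply.
Qed.

Lemma touch_pre Y Y' : [disjoint Y & Y'] -> touch (pre Y) (pre Y') = touch Y Y'.
Proof.
move=> dY; have [_ _ ef] := qg; apply/touchP/touchP.
  move=> [u [v [/in_pre[a ga aY] /in_pre[b gb bY] uv]]]; exists a, b; split=> //.
  have nab : a != b by apply: contraTneq aY => ->; rewrite (disjointFl dY bY).
  by rewrite ef //; apply/touchP; exists u, v; rewrite !inE ga gb !eqxx.
move=> [a [b [aY bY ab]]].
have nab : a != b by apply: contraTneq ab => ->; rewrite edge_irr.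
move: ab; rewrite (ef _ _ nab) => /touchP[p [q [pa qb pq]]].
by exists p, q; rewrite (subsetP (fiber_pre aY)) // (subsetP (fiber_pre bY)).
Qed.

Lemma bag_disjoint (H : sgraph) (f : H -> nat) i j : i != j -> [disjoint bag f i & bag f j].
Proof.
move=> ij; rewrite disjoint_subset; apply/subsetP => u; rewrite !inE => /eqP->//.
Qed.

(** Deleted vertices get [k], the first label that names no bag. *)
Definition lift k (f : F -> nat) u := if g u is Some t then f t else k.

Lemma bag_lift k f i : i < k -> bag (lift k f) i = pre (bag f i).
Proof.
move=> ik; apply/setP=> u; rewrite !inE /lift; case: (g u) => [t|]; first by rewrite inE.
by apply/negbTE; rewrite neq_ltn ik orbT.
Qed.

Lemma k4_quot Y : k4 Y -> k4 (pre Y).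
Proof.
move=> [f [fY f0 fc ft]]; exists (lift 4 f); split.
- by move=> u; rewrite inE /lift; case: (g u).
- by move=> i i4; rewrite bag_lift // pre_neq0 ?f0.
- by move=> i i4; rewrite bag_lift //; apply: conn_pre; exact: fc.
move=> i j ij j4; rewrite !bag_lift ?(ltn_trans ij) // touch_pre ?ft //.
by rewrite bag_disjoint // neq_ltn ij.
Qed.

Lemma house_quot : house F -> house G.
Proof.
move=> [f [f0 fc ft]]; exists (lift 5 f); split.
- by move=> i i4; rewrite bag_lift // pre_neq0 ?f0.
- by move=> i i4; rewrite bag_lift //; apply: conn_pre; exact: fc.
move=> i j ij j4; rewrite !bag_lift ?(ltn_trans ij) // touch_pre ?ft //.
by rewrite bag_disjoint // neq_ltn ij.
Qed.

(* A labelling constant on fibers descends to the quotient. *)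
Section Descend.

Variables (k : nat) (f : G -> nat).
Hypothesis fK : forall u v t, g u = Some t -> g v = Some t -> f u = f v.
Hypothesis f0 : forall u, g u = None -> k <= f u.

Lemma descend : exists f' : F -> nat,
  (forall u t, g u = Some t -> f' t = f u) /\
  forall i, i < k -> pre (bag f' i) = bag f i.
Proof.
have hx t : exists n, [exists u, (g u == Some t) && (f u == n)].
  by have [u gu] := fiberP t; exists (f u); apply/existsP; exists u; rewrite gu !eqxx.
(* The minimum is only a choice: [f] takes a single value on the fiber of [t]. *)
pose f' t := ex_minn (hx t).
have f'E u t : g u = Some t -> f' t = f u.
  move=> gu; rewrite /f'; case: ex_minnP => n /existsP[v /andP[/eqP gv /eqP<-]] _.
  exact: fK gv gu.
exists f'; split=> // i ik; apply/setP=> u; rewrite !inE.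
case gu: (g u) => [t|]; first by rewrite inE (f'E u).
by apply/esym/negbTE; rewrite neq_ltn (leq_trans ik) ?orbT ?f0.
Qed.

End Descend.

Lemma pre_eq0 Y : pre Y != set0 -> Y != set0.
Proof. by case/set0Pn=> u /in_pre[t _ tY]; apply/set0Pn; exists t. Qed.

Lemma k4_descend Y f :
  (forall u v t, g u = Some t -> g v = Some t -> f u = f v) ->
  (forall u, g u = None -> 4 <= f u) ->
  (forall u, f u < 4 -> u \in pre Y) ->
  (forall i, i < 4 -> bag f i != set0) ->
  (forall i, i < 4 -> conn (bag f i)) ->
  (forall i j, i < j -> j < 4 -> touch (bag f i) (bag f j)) ->
  k4 Y.
Proof.
move=> fK fN fY f0 fc ft; have [f' [f'E pE]] := descend fK fN.
exists f'; split.
- move=> t; have [u gu] := fiberP t; rewrite (f'E u) // => /fY.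
  by rewrite inE gu.
- by move=> i i4; apply: pre_eq0; rewrite pE // f0.
- by move=> i i4; apply: conn_preK; rewrite pE //; exact: fc.
move=> i j ij j4; rewrite -touch_pre ?pE ?(ltn_trans ij) ?ft //.
by rewrite bag_disjoint // neq_ltn ij.
Qed.

Lemma house_descend f :
  (forall u v t, g u = Some t -> g v = Some t -> f u = f v) ->
  (forall u, g u = None -> 5 <= f u) ->
  (forall i, i < 5 -> bag f i != set0) ->
  (forall i, i < 5 -> conn (bag f i)) ->
  (forall i j, i < j -> j < 5 -> touch (bag f i) (bag f j) = house_edge i j) ->
  house F.
Proof.
move=> fK fN f0 fc ft; have [f' [f'E pE]] := descend fK fN.
exists f'; split.
- by move=> i i4; apply: pre_eq0; rewrite pE // f0.
- by move=> i i4; apply: conn_preK; rewrite pE //; exact: fc.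
move=> i j ij j4; rewrite -touch_pre ?pE ?(ltn_trans ij) ?ft //.
by rewrite bag_disjoint // neq_ltn ij.
Qed.

End Quotient.

Section Contract.

Variables (G : sgraph) (x y : G).
Hypothesis xy : edge x y.

Let nxy : x != y.
Proof. by apply: contraTneq xy => ->; rewrite edge_irr. Qed.

(** The value is never [None] because [x != y]; [insub] only builds the proof that the image differs
    from [y]. *)
Definition contract_map (u : G) : option (contract x y) :=
  insub (if u == y then x else u).

Lemma contract_fiber (t : contract x y) :
  fiber contract_map t = if val t == x then [set x; y] else [set val t].
Proof.
apply/setP=> u; rewrite inE /contract_map; have vt : val t != y := valP t.
have E (a : G) : a != y -> (insub a == Some t) = (a == val t).
  move=> ay; apply/eqP/eqP => [|->]; last exact: valK.
  by rewrite insubT => -[<-].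
have [->|uy] := eqVneq u y; rewrite E //; case: (eqVneq (val t) x) => tx; rewrite !inE.
- by rewrite ?eqxx ?orbT ?tx ?eqxx.
- by rewrite ?eqxx ?(negbTE tx) eq_sym ?(negbTE tx) ?(negbTE vt).
- by rewrite ?(negbTE uy) ?orbF ?tx.
- by rewrite ?(negbTE uy).
Qed.

Lemma contract_qmap : qmap contract_map.
Proof.
split.
- by move=> t; rewrite contract_fiber; case: ifP => _;
    apply/set0Pn; [exists x | exists (val t)]; rewrite !inE eqxx.
- move=> t; rewrite contract_fiber; case: ifP => _; [exact: conn2 | exact: conn1].
move=> t t' tt'.
have vt : val t != y := valP t.
have vt' : val t' != y := valP t'.
have vtt : val t != val t' by [].
have -> : edge t t' = [|| edge (val t) (val t'),
                  (val t == x) && edge y (val t') |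
                  (val t' == x) && edge y (val t)] by rewrite {1}/edge /= /contract_edge tt'.
rewrite !contract_fiber; apply/idP/touchP.
  case/or3P.
  - move=> e; exists (val t), (val t'); split=> //;
      by case: eqP => [->|_]; rewrite !inE eqxx.
  - case/andP=> /eqP tx e; exists y, (val t'); split=> //; first by rewrite tx eqxx !inE eqxx orbT.
    by case: eqP => [->|_]; rewrite !inE eqxx.
  - case/andP=> /eqP tx e; exists (val t), y; rewrite edge_sym; split=> //; last by rewrite tx eqxx !inE eqxx orbT.
    by case: eqP => [->|_]; rewrite !inE eqxx.
case=> u [v []].
case: (eqVneq (val t) x) vtt => [tx|tx] vtt; case: (eqVneq (val t') x) vtt => [tx'|tx'] vtt;
   rewrite !inE.
- by rewrite tx tx' eqxx in vtt.
- by case/orP=> /eqP-> /eqP-> e; rewrite ?tx e ?orbT.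
- move=> /eqP-> /orP[]/eqP-> e; first by rewrite tx' e.
  by rewrite [edge y (val t)]edge_sym e ?orbT.
- by move=> /eqP-> /eqP->->.
Qed.

End Contract.

Section Induced.

Variables (G : sgraph) (X : {set G}).

Definition induced_edge : rel {u : G | u \in X} := fun u v => edge (val u) (val v).

Fact induced_edge_sym : symmetric induced_edge.
Proof. by move=> u v; exact: edge_sym. Qed.

Fact induced_edge_irr : irreflexive induced_edge.
Proof. by move=> u; exact: edge_irr. Qed.

Definition induced := SGraph induced_edge_sym induced_edge_irr.

Definition induced_map (u : G) : option induced := insub u.

Lemma induced_fiber (t : induced) : fiber induced_map t = [set val t].
Proof.
apply/setP=> u; rewrite !inE /induced_map.
by case: insubP => [v _ <-|/negbTE uX]; [|apply/esym/eqP => ut; rewrite ut (valP t) in uX].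
Qed.

Lemma induced_qmap : qmap induced_map.
Proof.
split=> [t|t|t t' tt']; rewrite ?induced_fiber.
- by apply/set0Pn; exists (val t); rewrite inE.
- exact: conn1.
apply/idP/touchP => [e|[u [v []]]]; first by exists (val t), (val t'); rewrite !inE.
by rewrite !inE => /eqP-> /eqP->.
Qed.

End Induced.

Section Delete.

Variables (G : sgraph) (x : G).

Definition delete_map (u : G) : option (delete_vertex x) := insub u.

Lemma delete_fiber (t : delete_vertex x) : fiber delete_map t = [set val t].
Proof.
apply/setP=> u; rewrite !inE /delete_map.
by case: insubP => [v _ <-|/negbTE uX]; [|apply/esym/eqP => ut; rewrite ut (valP t) in uX].
Qed.

Lemma delete_qmap : qmap delete_map.
Proof.
split=> [t|t|t t' tt']; rewrite ?delete_fiber.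
- by apply/set0Pn; exists (val t); rewrite inE.
- exact: conn1.
apply/idP/touchP => [e|[u [v []]]]; first by exists (val t), (val t'); rewrite !inE.
by rewrite !inE => /eqP-> /eqP->.
Qed.

End Delete.

Lemma card_sigC1 (T : finType) (x : T) : #|{: {u : T | u != x}}| < #|T|.
Proof.
rewrite card_sub (eq_card (B := predC1 x)) // cardC1 prednK //.
by apply/card_gt0P; exists x.
Qed.

Definition full_house_label (t : full_house) : nat := oapp (@nat_of_ord 4) 4 t.

Lemma full_house_label_inj : injective full_house_label.
Proof.
move=> [i|] [j|] //=; rewrite /full_house_label /=.
- by move/val_inj->.
- by move=> e; have := ltn_ord i; rewrite e.
- by move=> e; have := ltn_ord j; rewrite -e.
Qed.

Lemma full_house_label_lt t : full_house_label t < 5.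
Proof. by case: t => [i|] //=; apply: leq_trans (ltn_ord i) _. Qed.

Lemma full_house_edge (s t : full_house) : full_house_label s < full_house_label t ->
  edge s t = house_edge (full_house_label s) (full_house_label t).
Proof.
rewrite /house_edge; case: s t => [i|] [j|] //=; rewrite /full_house_label /=.
- move=> ij; rewrite /complete_edge (ltn_eqF (ltn_ord j)) /=.
  by apply: contraTneq ij => ->; rewrite ltnn.
- by move=> _; rewrite inE /= -leqNgt.
- by move=> h; have := ltn_trans h (ltn_ord j).
Qed.

Lemma full_house_label_onto i : i < 5 -> exists t, full_house_label t = i.
Proof.
rewrite ltnS leq_eqVlt => /orP[/eqP->|i4]; first by exists None.
by exists (Some (Ordinal i4)).
Qed.

Lemma house_iso (G : sgraph) : isomorphic G full_house -> house G.
Proof.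
move=> [f [f' fK f'K] fe]; pose l u := full_house_label (f u).
have bagE t : bag l (full_house_label t) = [set f' t].
  apply/setP=> u; rewrite !inE /l; apply/eqP/eqP => [/full_house_label_inj<-//|->].
  by rewrite f'K.
exists l; split.
- move=> i /full_house_label_onto[t <-]; rewrite bagE.
  by apply/set0Pn; exists (f' t); rewrite inE.
- by move=> i /full_house_label_onto[t <-]; rewrite bagE; exact: conn1.
move=> i j ij j5; have [s si] := full_house_label_onto (ltn_trans ij j5).
have [t tj] := full_house_label_onto j5.
rewrite -si -tj !bagE -full_house_edge ?si ?tj // -[in RHS](f'K s) -[in RHS](f'K t) fe.
apply/touchP/idP => [[u [v []]]|e]; first by rewrite !inE => /eqP-> /eqP->.
by exists (f' s), (f' t); rewrite !inE.
Qed.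

(** From a model back to a minor: a vertex in no bag can be deleted and an edge inside a bag
    contracted. When neither exists, the connected bags are singletons and the labelling is an
    isomorphism. *)
Lemma induced_minor_house (G : sgraph) : induced_minor full_house G <-> house G.
Proof.
split.
  elim=> {}G; first exact: house_iso.
    by move=> x _; apply: house_quot (delete_qmap x).
  by move=> x y xy _; apply: house_quot (contract_qmap xy).
have [n] := ubnP #|G|; elim: n G => // n IH G leGn [f [f0 fc ft]].
case: (boolP [exists x, 5 <= f x]) => [/existsP[x fx]|/existsPn f5].
  apply: (@induced_minor_delete _ _ x); apply: IH.
    by rewrite -ltnS; apply: leq_trans leGn; rewrite ltnS card_sigC1.
  have fN u : delete_map x u = None -> 5 <= f u.
    by rewrite /delete_map; case: insubP => // /negPn/eqP->.
  apply: (house_descend (delete_qmap x) _ fN f0 fc ft).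
  move=> u v t; rewrite /delete_map; case: insubP => // a _ <- [<-].
  by case: insubP => // b _ <- [<-].
case: (boolP [exists x, exists y, edge x y && (f x == f y)]).
  move=> /existsP[x /existsP[y /andP[xy /eqP fxy]]].
  apply: (@induced_minor_contract _ _ x y xy); apply: IH.
    by rewrite -ltnS; apply: leq_trans leGn; rewrite ltnS card_sigC1.
  apply: (house_descend (contract_qmap xy) _ _ f0 fc ft).
    have key u t : contract_map x y u = Some t -> f u = f (val t).
      rewrite /contract_map; case: insubP => // a _ ea [<-].
      by rewrite ea; case: (eqVneq u y) => [->|].
    by move=> u v t /key-> /key->.
  move=> u; rewrite /contract_map; case: insubP => //.
  case: (eqVneq u y) => [_|uy]; rewrite ?uy // => /negPn/eqP e _.
  by move: xy; rewrite e edge_irr.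
move=> /existsPn Hxy.
have finj : injective f.
  move=> x y fxy; apply/eqP; apply: contraT => nxy.
  have cx := fc (f x) _; rewrite ltnNge (f5 x) in cx.
  have [] := @conn_cross _ _ [set x] (cx isT); first by exists x; rewrite !inE.
    by apply/subsetPn; exists y; rewrite !inE ?fxy // eq_sym.
  move=> u [v [uX vX uS vS uv]]; have /existsPn /(_ v) := Hxy u.
  by rewrite uv; move: uX vX; rewrite !inE => /eqP-> /eqP->; rewrite eqxx.
apply: induced_minor_iso.
have hx u : exists t, full_house_label t == f u.
  by have [|t e] := @full_house_label_onto (f u); [rewrite ltnNge f5 | exists t; rewrite e].
pose h u := xchoose (hx u).
have hE u : full_house_label (h u) = f u by apply/eqP; exact: (xchooseP (hx u)).
have hy t : exists u, f u == full_house_label t.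
  by have /set0Pn[u] := f0 _ (full_house_label_lt t); rewrite inE; exists u.
pose h' t := xchoose (hy t).
have h'E t : f (h' t) = full_house_label t by apply/eqP; exact: (xchooseP (hy t)).
exists h; first exists h'.
- by move=> u; apply: finj; rewrite h'E hE.
- by move=> t; apply: full_house_label_inj; rewrite hE h'E.
have key u v : f u < f v -> edge (h u) (h v) = edge u v.
  move=> uv; rewrite full_house_edge ?hE // -ft //; last by rewrite ltnNge f5.
  apply/touchP/idP => [[a [b []]]|e]; last by exists u, v; rewrite !inE.
  by rewrite !inE => /eqP/finj-> /eqP/finj->.
move=> u v; case: (ltngtP (f u) (f v)) => [/key//|/key|/finj->].
  by rewrite edge_sym => ->; rewrite edge_sym.
by rewrite !edge_irr.
Qed.

(** * Eliminating vertices of degree at most 2 *)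

Section Elimination.

Variable G : sgraph.
Implicit Types (X : {set G}) (u v w l : G).

Definition nbrs X u := [set w in X | edge u w].

Lemma nbrs_le2 X l a b c : #|nbrs X l| <= 2 -> a \in X -> b \in X -> c \in X ->
  edge l a -> edge l b -> edge l c -> [|| a == b, a == c | b == c].
Proof.
move=> d2 aX bX cX la lb lc; apply: contraTT d2; rewrite !negb_or => /and3P[ab ac bc].
rewrite -ltnNge; have -> : 3 = #|[set a; b; c]|.
  by rewrite setUC cardsU1 cards2 !inE eq_sym negb_or ac eq_sym bc ab.
apply/subset_leq_card/subsetP => z; rewrite !inE -orbA => /or3P[]/eqP->;
  by apply/andP.
Qed.

Variable l : G.

(** The vertex type is unchanged and [l] keeps its edges; it will leave the set [X] instead, so that
    eliminations can be iterated on one type. *)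
Definition fill_edge : rel G :=
  fun u v => (u != v) && (edge u v || edge l u && edge l v).

Fact fill_edge_sym : symmetric fill_edge.
Proof. by move=> u v; rewrite /fill_edge eq_sym edge_sym [_ && edge l v]andbC. Qed.

Fact fill_edge_irr : irreflexive fill_edge.
Proof. by move=> u; rewrite /fill_edge eqxx. Qed.

Definition fill := SGraph fill_edge_sym fill_edge_irr.

Lemma edge_fill u v : edge u v -> @edge fill u v.
Proof.
move=> uv; rewrite /edge /= /fill_edge uv andbT.
by apply: contraTneq uv => ->; rewrite edge_irr.
Qed.

Lemma touch_fill (A B : {set G}) : touch A B -> @touch fill A B.
Proof.
by move=> /touchP[u [v [? ? ?]]]; apply/touchP; exists u, v; split=> //; apply: edge_fill.
Qed.

Lemma conn_fill (A : {set G}) : conn A -> @conn fill A.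
Proof. by move=> cA S hS clS; apply: cA => // u v ? ? uv; apply: clS => //; apply: edge_fill. Qed.

(** Were [l] alone in its bag, it would have neighbours in the three other bags. Otherwise it has a
    neighbour [w] in its bag, and fill edges at [w] replace the connections through [l]. *)
Lemma k4_fill X : l \in X -> #|nbrs X l| <= 2 -> @k4 G X -> @k4 fill (X :\ l).
Proof.
move=> lX d2 [f [fX f0 fc ft]].
case: (ltnP (f l) 4) => fl; last first.
  exists f; split=> //.
  - move=> u fu; rewrite !inE fX // andbT.
    by apply: contraTneq fu => ->; rewrite -leqNgt.
  - by move=> i i4; apply: conn_fill; exact: fc.
  - by move=> i j ij j4; apply: touch_fill; exact: ft.
have tch j : j < 4 -> j != f l -> touch (bag f (f l)) (bag f j).
  move=> j4; rewrite neq_ltn => /orP[] h; last exact: ft.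
  by rewrite touchC; apply: ft.
have [w wl lw] : exists2 w, w \in bag f (f l) :\ l & edge l w.
  have [w|h] := pickP [pred w | w \in bag f (f l) :\ l].
    rewrite !inE => /andP[wl /eqP fw].
    have [] := @conn_cross _ _ [set l] (fc _ fl).
    - by exists l; rewrite !inE.
    - by apply/subsetPn; exists w; rewrite !inE ?fw.
    move=> a [b [_ bX /set1P-> bl e]]; exists b => //.
    by rewrite inE bl.
  have bl : bag f (f l) = [set l].
    apply/setP=> u; rewrite !inE; apply/eqP/eqP=> [e|->//].
    by apply/eqP; have /negbT := h u; rewrite !inE e eqxx andbT negbK.
  have hn j : j < 4 -> j != f l -> exists2 a, f a = j & edge l a.
    move=> j4 jl; have /touchP[u [a]] := tch j j4 jl.
    by rewrite bl !inE => -[/eqP-> /eqP<- e]; exists a.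
  have no3 (i j k : nat) : i < 4 -> j < 4 -> k < 4 ->
     i != f l -> j != f l -> k != f l -> uniq [:: i; j; k] -> False.
    move=> i4 j4 k4 il jl kl /and3P[]; rewrite !inE negb_or => /andP[ij ik] jk _.
    have [a fa la] := hn i i4 il; have [b fb lb] := hn j j4 jl.
    have [c fc' lc] := hn k k4 kl.
    have := nbrs_le2 d2 (fX a _) (fX b _) (fX c _) la lb lc.
    rewrite fa fb fc' => /(_ i4 j4 k4)/or3P[]/eqP e.
    - by rewrite -fa -fb e eqxx in ij.
    - by rewrite -fa -fc' e eqxx in ik.
    - by rewrite -fb -fc' e eqxx in jk.
  case e: (f l) fl => [|[|[|[|//]]]] _.
  - by case: (no3 1 2 3); rewrite ?e.
  - by case: (no3 0 2 3); rewrite ?e.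
  - by case: (no3 0 1 3); rewrite ?e.
  - by case: (no3 0 1 2); rewrite ?e.
pose f' u := if u == l then 4 else f u.
have bagE i : i < 4 -> bag f' i = bag f i :\ l.
  move=> i4; apply/setP=> u; rewrite !inE /f'.
  by case: (eqVneq u l) => //= _; rewrite eq_sym (ltn_eqF i4).
have bagN i : i < 4 -> i != f l -> bag f' i = bag f i.
  move=> i4 il; rewrite bagE //; apply/setP=> u; rewrite !inE.
  by case: (eqVneq u l) => //= ->; rewrite eq_sym (negbTE il).
have tch' j : j < 4 -> j != f l -> @touch fill (bag f' (f l)) (bag f' j).
  move=> j4 jl; have /touchP[u [v [uX vX uv]]] := tch j j4 jl.
  rewrite bagE // bagN //; apply/touchP.
  have [ul|ul] := eqVneq u l; last first.
    by exists u, v; split=> //; [rewrite in_setD1 ul | apply: edge_fill].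
  subst u; exists w, v; split=> //.
  rewrite /edge /= /fill_edge lw uv orbT andbT.
  apply: contraTneq wl => ->; rewrite !inE negb_and; move: vX; rewrite inE => /eqP->.
  by rewrite jl orbT.
exists f'; split.
- by move=> u; rewrite /f' !inE; case: (eqVneq u l) => //= _ /fX.
- move=> i i4; have [->|il] := eqVneq i (f l); last by rewrite bagN ?f0.
  by rewrite bagE //; apply/set0Pn; exists w.
- move=> i i4; have [->|il] := eqVneq i (f l); last first.
    by rewrite bagN //; apply: conn_fill; exact: fc.
  rewrite bagE // => S [a aX aS] clS.
  (* A closed part [S] of the bag without [l] is completed by [l] exactly when it contains a
     neighbour of [l]; the fill edges make the result closed in [G]. *)
  pose ex := [exists b in bag f (f l) :\ l, (b \in S) && @edge G l b].
  have exP : reflect (exists2 b, b \in bag f (f l) :\ l & (b \in S) && @edge G l b) ex.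
    exact: exists_inP.
  pose S' := if ex then l |: S else S :\ l.
  have inS b : b != l -> (b \in S') = (b \in S).
    by move=> bl; rewrite /S'; case: ifP => _; rewrite !inE ?(negbTE bl) ?bl.
  suff sub : bag f (f l) \subset S'.
    apply/subsetP=> u; rewrite in_setD1 => /andP[ul uX].
    by rewrite -inS // (subsetP sub).
  apply: (fc _ fl).
    exists a; first by move: aX; rewrite in_setD1 => /andP[].
    by rewrite inS //; move: aX; rewrite in_setD1 => /andP[].
  move=> u v uX vX uv; have [ul|ul] := eqVneq u l.
    subst u; have vl : v != l by apply: contraTneq uv => ->; rewrite edge_irr.
    rewrite (inS v vl) /S'; case: exP => [[b bX /andP[bS lb]] _|_]; last by rewrite !inE eqxx.
    have [<-//|bv] := eqVneq b v; apply: (clS b v) => //; first by rewrite in_setD1 vl.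
    by rewrite /edge /= /fill_edge bv lb uv orbT.
  rewrite (inS u ul) => uS; have [vl|vl] := eqVneq v l.
    subst v; rewrite /S'; case: exP => [_|[]]; first by rewrite !inE eqxx.
    by exists u; rewrite ?in_setD1 ?ul // uS edge_sym.
  rewrite (inS v vl); apply: (clS u v) => //; rewrite ?in_setD1 ?ul ?vl //.
  exact: edge_fill.
move=> i j ij j4; have i4 := ltn_trans ij j4.
have [il|il] := eqVneq i (f l).
  by rewrite il tch' //; rewrite -il neq_ltn ij orbT.
have [jl|jl] := eqVneq j (f l); first by rewrite jl touchC tch'.
by rewrite !bagN //; apply: touch_fill; exact: ft.
Qed.

(** A fill edge inside [X] joins the only two neighbours of [l]. If one of them, [v], lies in a bag,
    [l] joins that bag and a path through [l] replaces the fill edge; if none does, no bag uses a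
    fill edge. *)
Lemma fill_k4 X : l \in X -> #|nbrs X l| <= 2 -> @k4 fill (X :\ l) -> @k4 G X.
Proof.
move=> lX d2 [f [fX f0 fc ft]].
have fX' u : f u < 4 -> u \in X by move/fX; rewrite !inE => /andP[].
have fl : 4 <= f l by rewrite leqNgt; apply/negP=> /fX; rewrite !inE eqxx.
have fillE u v : @edge fill u v -> edge u v \/ edge l u /\ edge l v /\ u != v.
  by rewrite /edge /= /fill_edge => /andP[uv /orP[|/andP[]]]; [left|right].
case: (pickP [pred v | edge l v && (f v < 4)]) => [v /= /andP[lv fv]|hno]; last first.
  have fE u w : f u < 4 -> @edge fill u w -> edge u w.
    by move=> fu /fillE[//|[lu _]]; have := hno u; rewrite /= lu fu.
  exists f; split=> //.
  - move=> i i4 S hS clS; apply: fc => // u w uX wX /fE uw; apply: (clS u w) => //.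
    by apply: uw; move: uX; rewrite inE => /eqP->.
  move=> i j ij j4; have /touchP[u [w [uX wX uw]]] := ft i j ij j4.
  apply/touchP; exists u, w; split=> //; apply: fE uw.
  by move: uX; rewrite inE => /eqP->; apply: ltn_trans ij j4.
pose f' u := if u == l then f v else f u.
have bagN i : i < 4 -> i != f v -> bag f' i = bag f i.
  move=> i4 il; apply/setP=> u; rewrite !inE /f'; case: (eqVneq u l) => // ->.
  by rewrite eq_sym (negbTE il) eq_sym ltn_eqF // (leq_trans i4).
have bagE : bag f' (f v) = l |: bag f (f v).
  by apply/setP=> u; rewrite !inE /f'; case: (eqVneq u l) => //= _; rewrite eqxx.
have bagS i : bag f i \subset bag f' i \/ 4 <= i.
  case: (ltnP i 4); [left|by right].
  have [->|iv] := eqVneq i (f v); first by rewrite bagE subsetU1.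
  by rewrite bagN.
exists f'; split.
- by move=> u; rewrite /f'; case: (eqVneq u l) => [->|_ /fX'].
- move=> i i4; case: (bagS i); last by rewrite leqNgt i4.
  have /set0Pn[u ui] := f0 i i4; move=> /subsetP/(_ _ ui) h.
  by apply/set0Pn; exists u.
- move=> i i4; have [->|iv] := eqVneq i (f v); last first.
    rewrite bagN // => S hS clS; apply: fc => // a b aX bX.
    case/fillE=> [|[la [lb ab]]]; first exact: clS.
    have fa : f a = i by move: aX; rewrite inE => /eqP.
    have fb : f b = i by move: bX; rewrite inE => /eqP.
    have := nbrs_le2 d2 (fX' a _) (fX' b _) (fX' v _) la lb lv.
    rewrite fa fb => /(_ i4 i4 fv)/or3P[]/eqP e.
    + by rewrite e eqxx in ab.
    + by rewrite -fa e eqxx in iv.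
    + by rewrite -fb e eqxx in iv.
  rewrite bagE => S [a aX aS] clS.
  have lB : l \in l |: bag f (f v) by rewrite !inE eqxx.
  have inB u : u \in bag f (f v) -> u \in l |: bag f (f v) by rewrite !inE => ->; rewrite orbT.
  have vB : v \in bag f (f v) by rewrite inE.
  have [b bX bS] : exists2 b, b \in bag f (f v) & b \in S.
    case/setU1P: aX => [al|aX]; last by exists a.
    by exists v => //; apply: (clS l v) => //; [exact: inB | rewrite -al].
  have sub : bag f (f v) \subset S.
    apply: fc => //; first by exists b.
    move=> p q pX qX /fillE[pq|[lp [lq _]]] pS; first by apply: (clS p q) => //; exact: inB.
    apply: (clS l q) => //; first exact: inB.
    by apply: (clS p l) => //; [exact: inB | rewrite edge_sym].
  rewrite subUset sub andbT sub1set; apply: (clS v l) => //; first exact: inB.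
    by rewrite edge_sym.
  exact: (subsetP sub).
move=> i j ij j4; have i4 := ltn_trans ij j4.
have /touchP[a [b [aX bX]]] := ft i j ij j4.
case: (bagS i); last by rewrite leqNgt i4.
case: (bagS j); last by rewrite leqNgt j4.
move=> /subsetP sj /subsetP si /fillE[ab|[la [lb ab]]].
  by apply/touchP; exists a, b; split; auto.
have fa : f a = i by move: aX; rewrite inE => /eqP.
have fb : f b = j by move: bX; rewrite inE => /eqP.
have := nbrs_le2 d2 (fX' a _) (fX' b _) (fX' v _) la lb lv.
rewrite fa fb => /(_ i4 j4 fv)/or3P[]/eqP e; first by rewrite e eqxx in ab.
  apply/touchP; exists l, b; split; auto.
  by rewrite -fa e bagE !inE eqxx.
apply/touchP; exists a, l; rewrite edge_sym; split; auto.
by rewrite -fb e bagE !inE eqxx.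
Qed.

End Elimination.

Lemma k4_eliminate (G : sgraph) (l : G) (X : {set G}) : l \in X -> #|nbrs X l| <= 2 ->
  @k4 G X <-> @k4 (fill l) (X :\ l).
Proof. by move=> lX d2; split; [exact: k4_fill | exact: fill_k4]. Qed.

Section Clique.

Variable G : sgraph.
Implicit Types (X : {set G}) (u v : G).

Lemma k4_clique X : 4 <= #|X| -> {in X &, forall u v, u != v -> edge u v} -> k4 X.
Proof.
rewrite cardE => X4 clX.
have [x0 _] : exists x, x \in X.
  by apply/card_gt0P; rewrite cardE; apply: leq_trans X4.
pose f u := if u \in X then index u (enum X) else 4.
have nX i : i < 4 -> nth x0 (enum X) i \in X.
  by move=> i4; rewrite -mem_enum mem_nth // (leq_trans i4).
have fn i : i < 4 -> f (nth x0 (enum X) i) = i.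
  by move=> i4; rewrite /f nX // index_uniq ?enum_uniq // (leq_trans i4).
have bagE i : i < 4 -> bag f i = [set nth x0 (enum X) i].
  move=> i4; apply/setP=> u; rewrite !inE; apply/eqP/eqP=> [|->]; last exact: fn.
  rewrite /f; case: ifP => uX; last by move=> e; rewrite -e in i4.
  by move=> <-; rewrite nth_index // mem_enum.
exists f; split.
- by move=> u; rewrite /f; case: ifP.
- by move=> i i4; rewrite bagE //; apply/set0Pn; exists (nth x0 (enum X) i); rewrite inE.
- by move=> i i4; rewrite bagE //; exact: conn1.
move=> i j ij j4; have i4 := ltn_trans ij j4.
rewrite !bagE //; apply/touchP; exists (nth x0 (enum X) i), (nth x0 (enum X) j).
rewrite !inE !eqxx; split=> //; apply: clX; rewrite ?nX //; apply: contraTneq ij => e.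
by rewrite -(fn i) // e fn // ltnn.
Qed.

End Clique.

Lemma card_nbrs_le (G : sgraph) (X Y : {set G}) u :
  nbrs X u \subset Y -> #|Y| <= 2 -> #|nbrs X u| <= 2.
Proof. by move=> s; apply: leq_trans; exact: subset_leq_card. Qed.

Lemma nbrs3P (G : sgraph) (X : {set G}) u a b c : #|nbrs X u| <= 3 ->
  a \in nbrs X u -> b \in nbrs X u -> c \in nbrs X u -> uniq [:: a; b; c] ->
  nbrs X u = [set a; b; c].
Proof.
move=> d3 ha hb hc; rewrite /= !inE negb_or andbT => /andP[/andP[ab ac] bc].
apply/esym/eqP; rewrite eqEcard; apply/andP; split.
  by apply/subsetP => z; rewrite in_setU in_set2 in_set1 -orbA => /or3P[]/eqP->.
by rewrite setUC cardsU1 cards2 !inE eq_sym negb_or ac eq_sym bc ab.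
Qed.

(** A pair of nonadjacent vertices, and not a single vertex, is what carries the induction: one of
    the two is not the merged vertex of a contraction, and one of them is not a neighbour of an
    eliminated vertex, as these neighbours become adjacent. *)
Lemma low_pair (G : sgraph) (X : {set G}) : ~ k4 X -> 4 <= #|X| ->
  exists s s', [/\ s \in X, s' \in X, s != s' & ~~ edge s s'] /\
    #|nbrs X s| <= 2 /\ #|nbrs X s'| <= 2.
Proof.
have [n] := ubnP #|X|; elim: n G X => // n IH G X leXn nk X4.
have [X5|X5] := ltnP 4 #|X|; last first.
  have X4' : #|X| = 4 by apply/eqP; rewrite eqn_leq X5.
  case: (boolP [exists s in X, exists s' in X, (s != s') && ~~ edge s s']); last first.
    move=> /existsPn h; case: nk; apply: k4_clique => // u v uX vX uv.
    have := h u; rewrite uX => /existsPn/(_ v).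
    by rewrite vX uv /= negbK.
  move=> /exists_inP[s sX /exists_inP[s' sX' /andP[ss ess]]]; exists s, s'; split=> //.
  have c2 : #|X :\: [set s; s']| <= 2.
    rewrite cardsD X4' (setIidPr _) ?cards2 ?ss //.
    by apply/subsetP=> z; rewrite !inE => /orP[]/eqP->.
  split; (apply: (card_nbrs_le _ c2); apply/subsetP=> z; rewrite !inE negb_or => /andP[-> e]);
    rewrite andbT; apply/andP; split; apply: contraTneq e => ->; rewrite ?edge_irr //.
  by rewrite edge_sym.
case: (boolP [exists l in X, #|nbrs X l| <= 2]) => [/exists_inP[l lX d2]|/existsPn deg3].
  have cX : #|X :\ l|.+1 = #|X| by rewrite (cardsD1 l X) lX.
  have [|||s [s' [[sX sX' ss ess] [ds ds']]]] := IH (fill l) (X :\ l).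
  - by rewrite -ltnS cX.
  - by move/(k4_eliminate lX d2).
  - by rewrite -ltnS cX.
  have key (a : G) : a \in X :\ l -> #|@nbrs (fill l) (X :\ l) a| <= 2 ->
      ~~ edge l a -> #|nbrs X a| <= 2.
    move=> aX da nla; apply: (@card_nbrs_le G X (@nbrs (fill l) (X :\ l) a) a _ da); apply/subsetP=> z; rewrite !inE => /andP[zX az].
    rewrite zX andbT (@edge_fill _ l a z az) andbT.
    by apply: contraNneq nla => <-; rewrite edge_sym.
  have : ~~ edge l s || ~~ edge l s'.
    rewrite -negb_and; apply: contra ess => /andP[ls ls'].
    by rewrite /edge /= /fill_edge ss ls ls' orbT.
  case/orP=> nl.
    exists l, s; move: (sX); rewrite !inE => /andP[sl sX0]; rewrite eq_sym.
    by split; split=> //; exact: key sX ds nl.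
  exists l, s'; move: (sX'); rewrite !inE => /andP[sl sX0]; rewrite eq_sym.
  by split; split=> //; exact: key sX' ds' nl.
have dge u : u \in X -> 3 <= #|nbrs X u|.
  by move=> uX; have := deg3 u; rewrite uX /= -ltnNge.
(* every edge lies in a triangle whose third vertex has degree 3 *)
have tri u v : u \in X -> v \in X -> edge u v ->
    exists s, [/\ s \in X, edge s u, edge s v & #|nbrs X s| = 3].
  move=> uX vX uv; have qm := contract_qmap uv.
  have nuv : u != v by apply: contraTneq uv => ->; rewrite edge_irr.
  pose X' := [set t : contract u v | val t \in X].
  have pX : pre (contract_map u v) X' = X.
    apply/setP=> z; rewrite inE /contract_map.
    have [->|zv] := eqVneq z v; first by rewrite insubT inE /= uX vX.
    by rewrite insubT inE.
  have vX' : val @: X' = X :\ v.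
    apply/setP=> z; apply/imsetP/setD1P => [[t]|[zv zX]].
      by rewrite inE => tX ->; split=> //; exact: (valP t).
    by exists (Sub z zv); rewrite ?inE.
  have cX' : #|X'|.+1 = #|X|.
    by rewrite -(card_imset _ val_inj) vX' (cardsD1 v X) vX.
  have [|||s [s' [[sX sX' ss ess] [ds ds']]]] := IH (contract u v) X'.
  - by rewrite -ltnS cX'.
  - by move/(k4_quot qm); rewrite pX.
  - by rewrite -ltnS cX'.
  wlog su : s s' sX sX' ss ess ds ds' / val s != u.
    move=> W; have [su|su] := eqVneq (val s) u; last exact: (W s s').
    apply: (W s' s); rewrite 1?eq_sym 1?edge_sym //.
    by apply: contraNneq ss => su'; apply/eqP; apply: val_inj; rewrite su su'.
  have sv : val s != v := valP s.
  have sXX : val s \in X by move: sX; rewrite inE.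
  have eE (t : contract u v) : edge s t =
     (s != t) && (edge (val s) (val t) || (val t == u) && edge v (val s)).
    by rewrite {1}/edge /= /contract_edge (negbTE su).
  have nE : val @: @nbrs (contract u v) X' s =
     (nbrs X (val s) :\ v) :|: (if edge (val s) v then [set u] else set0).
    apply/setP=> z; apply/imsetP/idP.
      move=> [t]; rewrite !inE eE => /andP[tX /andP[st h]] ->; rewrite (valP t) tX /=.
      case/orP: h => [->//|/andP[/eqP-> e]]; rewrite [edge (val s) v]edge_sym e.
      by rewrite inE eqxx orbT.
    case/setUP.
      rewrite !inE => /and3P[zv zX e]; exists (Sub z zv) => //.
      rewrite !inE zX eE /= e andbT; apply: contraTneq e => ->.
      by rewrite edge_irr.
    case: ifP => e; rewrite inE // => /eqP->; exists (Sub u nuv) => //.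
    rewrite !inE uX eE /= eqxx [edge v _]edge_sym e orbT andbT.
    by apply: contraNneq su => ->.
  have cn : #|(nbrs X (val s) :\ v) :|: (if edge (val s) v then [set u] else set0)| <= 2.
    by rewrite -nE card_imset //; exact: val_inj.
  (* The contraction lowers the degree of [s] from at least 3 to at most 2, so [s] sees both [u] and
     [v] and has degree exactly 3. *)
  have := dge _ sXX; rewrite (cardsD1 v) inE vX /=.
  case e: (edge (val s) v) cn => cn; last first.
    by rewrite setU0 in cn; rewrite add0n leqNgt ltnS cn.
  rewrite add1n ltnS => c2; exists (val s); split=> //; last first.
    rewrite (cardsD1 v) inE vX e add1n; congr S; apply/eqP; rewrite eqn_leq c2 andbT.
    by apply: leq_trans cn; apply: subset_leq_card; exact: subsetUl.
  have : nbrs X (val s) :\ v == (nbrs X (val s) :\ v) :|: [set u].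
    by rewrite eqEcard subsetUl (leq_trans cn c2).
  by move/eqP/setP/(_ u); rewrite !inE eqxx orbT => /and3P[].
have [u uX] : exists u, u \in X by apply/card_gt0P; apply: leq_trans X4.
have [v [vX uv]] : exists v, v \in X /\ edge u v.
  have /card_gt0P[v] : 0 < #|nbrs X u| by apply: leq_trans (dge u uX).
  by rewrite inE => /andP[]; exists v.
have [s [sX su sv ds]] := tri u v uX vX uv.
have nn (a b : G) : edge a b -> a != b by move=> e; apply: contraTneq e => ->; rewrite edge_irr.
have /card_gt0P[t] : 0 < #|nbrs X s :\: [set u; v]|.
  by rewrite cardsD ds subn_gt0; apply: leq_ltn_trans (subset_leq_card (subsetIr _ _)) _;
    rewrite cards2 ltnS; case: (_ != _).
rewrite !inE negb_or => /andP[/andP[tu tv] /andP[tX st]].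
have Ns : nbrs X s = [set u; v; t].
  by apply: nbrs3P; rewrite ?ds ?inE ?uX ?vX ?tX ?su ?sv ?st //= !inE negb_or
    (nn _ _ uv) eq_sym tu eq_sym tv.
have [r [rX rs rt dr]] := tri s t sX tX st.
(* [s] and [r] are adjacent twins of degree 3; [p], [t] are their common neighbours *)
have [p [pX pr pt [Ns' sp rp]]] : exists p, [/\ p \in X, p != r, p != t &
    [/\ nbrs X s = [set r; p; t], edge s p & edge r p]].
  have : r \in nbrs X s by rewrite inE rX edge_sym.
  rewrite Ns !inE -orbA => /or3P[]/eqP e; subst r.
  - by exists v; rewrite eq_sym (nn _ _ uv) eq_sym tv.
  - by exists u; rewrite (nn _ _ uv) eq_sym tu [[set u; v]]setUC [edge v u]edge_sym uv su.
  - by rewrite edge_irr in rt.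
have Nr : nbrs X r = [set s; p; t].
  apply: nbrs3P; rewrite ?dr ?inE ?sX ?pX ?tX ?rs ?rp ?rt //= !inE negb_or.
  by rewrite (nn _ _ sp) (nn _ _ st) pt.
have rX1 : s \in X :\ r by rewrite in_setD1 sX nn // edge_sym.
have sd2 : #|nbrs (X :\ r) s| <= 2.
  apply: (@card_nbrs_le _ _ [set p; t]); last by rewrite cards2; case: (_ != _).
  apply/subsetP=> z; have /setP/(_ z) := Ns'; rewrite !inE.
  by case: (z == r) => //= ->.
have cX : #|X :\ r :\ s|.+2 = #|X| by rewrite (cardsD1 r X) rX (cardsD1 s (X :\ r)) rX1.
have nk' : ~ @k4 (fill s) (X :\ r :\ s).
  by move/(k4_eliminate rX1 sd2)/(k4S (subD1set _ _)).
(* Such a [z] sees neither [r] nor [s], so deleting [r] and eliminating [s] leaves its degree at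
   least 3. *)
have lowz z : z \in X -> z != r -> z != s -> z != p -> z != t ->
    #|@nbrs (fill s) (X :\ r :\ s) z| <= 2 -> False.
  move=> zX zr zs zp zt; rewrite leqNgt => /negP[]; apply: leq_trans (dge z zX) _.
  apply: subset_leq_card; apply/subsetP=> y; rewrite !inE => /andP[yX zy].
  rewrite yX (@edge_fill _ s z y zy) !andbT; apply/andP; split.
    apply: contraTneq zy => ->; apply/negP; rewrite edge_sym => e.
    by have /setP/(_ z) := Ns'; rewrite !inE zX e (negbTE zr) (negbTE zp) (negbTE zt).
  apply: contraTneq zy => ->; apply/negP; rewrite edge_sym => e.
  by have /setP/(_ z) := Nr; rewrite !inE zX e (negbTE zs) (negbTE zp) (negbTE zt).
have [X6|X6] := leqP 4 #|X :\ r :\ s|.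
  have [|a [b [[aX bX ab eab] [da db]]]] := IH (fill s) _ _ nk' X6.
    by rewrite -ltnS; apply: leq_trans leXn; rewrite -cX ltnS leqnSn.
  (* Eliminating [s] makes [p] and [t] adjacent, so one of [a], [b] lies outside [[set p; t]]. *)
  wlog /andP[ap at_] : a b aX bX ab eab da db / (a != p) && (a != t).
    move=> W; case: (boolP ((a != p) && (a != t))) => h; first exact: (W a b).
    apply: (W b a) => //; [by rewrite eq_sym | by rewrite edge_sym |].
    have ept : @edge (fill s) p t by rewrite /edge /= /fill_edge pt sp st orbT.
    rewrite negb_and !negbK in h; case/orP: h => /eqP e; subst a; apply/andP; split.
    - by rewrite eq_sym.
    - by apply: contraNneq eab => ->.
    - by apply: contraNneq eab => ->; rewrite edge_sym.
    - by rewrite eq_sym.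
  move: aX; rewrite !inE => /and3P[as_ ar aX].
  by case: (lowz a).
(* Only [p], [t] and one more vertex [z] remain, which has too few possible neighbours. *)
have /card_gt0P[z] : 0 < #|(X :\ r :\ s) :\: [set p; t]|.
  rewrite cardsD subn_gt0; apply: leq_ltn_trans (subset_leq_card (subsetIr _ _)) _.
  have h2 : 2 < #|X :\ r :\ s| by rewrite -2!ltnS cX.
  by apply: leq_ltn_trans h2; rewrite cards2; case: (_ != _).
rewrite !inE negb_or => /andP[/andP[zp zt] /and3P[zs zr zX]].
case: (lowz z) => //; apply: (@card_nbrs_le (fill s) (X :\ r :\ s) [set p; t]); last by rewrite cards2; case: (_ != _).
have /subset_leq_card : [set p; t; z] \subset X :\ r :\ s.
  apply/subsetP=> y; rewrite !inE -orbA => /or3P[]/eqP->; rewrite ?zX ?zs ?zr ?pX ?tX ?pr //=.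
    by rewrite andbT eq_sym nn.
  by rewrite [t == s]eq_sym nn // [t == r]eq_sym nn.
have c3 : #|[set p; t; z]| = 3.
  by rewrite setUC cardsU1 cards2 !inE negb_or zp zt pt.
rewrite c3 => h3.
have /eqP <- : [set p; t; z] == X :\ r :\ s.
  rewrite eqEcard; apply/andP; split; last by rewrite c3 -ltnS.
  apply/subsetP=> y; rewrite !inE -orbA => /or3P[]/eqP->; rewrite ?zX ?zs ?zr ?pX ?tX ?pr //=.
    by rewrite andbT eq_sym nn.
  by rewrite [t == s]eq_sym nn // [t == r]eq_sym nn.
apply/subsetP=> y; rewrite !inE -orbA => /andP[/or3P[]/eqP-> e]; rewrite ?eqxx ?orbT //.
by rewrite edge_irr in e.
Qed.

Lemma k4_of_min_degree (G : sgraph) (X : {set G}) : X != set0 ->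
  {in X, forall u, 2 < #|nbrs X u|} -> k4 X.
Proof.
move=> X0 d3; apply: NNPP => nk; have [u uX] := set0Pn _ X0.
have X4 : 4 <= #|X|.
  rewrite (cardsD1 u) uX add1n ltnS; apply: leq_trans (d3 u uX) _.
  apply: subset_leq_card; apply/subsetP=> z; rewrite !inE => /andP[-> e]; rewrite andbT.
  by apply: contraTneq e => ->; rewrite edge_irr.
have [s [_ [[sX _ _ _] [ds _]]]] := low_pair nk X4.
by have := d3 s sX; rewrite ltnNge ds.
Qed.

(** * Models with explicit bags *)

Section Bags.

Variable G : sgraph.
Implicit Types (X E : {set G}) (l m : seq G).

(** Every explicitly constructed bag has one or two vertices, so connectedness reduces to one
    adjacency test. *)
Definition linked l :=
  match l with [:: _] => true | [:: x; y] => edge x y | _ => false end.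

Definition tch l m := has (fun u => has (@edge G u) m) l.

Lemma linked_conn l : linked l -> conn [set u in l].
Proof.
case: l => [|x [|y [|]]] //= => [_|xy].
  by have -> : [set u in [:: x]] = [set x]; [apply/setP=> u; rewrite !inE | exact: conn1].
by have -> : [set u in [:: x; y]] = [set x; y]; [apply/setP=> u; rewrite !inE | exact: conn2].
Qed.

Lemma linked_neq0 l : linked l -> [set u in l] != set0.
Proof. by case: l => // x l _; apply/set0Pn; exists x; rewrite !inE eqxx. Qed.

Lemma touch_tch l m : touch [set u in l] [set u in m] = tch l m.
Proof.
apply/touchP/hasP => [[u [v []]]|[u ul /hasP[v vm uv]]].
  by rewrite !inE => ul vm uv; exists u => //; apply/hasP; exists v.
by exists u, v; rewrite !inE.
Qed.

Definition label (ls : seq (seq G)) (u : G) := find (fun l => u \in l) ls.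

Lemma k4_lists la lb lc ld X : uniq (la ++ lb ++ lc ++ ld) ->
  {subset la ++ lb ++ lc ++ ld <= X} ->
  linked la -> linked lb -> linked lc -> linked ld ->
  tch la lb -> tch la lc -> tch la ld -> tch lb lc -> tch lb ld -> tch lc ld ->
  k4 X.
Proof.
rewrite !cat_uniq !has_cat !negb_or => /and5P[_ /and3P[/hasPn nab /hasPn nac /hasPn nad]].
move=> _ /andP[/hasPn nbc /hasPn nbd] /and3P[_ /hasPn ncd _] sub ca cb cc cd.
move=> tab tac tad tbc tbd tcd.
have E0 : bag (label [:: la; lb; lc; ld]) 0 = [set u in la].
  by apply/setP=> u; rewrite !inE /label /=; case: (u \in la); case: (u \in lb);
     case: (u \in lc); case: (u \in ld).
have E1 : bag (label [:: la; lb; lc; ld]) 1 = [set u in lb].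
  apply/setP=> u; rewrite !inE /label /=; case ua: (u \in la).
    by apply/esym/negbTE/negP => /nab; rewrite /= ua.
  by case: (u \in lb); case: (u \in lc); case: (u \in ld).
have E2 : bag (label [:: la; lb; lc; ld]) 2 = [set u in lc].
  apply/setP=> u; rewrite !inE /label /=; case ua: (u \in la).
    by apply/esym/negbTE/negP => /nac; rewrite /= ua.
  case ub: (u \in lb); first by apply/esym/negbTE/negP => /nbc; rewrite /= ub.
  by case: (u \in lc); case: (u \in ld).
have E3 : bag (label [:: la; lb; lc; ld]) 3 = [set u in ld].
  apply/setP=> u; rewrite !inE /label /=; case ua: (u \in la).
    by apply/esym/negbTE/negP => /nad; rewrite /= ua.
  case ub: (u \in lb); first by apply/esym/negbTE/negP => /nbd; rewrite /= ub.
  case uc: (u \in lc); first by apply/esym/negbTE/negP => /ncd; rewrite /= uc.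
  by case: (u \in ld).
exists (label [:: la; lb; lc; ld]); split.
- move=> u hu; apply: sub; rewrite !mem_cat.
  move: hu; rewrite /label /=; case: (u \in la) => //; case: (u \in lb) => //.
  by case: (u \in lc) => //; case: (u \in ld).
- by move=> [|[|[|[|//]]]] _; rewrite ?E0 ?E1 ?E2 ?E3 linked_neq0.
- by move=> [|[|[|[|//]]]] _; rewrite ?E0 ?E1 ?E2 ?E3; exact: linked_conn.
by case=> [|[|[|[|i]]]] [|[|[|[|j]]]] // _ _; rewrite ?E0 ?E1 ?E2 ?E3 touch_tch.
Qed.

Lemma house_lists la lb lc ld E : uniq (la ++ lb ++ lc ++ ld) ->
  {in la ++ lb ++ lc ++ ld, forall u, u \notin E} -> E != set0 -> conn E ->
  linked la -> linked lb -> linked lc -> linked ld ->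
  tch la lb -> tch la lc -> tch la ld -> tch lb lc -> tch lb ld -> tch lc ld ->
  touch [set u in la] E -> touch [set u in lb] E ->
  ~~ touch [set u in lc] E -> ~~ touch [set u in ld] E -> house G.
Proof.
rewrite !cat_uniq !has_cat !negb_or => /and5P[_ /and3P[/hasPn nab /hasPn nac /hasPn nad]].
move=> _ /andP[/hasPn nbc /hasPn nbd] /and3P[_ /hasPn ncd _] nE E0 cE ca cb cc cd.
move=> tab tac tad tbc tbd tcd tae tbe tce tde.
pose f u := if u \in E then 4 else if u \in la then 0 else if u \in lb then 1 else
  if u \in lc then 2 else if u \in ld then 3 else 5.
have nE' u : u \in E -> [/\ u \in la = false, u \in lb = false, u \in lc = false & u \in ld = false].
  move=> uE; have : u \notin la ++ lb ++ lc ++ ld by apply/negP => /nE; rewrite uE.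
  by rewrite !mem_cat !negb_or => /and4P[/negbTE-> /negbTE-> /negbTE-> /negbTE->].
have F0 : bag f 0 = [set u in la].
  apply/setP=> u; rewrite !inE /f; case uE: (u \in E).
    by have [-> _ _ _] := nE' u uE.
  by case: (u \in la); case: (u \in lb); case: (u \in lc); case: (u \in ld).
have F1 : bag f 1 = [set u in lb].
  apply/setP=> u; rewrite !inE /f; case uE: (u \in E).
    by have [_ -> _ _] := nE' u uE.
  case ua: (u \in la); first by apply/esym/negbTE/negP => /nab; rewrite /= ua.
  by case: (u \in lb); case: (u \in lc); case: (u \in ld).
have F2 : bag f 2 = [set u in lc].
  apply/setP=> u; rewrite !inE /f; case uE: (u \in E).
    by have [_ _ -> _] := nE' u uE.
  case ua: (u \in la); first by apply/esym/negbTE/negP => /nac; rewrite /= ua.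
  case ub: (u \in lb); first by apply/esym/negbTE/negP => /nbc; rewrite /= ub.
  by case: (u \in lc); case: (u \in ld).
have F3 : bag f 3 = [set u in ld].
  apply/setP=> u; rewrite !inE /f; case uE: (u \in E).
    by have [_ _ _ ->] := nE' u uE.
  case ua: (u \in la); first by apply/esym/negbTE/negP => /nad; rewrite /= ua.
  case ub: (u \in lb); first by apply/esym/negbTE/negP => /nbd; rewrite /= ub.
  case uc: (u \in lc); first by apply/esym/negbTE/negP => /ncd; rewrite /= uc.
  by case: (u \in ld).
have F4 : bag f 4 = E.
  apply/setP=> u; rewrite !inE /f; case: (u \in E) => //.
  by case: (u \in la); case: (u \in lb); case: (u \in lc); case: (u \in ld).
exists f; split.
- by move=> [|[|[|[|[|//]]]]] _; rewrite ?F0 ?F1 ?F2 ?F3 ?F4 ?linked_neq0.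
- by move=> [|[|[|[|[|//]]]]] _; rewrite ?F0 ?F1 ?F2 ?F3 ?F4 //; exact: linked_conn.
by case=> [|[|[|[|[|i]]]]] [|[|[|[|[|j]]]]] // _ _;
  rewrite ?F0 ?F1 ?F2 ?F3 ?F4 ?touch_tch ?tab ?tac ?tad ?tbc ?tbd ?tcd ?tae ?tbe
    ?(negbTE tce) ?(negbTE tde).
Qed.

End Bags.

(** * Minimal K4 minors and the exceptional graphs *)

Section Classes.

Variable G : sgraph.
Implicit Types (X Y : {set G}) (u v : G).

(* Nonadjacency is transitive, i.e. the graph is complete multipartite. *)
Definition cm X := {in X & &, forall e c d, edge c d -> edge e c || edge e d}.

(* The join of [K_2 + K_1], on [a], [b] and [c], with an independent set. *)
Definition exc X := exists a b c,
  [/\ a \in X, b \in X & c \in X] /\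
  [/\ edge a b, ~~ edge c a, ~~ edge c b, c != a & c != b] /\
  {in X :\: [set a; b; c], forall u, [&& edge u a, edge u b & edge u c]} /\
  {in X :\: [set a; b; c] &, forall u v, ~~ edge u v}.

Definition mink4 X := k4 X /\ {in X, forall u, ~ k4 (X :\ u)}.

Lemma cmS X Y : X \subset Y -> cm Y -> cm X.
Proof. by move=> /subsetP s cY e c d /s eY /s cY' /s dY; exact: cY. Qed.

Lemma edge_neq u v : edge u v -> u != v.
Proof. by move=> e; apply: contraTneq e => ->; rewrite edge_irr. Qed.

(** Eliminating a vertex with at most one neighbour adds no edge, so such a vertex does not occur in
    a minimal [K_4] minor. *)
Lemma fill_trivial u Y : {in Y &, forall a b, edge u a -> edge u b -> a = b} ->
  @k4 (fill u) Y -> k4 Y.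
Proof.
move=> h [f [fY f0 fc ft]].
have fE (a b : G) : f a < 4 -> f b < 4 -> @edge (fill u) a b -> @edge G a b.
  move=> fa fb; rewrite /edge /= /fill_edge => /andP[ab /orP[//|/andP[ua ub]]].
  by rewrite (h a b) ?eqxx // in ab; exact: fY.
exists f; split=> //.
  move=> i i4 S hS clS; apply: fc => // a b aX bX ab; apply: (clS a b) => //.
  by apply: (fE a b _ _ ab); [move: aX|move: bX]; rewrite inE => /eqP->.
move=> i j ij j4; have /touchP[a [b [aX bX ab]]] := ft i j ij j4.
apply/touchP; exists a, b; split=> //; apply: (fE a b _ _ ab).
  by move: aX; rewrite inE => /eqP->; exact: ltn_trans j4.
by move: bX; rewrite inE => /eqP->.
Qed.

Lemma mink4_deg X u : mink4 X -> u \in X -> 1 < #|nbrs X u|.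
Proof.
move=> [kX mX] uX; rewrite ltnNge; apply/negP=> d1.
apply: (mX u uX); apply: (@fill_trivial u).
  move=> a b; rewrite !inE => /andP[_ aX] /andP[_ bX] ua ub.
  by apply: (card_le1_eqP d1); rewrite inE ?aX ?bX.
by apply/(k4_eliminate uX) => //; apply: leq_trans d1 _.
Qed.

(** Every edge has an end adjacent to [a]. Applied to the edges between bags, this shows that the
    neighbourhood of [a] misses at most one of the four bags. *)
Lemma cm_deg X a : cm X -> k4 X -> a \in X -> 2 < #|nbrs X a|.
Proof.
move=> cX [f [fX f0 fc ft]] aX; rewrite ltnNge; apply/negP=> d2.
pose h i := [exists u in nbrs X a, f u == i].
have hij i j : i < j -> j < 4 -> h i || h j.
  move=> ij j4; have /touchP[u [v []]] := ft i j ij j4.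
  rewrite !inE => /eqP fu /eqP fv uv.
  have uX : u \in X by apply: fX; rewrite fu (ltn_trans ij).
  have vX : v \in X by apply: fX; rewrite fv.
  by case/orP: (cX a u v aX uX vX uv) => e; apply/orP; [left|right];
    apply/exists_inP; [exists u | exists v]; rewrite ?inE ?uX ?vX ?fu ?fv.
have h3 i j k : h i -> h j -> h k -> uniq [:: i; j; k] -> False.
  move=> /exists_inP[x + /eqP fx] /exists_inP[y + /eqP fy] /exists_inP[z + /eqP fz].
  rewrite !inE => /andP[xX ax] /andP[yX ay] /andP[zX az].
  have := nbrs_le2 d2 xX yX zX ax ay az.
  by rewrite -fx -fy -fz /= !inE negb_or => /or3P[]/eqP->; rewrite eqxx ?andbF.
have := hij 0 1 isT isT; have := hij 0 2 isT isT; have := hij 0 3 isT isT.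
have := hij 1 2 isT isT; have := hij 1 3 isT isT; have := hij 2 3 isT isT.
have := h3 0 1 2; have := h3 0 1 3; have := h3 0 2 3; have := h3 1 2 3.
by case: (h 0); case: (h 1); case: (h 2); case: (h 3) => //= A B C D *;
  (try by case: A); (try by case: B); (try by case: C); (try by case: D).
Qed.

(** With 7 vertices some [a] can be deleted while all degrees stay at least 3. If [a] has degree at
    most 3, then it has at least four nonneighbours, itself included, and each neighbour of [a] sees
    all of them, so it can afford to lose [a]. If all degrees exceed 3, any [a] will do. *)
Lemma cm_mink4_card X : cm X -> mink4 X -> #|X| <= 6.
Proof.
move=> cX [kX mX]; rewrite leqNgt; apply/negP=> X7.
have dX u : u \in X -> 2 < #|nbrs X u| by exact: cm_deg.
have [a aX h] : exists2 a, a \in X &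
    {in X :\ a, forall u, edge a u -> 3 < #|nbrs X u|}.
  case: (boolP [exists a in X, #|nbrs X a| <= 3]) => [/exists_inP[a aX d3]|/existsPn h].
    exists a => // u; rewrite !inE => /andP[ua uX] au.
    have : X :\: nbrs X a \subset nbrs X u.
      apply/subsetP=> w; rewrite !inE negb_and => /andP[+ wX]; rewrite wX /=.
      rewrite edge_sym => /negbTE nwa.
      by have := cX w a u wX aX uX au; rewrite nwa /= edge_sym.
    move/subset_leq_card; apply: leq_trans; rewrite cardsD (setIidPr _); last first.
      by apply/subsetP=> w; rewrite inE => /andP[].
    by rewrite ltn_subRL (leq_ltn_trans _ X7) // -[6]/(3 + 3) leq_add2r.
  have [a aX] : exists a, a \in X by apply/card_gt0P; apply: leq_trans X7.
  exists a => // u; rewrite !inE => /andP[_ uX] _.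
  by have := h u; rewrite uX /= -ltnNge.
apply: (mX a aX); apply: k4_of_min_degree.
  apply/set0Pn; have /card_gt0P[z] : 0 < #|nbrs X a| by apply: leq_trans (dX a aX).
  by rewrite inE => /andP[zX az]; exists z; rewrite !inE zX eq_sym edge_neq.
move=> u uX'; have := uX'; rewrite !inE => /andP[ua uX].
have -> : nbrs (X :\ a) u = nbrs X u :\ a by apply/setP=> z; rewrite !inE andbA.
have := cardsD1 a (nbrs X u); rewrite inE aX /= edge_sym.
case e: (edge a u) => /= E; last by have := dX u uX; rewrite E.
by have := h u uX' e; rewrite E add1n ltnS.
Qed.

(** Two of the four bags contain neither [p] nor [q]; they lie in an independent set and cannot
    touch. *)
Lemma k4_cover2 p q X : {in X :\: [set p; q] &, forall u v, ~~ edge u v} -> ~ k4 X.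
Proof.
move=> hI [f [fX f0 fc ft]].
have out u i : i < 4 -> f u = i -> f p != i -> f q != i -> u \in X :\: [set p; q].
  move=> i4 fu pi qi; rewrite !inE fX ?fu // andbT negb_or.
  by apply/andP; split; [apply: contraNneq pi | apply: contraNneq qi] => <-; rewrite fu.
have bad i j : i < j -> j < 4 -> [|| f p == i, f p == j, f q == i | f q == j].
  move=> ij j4; apply: contraT; rewrite !negb_or => /and4P[pi pj qi qj].
  have /touchP[u [v []]] := ft i j ij j4; rewrite !inE => /eqP fu /eqP fv uv.
  by have := hI u v (out u i (ltn_trans ij j4) fu pi qi) (out v j j4 fv pj qj); rewrite uv.
have := bad 0 1 isT isT; have := bad 0 2 isT isT; have := bad 0 3 isT isT.
have := bad 1 2 isT isT; have := bad 1 3 isT isT; have := bad 2 3 isT isT.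
by case: (f p) => [|[|[|[|?]]]]; case: (f q) => [|[|[|[|?]]]].
Qed.

(** If [v] were in the triple, the other two of its vertices would cover all edges. Beside [v] the
    independent part has exactly two vertices: at least two because [c] has degree at least 2, and
    not a third one [z], since the bags [a], [b], [x] and [y c] would avoid it. *)
Lemma exc_mink4 v : exc setT -> mink4 [set~ v] ->
  #|G| = 6 /\ exists a b c,
    [/\ edge a b, ~~ edge c a, ~~ edge c b & c != a] /\ c != b /\
    v \notin [set a; b; c] /\
    {in ~: [set a; b; c], forall u, [&& edge u a, edge u b & edge u c]} /\
    {in ~: [set a; b; c] &, forall u v, ~~ edge u v}.
Proof.
move=> [a [b [c [_ [[ab ca cb nca ncb] [hU hI]]]]]] mk.
have kv := mk.1; rewrite setTD in hU hI.
have nab := edge_neq ab.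
have cover z p q : [set a; b; c] = [set z; p; q] -> k4 [set~ z] -> False.
  move=> e; apply/(@k4_cover2 p q) => x y hx hy; apply: hI; rewrite e;
  [move: hx|move: hy]; rewrite !inE !negb_or => /andP[/andP[-> ->] ->] //.
have vU : v \notin [set a; b; c].
  apply/negP; rewrite !inE -orbA => /or3P[]/eqP e; subst v.
  - by apply: cover kv.
  - by apply: (cover b a c) => //; rewrite [[set b; a]]setUC.
  - by apply: (cover c a b) => //; rewrite setUC setUA.
have c3 : #|[set a; b; c]| = 3.
  by rewrite setUC cardsU1 cards2 !inE negb_or nca ncb nab.
split; last by exists a, b, c.
have c3' := cardsC [set a; b; c]; rewrite c3 in c3'.
have cv := cardsD1 v (~: [set a; b; c]); rewrite inE vU add1n in cv.
rewrite -c3' cv; suff -> : #|~: [set a; b; c] :\ v| = 2 by [].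
apply/eqP; rewrite eqn_leq; apply/andP; split; last first.
  have := mink4_deg mk (u := c); rewrite !inE eq_sym => /(_ _)/leq_trans; apply.
    by apply: contraNneq vU => ->; rewrite !inE eqxx orbT.
  apply: subset_leq_card; apply/subsetP=> z; rewrite !inE => /andP[-> e].
  by rewrite !negb_or andTb -andbA; apply/and3P; split; apply: contraTneq e => ->;
    rewrite ?edge_irr.
rewrite leqNgt; apply/negP=> /card_gt2P[x [y [z [[]]]]].
rewrite !(in_setD1, in_setC) => /andP[xv xU] /andP[yv yU] /andP[zv zU] [xy yz zx].
have zX : z \in [set~ v] by rewrite !inE.
apply: (mk.2 z zX).
have U u : u \notin [set a; b; c] -> [/\ edge u a, edge u b & edge u c].
  by move=> h; apply/and3P; apply: hU; rewrite inE.
have N u w : u \notin [set a; b; c] -> w \in [set a; b; c] -> u != w.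
  by move=> hu; apply: contraTneq => <-.
have [aA bA cA] : [/\ a \in [set a; b; c], b \in [set a; b; c] & c \in [set a; b; c]].
  by rewrite !inE !eqxx ?orbT.
have [xa xb xc] := U x xU; have [ya yb yc] := U y yU; have [za zb zc] := U z zU.
apply: (@k4_lists _ [:: a] [:: b] [:: x] [:: y; c]); rewrite /tch /= ?orbF //.
- by rewrite !inE !negb_or nab [a == x]eq_sym [a == y]eq_sym [b == x]eq_sym [b == y]eq_sym
    [a == c]eq_sym [b == c]eq_sym nca ncb xy !N.
- move=> u; rewrite !inE => /or4P[|||/orP[]]/eqP->.
  - by rewrite [a == z]eq_sym [a == v]eq_sym !N.
  - by rewrite [b == z]eq_sym [b == v]eq_sym !N.
  - by rewrite [x == z]eq_sym zx.
  - by rewrite yz.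
  - by rewrite [c == z]eq_sym [c == v]eq_sym !N.
- by rewrite edge_sym.
- by rewrite edge_sym ya.
- by rewrite edge_sym.
- by rewrite edge_sym yb.
- by rewrite xc orbT.
Qed.

End Classes.

(** * A finite check *)

Section Search.

Variable n : nat.
Variable adj : nat -> nat -> bool.

Definition hbag (i j : nat) := if i == j then [:: i] else [:: i; j].

Definition lnkn (l : seq nat) :=
  match l with [:: _] => true | [:: x; y] => adj x y | _ => false end.

Definition tchn (l m : seq nat) := has (fun i => has (adj i) m) l.

(* A hint [e; a; a'; b; b'; c; c'; d; d'] names the vertex [e] and the four bags
   of a full house, each with one or two elements. *)
Definition hint_wf (h : seq nat) :=
  if h is [:: e; a; a'; b; b'; c; c'; d; d'] then
    let s := e :: hbag a a' ++ hbag b b' ++ hbag c c' ++ hbag d d' in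
    all (gtn n) s && uniq s
  else false.

Definition hint_ok (h : seq nat) :=
  if h is [:: e; a; a'; b; b'; c; c'; d; d'] then
    let a := hbag a a' in let b := hbag b b' in
    let c := hbag c c' in let d := hbag d d' in
    [&& has (adj e) a, has (adj e) b, ~~ has (adj e) c, ~~ has (adj e) d &
     [&& tchn a b, tchn a c, tchn a d, tchn b c & [&& tchn b d, tchn c d,
      lnkn a, lnkn b, lnkn c & lnkn d]]]
  else false.

Definition cm_search := let r := iota 0 n in
  all (fun e => all (fun c => all (fun d => adj c d ==> (adj e c || adj e d)) r) r) r.

Definition exc_search := let r := iota 0 n in
  has (fun a => has (fun b => if adj a b then has (fun c =>
   [&& ~~ adj c a, ~~ adj c b, c != a, c != b &
    all (fun u => (u \in [:: a; b; c]) ||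
      [&& adj u a, adj u b, adj u c &
        all (fun w => (w \in [:: a; b; c]) || ~~ adj u w) r]) r]) r else false) r) r.

End Search.

Definition table n (adj : nat -> nat -> bool) :=
  [seq [seq adj i j | j <- iota 0 n] | i <- iota 0 n].

Definition lookup (t : seq (seq bool)) i j := nth false (nth [::] t i) j.

Fixpoint prods (A : Type) (ss : seq (seq A)) : seq (seq A) :=
  if ss is s :: ss' then [seq x :: t | x <- s, t <- prods ss'] else [:: [::]].

(* The graph on [x, y, v, ...] obtained by splitting vertex 0 of the graph with
   vertices [0, v, ...] and adjacency [R (lab i) (lab j)] into [x] and [y]. *)
Definition split_adj (R : rel nat) (lab : seq nat) (cols : seq (bool * bool)) i j :=
  match i, j with
  | 0, 0 | 1, 1 => false
  | 0, 1 | 1, 0 => true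
  | 0, j'.+1 => (nth (false, false) cols j').1
  | i'.+1, 0 => (nth (false, false) cols i').1
  | 1, j'.+1 => (nth (false, false) cols j').2
  | i'.+1, 1 => (nth (false, false) cols i').2
  | i'.+1, j'.+1 => R (nth 0 lab i') (nth 0 lab j')
  end.

(** A neighbour of the merged vertex sees [x], [y] or both; any other vertex sees neither. Column 0
    belongs to the merged vertex itself and is a dummy. *)
Definition col_options (R : rel nat) (lab : seq nat) :=
  [seq if (0 < i) && R (nth 0 lab 0) (nth 0 lab i)
       then [:: (true, false); (false, true); (true, true)]
       else [:: (false, false)] | i <- iota 0 (size lab)].

(** The guard keeps the splits in which [x] and [y] each have a neighbour other than [x], [y], [v]
    and [v] has degree at least 2; columns 0 and 1 are the dummy and [v], hence [drop 2]. Adjacency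
    is tabulated once, and nested conditionals are used because call by value would evaluate both
    sides of a disjunction. *)
Definition split_ok (R : rel nat) hints lab cols :=
  let n := (size lab).+1 in
  let t := table n (split_adj R lab cols) in
  let adj := lookup t in
  if [&& has fst (drop 2 cols), has snd (drop 2 cols) & 1 < count (adj 2) (iota 0 n)] then
    if has (hint_ok adj) hints then true else
    if cm_search n adj then true else exc_search n adj
  else true.

Definition all_splits_ok R hints n labs := all (hint_wf n.+1) hints &&
  all (fun lab => all (split_ok R hints lab) (prods (col_options R lab))) labs.

Definition neqr : rel nat := fun i j => i != j.

(** Labels 1, 2 and 3 are [a], [b] and [c], and 0 marks the independent set; among positive labels
    only 1 and 2 add up to 3. *)
Definition excr : rel nat := fun i j =>
  if i == 0 then j != 0 else if j == 0 then true else (i + j == 3).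

Definition deg_in (lab s : seq nat) i := count (fun j => nth 0 lab i != nth 0 lab j) s.

(* The complete multipartite graphs that are minimal for a [K_4] minor after
   deletion of vertex 1. *)
Definition cm_label (lab : seq nat) :=
  let s := 0 :: iota 2 (size lab - 2) in
  [&& all (fun i => nth 0 lab (nth 0 lab i) == nth 0 lab i) (iota 0 (size lab)),
   all (fun i => 2 < deg_in lab s i) s &
   all (fun u => has (fun i => (i != u) && (deg_in lab (rem u s) i <= 2)) s) s].

Definition cm_labels n := [seq lab <- prods [seq iota 0 i.+1 | i <- iota 0 n] | cm_label lab].

(** One row for each label of the merged vertex, which comes first; the vertex after it is the
    attached one, which always lies in the independent set. *)
Definition exc_labels :=
  [:: [:: 0; 0; 1; 2; 3; 0]; [:: 1; 0; 2; 3; 0; 0]; [:: 2; 0; 1; 3; 0; 0]; [:: 3; 0; 1; 2; 0; 0]].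

(** The hints are certificates verified by [hint_ok]. A list only has to serve every split that is
    neither complete multipartite nor exceptional; its number is the order of the graph before the
    split. *)
Definition hints_cm5 : seq (seq nat) := [::
  [:: 0; 1; 1; 4; 5; 2; 2; 3; 3]; [:: 1; 0; 0; 3; 5; 2; 2; 4; 4]; [:: 1; 0; 0; 3; 4; 2; 2; 5; 5];
  [:: 0; 1; 1; 3; 4; 2; 2; 5; 5]; [:: 0; 1; 1; 3; 5; 2; 2; 4; 4]; [:: 1; 0; 0; 4; 5; 2; 2; 3; 3];
  [:: 1; 0; 0; 2; 5; 3; 3; 4; 4]; [:: 0; 1; 1; 2; 3; 4; 4; 5; 5]; [:: 0; 1; 1; 2; 4; 3; 3; 5; 5];
  [:: 0; 1; 1; 2; 5; 3; 3; 4; 4]; [:: 1; 0; 0; 2; 3; 4; 4; 5; 5]; [:: 1; 0; 0; 2; 4; 3; 3; 5; 5];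
  [:: 2; 3; 4; 5; 5; 0; 0; 1; 1]; [:: 2; 4; 4; 5; 5; 0; 0; 3; 3]; [:: 2; 3; 3; 5; 5; 0; 0; 4; 4];
  [:: 2; 3; 3; 4; 4; 0; 0; 5; 5]; [:: 2; 3; 3; 5; 5; 1; 1; 4; 4]; [:: 0; 3; 3; 4; 4; 2; 2; 5; 5];
  [:: 5; 3; 3; 4; 4; 0; 0; 2; 2]; [:: 1; 3; 3; 4; 4; 2; 2; 5; 5]; [:: 3; 4; 4; 5; 5; 0; 0; 2; 2];
  [:: 5; 3; 3; 4; 4; 1; 1; 2; 2]; [:: 3; 4; 4; 5; 5; 1; 1; 2; 2]; [:: 4; 3; 3; 5; 5; 1; 1; 2; 2];
  [:: 4; 3; 3; 5; 5; 0; 0; 2; 2]; [:: 2; 3; 3; 4; 4; 1; 1; 5; 5]; [:: 2; 4; 4; 5; 5; 1; 1; 3; 3];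
  [:: 1; 4; 4; 5; 5; 2; 2; 3; 3]; [:: 0; 3; 3; 5; 5; 2; 2; 4; 4]; [:: 0; 4; 4; 5; 5; 2; 2; 3; 3];
  [:: 1; 3; 3; 5; 5; 2; 2; 4; 4]; [:: 1; 0; 0; 5; 5; 3; 3; 4; 4]; [:: 3; 0; 4; 5; 5; 1; 1; 2; 2];
  [:: 3; 1; 4; 5; 5; 0; 0; 2; 2]; [:: 0; 1; 2; 3; 3; 4; 4; 5; 5]; [:: 4; 3; 3; 1; 5; 0; 0; 2; 2];
  [:: 2; 1; 3; 5; 5; 0; 0; 4; 4]; [:: 2; 3; 3; 1; 5; 0; 0; 4; 4]; [:: 0; 1; 2; 4; 4; 3; 3; 5; 5];
  [:: 5; 1; 3; 4; 4; 0; 0; 2; 2]; [:: 0; 1; 2; 5; 5; 3; 3; 4; 4]; [:: 1; 0; 0; 3; 3; 4; 4; 5; 5];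
  [:: 5; 0; 3; 4; 4; 1; 1; 2; 2]; [:: 2; 1; 4; 5; 5; 0; 0; 3; 3]; [:: 5; 3; 3; 1; 4; 0; 0; 2; 2];
  [:: 3; 4; 4; 1; 5; 0; 0; 2; 2]; [:: 1; 0; 0; 4; 4; 3; 3; 5; 5]; [:: 5; 3; 3; 0; 4; 1; 1; 2; 2];
  [:: 4; 1; 3; 5; 5; 0; 0; 2; 2]].

Definition hints_exc6 : seq (seq nat) := [::
  [:: 4; 2; 2; 3; 5; 0; 0; 1; 1]; [:: 1; 0; 5; 3; 6; 2; 2; 4; 4]; [:: 0; 1; 5; 3; 6; 2; 2; 4; 4];
  [:: 1; 3; 5; 0; 6; 2; 2; 4; 4]; [:: 0; 3; 5; 1; 6; 2; 2; 4; 4]; [:: 4; 2; 2; 3; 6; 0; 0; 1; 1];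
  [:: 1; 2; 3; 0; 6; 4; 4; 5; 5]; [:: 2; 0; 3; 4; 5; 1; 1; 6; 6]; [:: 1; 0; 3; 4; 4; 2; 5; 6; 6];
  [:: 0; 1; 4; 5; 6; 2; 2; 3; 3]; [:: 0; 1; 3; 4; 6; 2; 2; 5; 5]; [:: 1; 0; 4; 5; 6; 2; 2; 3; 3];
  [:: 1; 0; 2; 3; 6; 4; 4; 5; 5]; [:: 1; 0; 2; 3; 5; 4; 4; 6; 6]; [:: 6; 2; 3; 4; 4; 0; 0; 1; 1]].

Definition hints_cm6 : seq (seq nat) := [::
  [:: 0; 1; 2; 3; 5; 4; 4; 6; 6]; [:: 1; 0; 2; 5; 6; 3; 3; 4; 4]; [:: 1; 3; 4; 0; 6; 2; 2; 5; 5];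
  [:: 0; 1; 2; 5; 6; 3; 3; 4; 4]; [:: 0; 1; 2; 4; 6; 3; 3; 5; 5]; [:: 1; 0; 4; 2; 5; 3; 3; 6; 6];
  [:: 1; 0; 2; 3; 4; 5; 5; 6; 6]; [:: 1; 0; 2; 3; 6; 4; 4; 5; 5]; [:: 0; 1; 5; 3; 6; 2; 2; 4; 4];
  [:: 1; 0; 3; 4; 5; 2; 2; 6; 6]; [:: 0; 2; 4; 1; 5; 3; 3; 6; 6]; [:: 1; 0; 4; 2; 6; 3; 3; 5; 5];
  [:: 0; 3; 4; 1; 6; 2; 2; 5; 5]; [:: 0; 1; 4; 2; 5; 3; 3; 6; 6]; [:: 2; 3; 4; 5; 5; 1; 1; 6; 6];
  [:: 0; 2; 3; 1; 4; 5; 5; 6; 6]; [:: 0; 1; 3; 4; 5; 2; 2; 6; 6]; [:: 0; 1; 3; 2; 6; 4; 4; 5; 5];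
  [:: 1; 0; 5; 4; 6; 2; 2; 3; 3]; [:: 1; 2; 3; 0; 5; 4; 4; 6; 6]; [:: 1; 3; 5; 0; 6; 2; 2; 4; 4];
  [:: 3; 4; 4; 5; 6; 1; 1; 2; 2]; [:: 2; 3; 4; 5; 5; 0; 0; 6; 6]; [:: 1; 0; 2; 4; 5; 3; 3; 6; 6];
  [:: 2; 3; 4; 0; 6; 1; 1; 5; 5]; [:: 5; 2; 4; 3; 6; 0; 0; 1; 1]; [:: 5; 2; 3; 4; 4; 1; 1; 6; 6];
  [:: 2; 3; 5; 6; 6; 0; 0; 4; 4]; [:: 2; 3; 3; 4; 6; 0; 0; 5; 5]; [:: 1; 0; 3; 2; 5; 4; 4; 6; 6];
  [:: 4; 3; 3; 5; 6; 1; 1; 2; 2]; [:: 0; 4; 4; 5; 6; 2; 2; 3; 3]; [:: 6; 4; 4; 2; 5; 0; 0; 3; 3];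
  [:: 0; 3; 3; 5; 6; 2; 2; 4; 4]; [:: 2; 4; 5; 6; 6; 1; 1; 3; 3]; [:: 0; 1; 2; 3; 6; 4; 4; 5; 5];
  [:: 6; 3; 3; 2; 4; 0; 0; 1; 1]; [:: 3; 5; 5; 4; 6; 0; 0; 2; 2]; [:: 2; 3; 3; 4; 6; 1; 1; 5; 5];
  [:: 2; 4; 5; 6; 6; 0; 0; 3; 3]; [:: 3; 2; 4; 6; 6; 0; 0; 1; 1]; [:: 4; 3; 3; 5; 6; 0; 0; 2; 2];
  [:: 6; 4; 4; 2; 5; 1; 1; 3; 3]; [:: 3; 2; 5; 6; 6; 1; 1; 4; 4]; [:: 6; 3; 3; 2; 5; 0; 0; 4; 4];
  [:: 5; 2; 3; 4; 4; 0; 0; 6; 6]; [:: 4; 2; 5; 3; 6; 0; 0; 1; 1]; [:: 3; 2; 4; 6; 6; 0; 0; 5; 5];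
  [:: 6; 3; 3; 2; 5; 1; 1; 4; 4]; [:: 0; 1; 5; 4; 6; 2; 2; 3; 3]; [:: 5; 2; 3; 6; 6; 1; 1; 4; 4];
  [:: 3; 2; 4; 6; 6; 1; 1; 5; 5]; [:: 5; 4; 4; 3; 6; 0; 0; 2; 2]; [:: 1; 3; 3; 5; 6; 2; 2; 4; 4];
  [:: 1; 4; 4; 3; 5; 2; 2; 6; 6]; [:: 4; 0; 2; 5; 5; 1; 1; 3; 3]; [:: 1; 2; 3; 0; 6; 4; 4; 5; 5];
  [:: 5; 3; 3; 2; 6; 0; 0; 4; 4]; [:: 5; 4; 4; 3; 6; 1; 1; 2; 2]; [:: 4; 2; 5; 6; 6; 0; 0; 3; 3];
  [:: 5; 3; 4; 6; 6; 0; 0; 1; 1]; [:: 0; 1; 3; 2; 5; 4; 4; 6; 6]; [:: 6; 0; 2; 4; 4; 1; 1; 5; 5];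
  [:: 1; 4; 4; 0; 5; 3; 3; 6; 6]; [:: 4; 3; 5; 6; 6; 1; 1; 2; 2]; [:: 4; 3; 3; 5; 6; 0; 0; 1; 1];
  [:: 6; 1; 2; 4; 4; 0; 0; 5; 5]; [:: 1; 4; 5; 6; 6; 2; 2; 3; 3]; [:: 5; 0; 2; 4; 4; 1; 1; 3; 3];
  [:: 3; 2; 4; 5; 5; 1; 1; 6; 6]; [:: 3; 2; 5; 6; 6; 0; 0; 4; 4]; [:: 6; 4; 4; 3; 5; 0; 0; 1; 1];
  [:: 5; 2; 2; 1; 6; 0; 0; 3; 3]; [:: 3; 2; 2; 4; 5; 0; 0; 1; 1]; [:: 3; 1; 4; 2; 5; 0; 0; 6; 6];
  [:: 4; 0; 2; 3; 3; 1; 1; 5; 5]; [:: 0; 1; 3; 4; 4; 5; 5; 6; 6]; [:: 1; 0; 3; 4; 6; 2; 2; 5; 5];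
  [:: 0; 1; 2; 4; 5; 3; 3; 6; 6]; [:: 4; 1; 2; 3; 3; 0; 0; 5; 5]; [:: 1; 0; 5; 2; 6; 3; 3; 4; 4];
  [:: 4; 2; 2; 0; 5; 1; 1; 6; 6]; [:: 4; 1; 2; 3; 3; 0; 0; 6; 6]; [:: 1; 0; 3; 4; 4; 5; 5; 6; 6];
  [:: 0; 2; 3; 1; 6; 4; 4; 5; 5]; [:: 0; 4; 4; 3; 5; 2; 2; 6; 6]; [:: 4; 5; 5; 3; 6; 0; 0; 1; 1];
  [:: 5; 1; 1; 2; 6; 0; 0; 3; 3]; [:: 0; 1; 2; 3; 4; 5; 5; 6; 6]; [:: 6; 2; 2; 1; 5; 0; 0; 3; 3];
  [:: 2; 3; 3; 4; 4; 0; 0; 1; 1]; [:: 3; 2; 2; 4; 6; 0; 0; 1; 1]; [:: 1; 0; 2; 3; 5; 4; 4; 6; 6];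
  [:: 3; 5; 5; 0; 6; 1; 1; 4; 4]; [:: 6; 0; 2; 5; 5; 1; 1; 3; 3]; [:: 6; 4; 4; 2; 5; 0; 0; 1; 1];
  [:: 1; 4; 4; 2; 5; 3; 3; 6; 6]; [:: 3; 0; 2; 4; 4; 1; 1; 5; 5]; [:: 5; 3; 3; 2; 6; 0; 0; 1; 1];
  [:: 2; 4; 4; 3; 6; 0; 0; 1; 1]; [:: 0; 1; 3; 5; 5; 2; 2; 4; 4]; [:: 5; 4; 4; 0; 6; 1; 1; 3; 3];
  [:: 6; 0; 2; 3; 3; 1; 1; 4; 4]; [:: 3; 2; 2; 1; 4; 0; 0; 5; 5]; [:: 5; 1; 2; 3; 3; 0; 0; 4; 4];
  [:: 6; 1; 3; 4; 4; 0; 0; 5; 5]; [:: 3; 1; 2; 5; 5; 0; 0; 4; 4]; [:: 4; 1; 1; 2; 6; 0; 0; 5; 5];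
  [:: 5; 2; 2; 1; 3; 0; 0; 6; 6]; [:: 4; 0; 0; 5; 5; 1; 1; 3; 3]; [:: 5; 0; 0; 2; 2; 1; 1; 6; 6];
  [:: 6; 2; 3; 0; 4; 1; 1; 5; 5]; [:: 3; 0; 0; 4; 4; 1; 1; 6; 6]; [:: 4; 1; 1; 2; 3; 0; 0; 6; 6];
  [:: 6; 2; 2; 1; 3; 0; 0; 4; 4]; [:: 4; 1; 5; 6; 6; 0; 0; 3; 3]; [:: 3; 4; 4; 2; 5; 0; 0; 6; 6];
  [:: 4; 0; 2; 5; 5; 1; 1; 6; 6]; [:: 4; 3; 3; 2; 6; 1; 1; 5; 5]; [:: 5; 2; 2; 0; 3; 1; 1; 4; 4];
  [:: 3; 1; 1; 5; 5; 0; 0; 6; 6]].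

Definition hints_cm7 : seq (seq nat) := [::
  [:: 0; 1; 3; 5; 6; 4; 4; 7; 7]; [:: 1; 3; 5; 0; 7; 4; 4; 6; 6]; [:: 0; 1; 5; 4; 6; 3; 3; 7; 7];
  [:: 1; 0; 3; 5; 6; 4; 4; 7; 7]; [:: 0; 1; 5; 3; 7; 4; 4; 6; 6]; [:: 1; 0; 4; 5; 7; 3; 3; 6; 6];
  [:: 1; 0; 6; 3; 7; 4; 4; 5; 5]; [:: 0; 1; 6; 5; 7; 3; 3; 4; 4]; [:: 0; 3; 5; 1; 7; 4; 4; 6; 6];
  [:: 1; 0; 5; 6; 7; 3; 3; 4; 4]; [:: 1; 4; 5; 0; 6; 3; 3; 7; 7]; [:: 1; 3; 4; 0; 5; 6; 6; 7; 7];
  [:: 1; 0; 4; 3; 6; 5; 5; 7; 7]; [:: 0; 3; 4; 1; 6; 5; 5; 7; 7]; [:: 0; 1; 4; 6; 7; 3; 3; 5; 5];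
  [:: 0; 1; 3; 4; 5; 6; 6; 7; 7]; [:: 0; 3; 6; 1; 7; 4; 4; 5; 5]; [:: 1; 4; 6; 0; 7; 3; 3; 5; 5];
  [:: 1; 0; 3; 4; 7; 5; 5; 6; 6]; [:: 0; 1; 4; 3; 7; 5; 5; 6; 6]; [:: 0; 1; 5; 4; 7; 3; 3; 6; 6];
  [:: 1; 3; 6; 0; 7; 4; 4; 5; 5]; [:: 4; 6; 6; 3; 7; 0; 0; 1; 1]; [:: 4; 3; 3; 5; 6; 0; 0; 1; 1];
  [:: 6; 3; 5; 7; 7; 0; 0; 1; 1]; [:: 3; 6; 6; 5; 7; 0; 0; 1; 1]; [:: 1; 0; 3; 4; 5; 6; 6; 7; 7];
  [:: 7; 4; 4; 5; 6; 0; 0; 1; 1]; [:: 1; 0; 4; 3; 7; 5; 5; 6; 6]].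

Lemma cm5_ok : all_splits_ok neqr hints_cm5 5 (cm_labels 5).
Proof. by vm_compute. Qed.

Lemma exc6_ok : all_splits_ok excr hints_exc6 6 exc_labels.
Proof. by vm_compute. Qed.

Lemma cm6_ok : all_splits_ok neqr hints_cm6 6 (cm_labels 6).
Proof. by vm_compute. Qed.

Lemma cm7_ok : all_splits_ok neqr hints_cm7 7 (cm_labels 7).
Proof. by vm_compute. Qed.

Lemma lookup_table n adj i j : i < n -> j < n -> lookup (table n adj) i j = adj i j.
Proof.
move=> ni nj; rewrite /lookup /table (nth_map 0) ?size_iota // (nth_map 0) ?size_iota //.
by rewrite !nth_iota.
Qed.

Lemma mem_prods (A : eqType) (ss : seq (seq A)) (t : seq A) :
  all2 (fun x s => x \in s) t ss -> t \in prods ss.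
Proof.
elim: ss t => [|s ss IH] [|x t] //= /andP[xs /IH tss].
by apply/allpairsP; exists (x, t).
Qed.

Section Soundness.

Variables (F : sgraph) (x0 : F) (L : seq F) (adj : nat -> nat -> bool).
Hypotheses (uL : uniq L) (mL : forall u, u \in L).
Let el := nth x0 L.
Hypothesis adjE : forall i j, i < size L -> j < size L -> adj i j = edge (el i) (el j).

Let lt_all (l : seq nat) := all (gtn (size L)) l.

Lemma tchn_map l m : lt_all l -> lt_all m -> tchn adj l m = tch (map el l) (map el m).
Proof.
move=> /allP hl /allP hm; rewrite /tchn /tch has_map; apply: eq_in_has => i /hl ni /=.
by rewrite has_map; apply: eq_in_has => j /hm nj /=; rewrite adjE.
Qed.

Lemma lnkn_map l : lt_all l -> lnkn adj l = linked (map el l).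
Proof. by case: l => [|a [|b [|]]] //= /and3P[ha hb _]; rewrite adjE. Qed.

Lemma touch_map l e : lt_all l -> e < size L ->
  touch [set u in map el l] [set el e] = has (adj e) l.
Proof.
move=> /allP hl ne; apply/touchP/hasP => [[u [w []]]|[i il ei]].
  rewrite !inE => /mapP[i il ->] /eqP-> ie; exists i => //.
  by rewrite adjE; [rewrite edge_sym | exact: ne | exact: hl].
exists (el i), (el e); rewrite !inE map_f //; split=> //.
by rewrite edge_sym; rewrite adjE in ei; [exact: ei | exact: ne | exact: hl].
Qed.

Lemma hint_house h : hint_wf (size L) h -> hint_ok adj h -> house F.
Proof.
case: h => [|e h]; first by []. case: h => [|a h]; first by [].
case: h => [|a' h]; first by []. case: h => [|b h]; first by [].
case: h => [|b' h]; first by []. case: h => [|c h]; first by [].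
case: h => [|c' h]; first by []. case: h => [|d h]; first by [].
case: h => [|d' h]; first by []. case: h => [|? ?]; last by [].
rewrite /hint_wf /hint_ok; set la := hbag a a'; set lb := hbag b b'.
set lc := hbag c c'; set ld := hbag d d'; cbv zeta.
move=> /andP[/= /andP[ne hall] /andP[nes hun]].
move=> /and5P[ea eb ec ed /and5P[tab tac tad tbc /and5P[tbd tcd ka kb /andP[kc kd]]]].
have /and4P[ha hb hc hd] : [&& lt_all la, lt_all lb, lt_all lc & lt_all ld].
  by rewrite /lt_all -!all_cat.
have inj : {in la ++ lb ++ lc ++ ld &, injective el}.
  move=> i j /(allP hall) ni /(allP hall) nj /eqP; rewrite nth_uniq //.
  by move/eqP.
apply: (@house_lists F (map el la) (map el lb) (map el lc) (map el ld) [set el e]);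
  rewrite -?tchn_map -?lnkn_map ?touch_map //.
- by rewrite -!map_cat map_inj_in_uniq.
- move=> u; rewrite -!map_cat => /mapP[i il ->]; rewrite inE /el nth_uniq //.
    by apply: contraNneq nes => <-.
  exact: (allP hall).
- by apply/set0Pn; exists (el e); rewrite inE.
- exact: conn1.
Qed.

Let onto u : exists2 i, i < size L & el i = u.
Proof. by exists (index u L); rewrite ?index_mem // /el nth_index. Qed.

Lemma cm_search_cm : cm_search (size L) adj -> @cm F setT.
Proof.
move=> h e c d _ _ _.
have [i ni <-] := onto e; have [j nj <-] := onto c; have [k nk <-] := onto d.
have mi m : m < size L -> m \in iota 0 (size L) by rewrite mem_iota.
have /allP/(_ _ (mi _ nj))/allP/(_ _ (mi _ nk)) := allP h _ (mi _ ni).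
by rewrite !adjE // => /implyP.
Qed.

Lemma exc_search_exc : exc_search (size L) adj -> @exc F setT.
Proof.
have im m : m \in iota 0 (size L) -> m < size L by rewrite mem_iota.
have mi m : m < size L -> m \in iota 0 (size L) by rewrite mem_iota.
have el_eq i j : i < size L -> j < size L -> (el i == el j) = (i == j).
  by move=> ni nj; rewrite /el nth_uniq.
case/hasP=> a /im na /hasP[b /im nb]; case: ifP => // ab.
case/hasP=> c /im nc /and5P[nca ncb ca cb /allP h].
exists (el a), (el b), (el c); rewrite !inE; split=> //; split.
  by split; rewrite -?adjE // el_eq.
have key i : i < size L -> el i \in setT :\: [set el a; el b; el c] ->
    i \notin [:: a; b; c].
  by move=> ni; rewrite !inE !el_eq // -orbA andbT.
split.
  move=> u; have [i ni <-] := onto u => /(key _ ni)/negbTE nabc.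
  by have := h i (mi i ni); rewrite nabc /= => /and4P[e1 e2 e3 _]; rewrite -!adjE // e1 e2 e3.
move=> u w; have [i ni <-] := onto u; have [j nj <-] := onto w.
move=> /(key _ ni)/negbTE nabc /(key _ nj)/negbTE nabc'.
have := h i (mi i ni); rewrite nabc /= => /and4P[_ _ _ /allP/(_ _ (mi _ nj))].
by rewrite nabc' adjE.
Qed.

End Soundness.

Lemma all2_nthP (A B : Type) (x0 : A) (y0 : B) (r : A -> B -> bool) s t :
  size s = size t -> (forall i, i < size s -> r (nth x0 s i) (nth y0 t i)) -> all2 r s t.
Proof.
elim: s t => [|x s IH] [|y t] //= [e] h; rewrite (h 0) //=; apply: IH => // i ni.
exact: (h i.+1).
Qed.

(** * Attaching a vertex to a minimal K4 minor *)

Section Split.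

Variables (F : sgraph) (x y v : F).
Hypotheses (xy : edge x y) (vy : v != y).

Let nxy : x != y := edge_neq xy.
Let F' := contract x y.
Definition cw : contract x y := Sub x nxy.
Definition cv : contract x y := Sub v vy.

Lemma contractE (s t : contract x y) : edge s t =
  (s != t) && [|| edge (val s) (val t),
                  (val s == x) && edge y (val t) |
                  (val t == x) && edge y (val s)].
Proof. by []. Qed.

Variables (R : rel nat) (hints : seq (seq nat)) (labs : seq (seq nat)).
Variables (o : seq F') (labf : F' -> nat).
Let L' := cw :: cv :: o.
Hypotheses (uL' : uniq L') (mL' : forall t, t \in L').
Hypothesis labE : forall s t, edge s t = R (labf s) (labf t).
Hypothesis labsP : map labf L' \in labs.
Hypothesis ok : all_splits_ok R hints (size L') labs.

Let L := [:: x, y, v & map val o].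

(** Along [L] the graph [F] is a split of the labelled graph [contract x y]: an edge at the merged
    vertex comes from an edge at [x], at [y] or at both, so the columns of [F] are among the
    enumerated ones. *)
Lemma split_concl : (exists2 z, z \notin [:: x; y; v] & edge x z) ->
  (exists2 z, z \notin [:: x; y; v] & edge y z) -> 1 < #|nbrs setT v| ->
  [\/ @cm F setT, @exc F setT | house F].
Proof.
move=> [zx zxn xzx] [zy zyn yzy] dv.
have EL : L = x :: y :: behead (map val L') by [].
have uL : uniq L.
  rewrite EL /= -/(map val o).
  have : uniq (map val L') by rewrite (map_inj_uniq val_inj).
  rewrite /= => /and3P[h1 h2 h3].
  rewrite inE negb_or nxy h1 h2 h3 !andbT /= inE negb_or eq_sym vy /=.
  by apply/mapP => -[t _ e]; move/negP: (valP t); apply; apply/eqP; exact: esym e.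
have mL u : u \in L.
  have [->|uy] := eqVneq u y; first by rewrite !inE eqxx orbT.
  have := mL' (Sub u uy); rewrite /L !inE -!val_eqE /=.
  case/or3P=> [->//|->|h]; rewrite ?orbT //.
  by apply/or4P; apply: Or44; apply/mapP; exists (Sub u uy).
pose lab := map labf L'.
pose cols := (false, false) :: [seq (edge x (val t), edge y (val t)) | t <- cv :: o].
pose n := (size lab).+1.
have sL : size L = n by rewrite /n /lab !size_map /= size_map.
pose T := table n (split_adj R lab cols).
have labn i : i < size L' -> nth 0 lab i = labf (nth cw L' i).
  by move=> ni; rewrite /lab (nth_map cw).
have eln i : i < size o -> nth x L i.+3 = val (nth cw o i).
  by move=> ni; rewrite /L /= (nth_map cw).
have eln2 i : i.+1 < size L' -> nth x L i.+2 = val (nth cw (cv :: o) i).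
  by case: i => [|i] ni; [|apply: eln].
have coln i : i.+1 < size L' -> nth (false, false) cols i.+1 =
    (edge x (nth x L i.+2), edge y (nth x L i.+2)).
  by move=> ni; rewrite eln2 // /cols [LHS]/= -/(map _ (cv :: o)) (nth_map cw).
have nL' i : i.+2 < n -> i.+1 < size L' by rewrite /n /lab size_map.
have adjE i j : i < size L -> j < size L -> lookup T i j = edge (nth x L i) (nth x L j).
  rewrite sL => ni nj; rewrite lookup_table //.
  case: i ni => [|[|i]] ni; case: j nj => [|[|j]] nj.
  - by rewrite /= edge_irr.
  - by rewrite /= xy.
  - by rewrite -[LHS]/((nth (false, false) cols j.+1).1) coln ?nL'.
  - by rewrite /= edge_sym xy.
  - by rewrite /= edge_irr.
  - by rewrite -[LHS]/((nth (false, false) cols j.+1).2) coln ?nL'.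
  - by rewrite -[LHS]/((nth (false, false) cols i.+1).1) coln ?nL' // [RHS]edge_sym.
  - by rewrite -[LHS]/((nth (false, false) cols i.+1).2) coln ?nL' // [RHS]edge_sym.
  rewrite -[LHS]/(R (nth 0 lab i.+1) (nth 0 lab j.+1)) !labn ?nL' // -labE contractE.
  rewrite !eln2 ?nL' // -[nth cw L' i.+1]/(nth cw (cv :: o) i).
  rewrite -[nth cw L' j.+1]/(nth cw (cv :: o) j).
  have nvx k : k.+1 < size L' -> val (nth cw (cv :: o) k) == x = false.
    move=> nk; apply/negbTE; have := uL'; rewrite /L' cons_uniq => /andP[+ _].
    apply: contraNN => /eqP e; have <- : nth cw (cv :: o) k = cw by exact: val_inj.
    exact: mem_nth.
  rewrite !nvx ?nL' // !orbF.
  have [e|//] := eqVneq (nth cw (cv :: o) i) (nth cw (cv :: o) j).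
  by rewrite e edge_irr.
have labin : lab \in labs by [].
have slab : size lab = size L' by rewrite /lab size_map.
have scols : size cols = size L' by rewrite /cols /L' [LHS]/= size_map.
have colsin : cols \in prods (col_options R lab).
  apply: mem_prods; apply: (@all2_nthP _ _ (false, false) [::]).
    by rewrite /col_options size_map size_iota slab.
  rewrite scols => i ni; rewrite /col_options (nth_map 0) ?size_iota ?slab //.
  rewrite nth_iota // add0n; case: i ni => [|i] ni; first by rewrite inE.
  rewrite coln // !labn // -labE contractE eln2 // eqxx /=.
  have nwc : nth cw (cv :: o) i != cw.
    move: uL'; rewrite /L' cons_uniq => /andP[+ _]; apply: contraNneq => <-.
    exact: mem_nth.
  rewrite eq_sym nwc /=; move: nwc; rewrite -val_eqE /= => /negbTE->.
  rewrite orbF; case: (edge x _); case: (edge y _); by rewrite ?inE.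
have /andP[hw /allP/(_ _ labin)/allP/(_ _ colsin)] := ok.
rewrite /split_ok -/n -/T; case: ifP => [_|/negP[]]; last first.
  have ino z : z \notin [:: x; y; v] -> exists2 t, t \in o & z = val t.
    by rewrite !inE !negb_or => /and3P[/negbTE h1 /negbTE h2 /negbTE h3];
      have := mL z; rewrite /L !inE h1 h2 h3 => /mapP.
  have dE : drop 2 cols = [seq (edge x (val t), edge y (val t)) | t <- o].
    by rewrite /cols /= drop0.
  apply/and3P; split.
  - by rewrite dE has_map; have [t to zt] := ino _ zxn; apply/hasP; exists t => //=;
      rewrite -zt.
  - by rewrite dE has_map; have [t to zt] := ino _ zyn; apply/hasP; exists t => //=;
      rewrite -zt.
  rewrite (_ : count _ _ = #|nbrs setT v|) // -/n -/T -sL.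
  have -> : #|nbrs setT v| = count (edge v) L.
    rewrite -size_filter -(card_uniqP (filter_uniq _ uL)); apply: eq_card => z.
    by rewrite inE mem_filter mL andbT inE.
  rewrite -[L in RHS](mkseq_nth x) /mkseq count_map; apply: eq_in_count => i.
  by rewrite mem_iota => /= ni; rewrite adjE // sL.
have nsz : n = size L by [].
case: ifP => [/hasP[h hin hok] _|_].
  apply: Or33; apply: (hint_house uL adjE _ hok).
  by have := allP hw _ hin; rewrite -nsz /n size_map.
case: ifP => [hcm _|_ hex].
  by apply: Or31; apply: (cm_search_cm mL adjE); rewrite -nsz.
by apply: Or32; apply: (exc_search_exc uL mL adjE); rewrite -nsz.
Qed.

End Split.

Lemma map_const_in (T : eqType) (f : T -> nat) k (s : seq T) :
  {in s, forall z, f z = k} -> map f s = nseq (size s) k.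
Proof.
elim: s => //= z s IH h; rewrite h ?mem_head // IH // => u us.
by apply: h; rewrite inE us orbT.
Qed.

Section CompleteSeq.

Variables (T : finType) (s : seq T).
Hypothesis us : uniq s.

Definition others := enum [predC s].

Lemma others_uniq : uniq (s ++ others).
Proof.
rewrite cat_uniq us enum_uniq andbT; apply/hasPn => z.
by rewrite mem_enum !inE.
Qed.

Lemma mem_others z : z \in s ++ others.
Proof. by rewrite mem_cat mem_enum !inE orbN. Qed.

Lemma size_others : size others = #|T| - size s.
Proof. by rewrite -cardE -(cardC (mem s)) (card_uniqP us) addKn. Qed.

End CompleteSeq.

Section SmallSplit.

Variables (F : sgraph) (x y v : F).
Hypotheses (xy : edge x y) (vx : v != x) (vy : v != y).
Hypothesis hx : exists2 z, z \notin [:: x; y; v] & edge x z.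
Hypothesis hy : exists2 z, z \notin [:: x; y; v] & edge y z.
Hypothesis hv : 1 < #|nbrs setT v|.

Let F' := contract x y.
Let w : F' := cw xy.
Let v' : F' := cv x vy.

Let wv : w != v'.
Proof. by rewrite -val_eqE /= eq_sym. Qed.

Hypothesis mk : @mink4 F' [set~ v'].

Lemma exc_split : @exc F' setT -> [\/ @cm F setT, @exc F setT | house F].
Proof.
move=> he; have [c6 [a [b [c [[ab nca ncb ca] [cb [vabc [hU hI]]]]]]]] := exc_mink4 he mk.
clear he; wlog wb : a b ab nca ncb ca cb vabc hU hI / w != b.
  move=> W; have [e|wb] := eqVneq w b; last exact: (W a b).
  have sw : [set b; a; c] = [set a; b; c] by rewrite [[set b; a]]setUC.
  apply: (W b a) => //; rewrite ?sw //; first by rewrite edge_sym.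
    by move=> u hu; have /and3P[e1 e2 e3] := hU u hu; rewrite e1 e2 e3.
  by rewrite e eq_sym edge_neq.
have nab := edge_neq ab.
pose lab (z : F') := if z == a then 1 else if z == b then 2 else if z == c then 3 else 0.
have lab0 z : z \notin [set a; b; c] -> lab z = 0.
  by rewrite !inE !negb_or /lab => /andP[/andP[/negbTE-> /negbTE->] /negbTE->].
have laba : lab a = 1 by rewrite /lab eqxx.
have labb : lab b = 2 by rewrite /lab eq_sym (negbTE nab) eqxx.
have labc : lab c = 3 by rewrite /lab (negbTE ca) (negbTE cb) eqxx.
have Ud u : u \notin [set a; b; c] -> [/\ edge u a, edge u b & edge u c].
  by move=> h; apply/and3P/hU; rewrite inE.
have abcP z : z \in [set a; b; c] -> [\/ z = a, z = b | z = c].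
  by rewrite !inE -orbA => /or3P[]/eqP->; [constructor 1|constructor 2|constructor 3].
have labE s t : edge s t = excr (lab s) (lab t).
  case: (boolP (s \in [set a; b; c])) => [/abcP sa|sa];
    case: (boolP (t \in [set a; b; c])) => [/abcP ta|ta].
  - have ba : edge b a by rewrite edge_sym.
    have nac : ~~ edge a c by rewrite edge_sym.
    have nbc : ~~ edge b c by rewrite edge_sym.
    by case: sa => ->; case: ta => ->; rewrite ?laba ?labb ?labc ?ab ?ba
      ?(negbTE nca) ?(negbTE ncb) ?(negbTE nac) ?(negbTE nbc) // edge_irr.
  - have [e1 e2 e3] := Ud t ta; rewrite (lab0 t) // edge_sym.
    by case: sa => ->; rewrite ?laba ?labb ?labc /excr /= ?e1 ?e2 ?e3.
  - have [e1 e2 e3] := Ud s sa; rewrite (lab0 s) //.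
    by case: ta => ->; rewrite ?laba ?labb ?labc /excr /= ?e1 ?e2 ?e3.
  rewrite !lab0 // /excr /=; apply/negbTE/hI; by rewrite inE.
have va : v' != a by apply: contraNneq vabc => ->; rewrite !inE eqxx.
have vb : v' != b by apply: contraNneq vabc => ->; rewrite !inE eqxx !orbT.
have vc : v' != c by apply: contraNneq vabc => ->; rewrite !inE eqxx !orbT.
have main p : uniq (w :: v' :: p) -> {subset [:: a; b; c] <= w :: v' :: p} ->
    [:: lab w, 0 & map lab p] ++ nseq (6 - size (w :: v' :: p)) 0 \in exc_labels ->
    [\/ @cm F setT, @exc F setT | house F].
  move=> up sp hin.
  have uo := others_uniq up; have mo := mem_others (w :: v' :: p).
  have lo : map lab (others (w :: v' :: p)) = nseq (6 - size (w :: v' :: p)) 0.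
    rewrite -c6 -size_others //; apply: map_const_in => z; rewrite mem_enum => hz.
    apply: lab0; apply: contra hz => zabc; apply: sp; move: zabc.
    by rewrite !inE -orbA.
  have sz : size (w :: v' :: p ++ others (w :: v' :: p)) = 6.
    rewrite -[_ :: _]/((w :: v' :: p) ++ _) size_cat size_others // c6 subnKC //.
    by rewrite -c6 -(card_uniqP up) max_card.
  apply: (split_concl (labf := lab) uo mo labE (labs := exc_labels) (hints := hints_exc6)) => //.
    rewrite -[others _]/(others (w :: v' :: p)) /= map_cat lo (lab0 v') //.
  by rewrite sz; exact: exc6_ok.
have [wa|wa] := eqVneq w a.
  apply: (main [:: b; c]).
  - by rewrite /= !inE !negb_or wv wb vb vc wa [b == c]eq_sym cb [a == c]eq_sym ca.
  - by move=> z; rewrite !inE wa => /or3P[]/eqP->; rewrite eqxx ?orbT.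
  by rewrite /= wa laba labb labc.
have [wc|wc] := eqVneq w c.
  apply: (main [:: a; b]).
  - by rewrite /= !inE !negb_or wv wa wb va vb nab.
  - by move=> z; rewrite !inE wc => /or3P[]/eqP->; rewrite eqxx ?orbT.
  by rewrite /= wc laba labb labc.
apply: (main [:: a; b; c]).
- by rewrite /= !inE !negb_or wv wa wb wc va vb vc nab [a == c]eq_sym ca [b == c]eq_sym cb.
- by move=> z; rewrite !inE => /or3P[]/eqP->; rewrite eqxx ?orbT.
by rewrite /= lab0 ?laba ?labb ?labc // !inE !negb_or wa wb wc.
Qed.

Lemma cm_split : @cm F' setT -> 4 < #|F'| <= 7 -> [\/ @cm F setT, @exc F setT | house F].
Proof.
move=> cmF sF.
have u2 : uniq [:: w; v'] by rewrite /= inE wv.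
pose o := others [:: w; v'].
have uL : uniq (w :: v' :: o) := others_uniq u2.
have mL : forall t, t \in w :: v' :: o := @mem_others _ [:: w; v'].
pose L := w :: v' :: o; pose n := size L.
have nE : n = #|F'|.
  rewrite /n /L -[_ :: _]/([:: w; v'] ++ o) size_cat size_others // subnKC //.
  by rewrite -(card_uniqP u2) max_card.
pose el := nth w L.
have onto t : exists2 i, i < n & el i = t.
  by exists (index t L); [rewrite index_mem mL | rewrite /el nth_index // mL].
have el_inj i j : i < n -> j < n -> (el i == el j) = (i == j).
  by move=> ni nj; rewrite /el nth_uniq.
(* Nonadjacency is an equivalence here, so a vertex is labelled by the index of the first member of
   its class. *)
pose lab (z : F') := find (fun b => ~~ edge z b) L.
have hasL z : has (fun b => ~~ edge z b) L.
  by apply/hasP; exists z; rewrite ?mL ?edge_irr.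
have lab_lt z : lab z < n by rewrite /lab -has_find.
have nlab z : ~~ edge z (el (lab z)) by exact: (nth_find w (hasL z)).
have labE s t : edge s t = neqr (lab s) (lab t).
  rewrite /neqr; apply/idP/idP => [st|]; last first.
    apply: contraR => nst; rewrite /lab; apply/eqP/eq_find => b; congr (~~ _).
    have st z : edge s z -> edge t z.
      move=> sz; have := cmF t s z; rewrite !inE [edge t s]edge_sym (negbTE nst).
      by move=> /(_ isT isT isT sz).
    have ts z : edge t z -> edge s z.
      move=> tz; have := cmF s t z; rewrite !inE (negbTE nst).
      by move=> /(_ isT isT isT tz).
    by apply/idP/idP; auto.
  apply: contraL st => /eqP e; have := nlab s; have := nlab t; rewrite -e.
  set z := el _ => tz sz; apply: contra tz => st.
  have := cmF z s t; rewrite !inE ![edge z _]edge_sym (negbTE sz).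
  by move=> /(_ isT isT isT st).
have labn i : i < n -> nth 0 (map lab L) i = lab (el i).
  by move=> ni; rewrite (nth_map w).
have degE (Y : {set F'}) (S : seq nat) i : uniq S -> all (gtn n) S ->
    (forall j, j < n -> (el j \in Y) = (j \in S)) -> i < n ->
    deg_in (map lab L) S i = #|nbrs Y (el i)|.
  move=> uS /allP aS YS ni.
  have -> : #|nbrs Y (el i)| = #|[seq el j | j <- S & edge (el i) (el j)]|.
    apply: eq_card => z; have [j nj <-] := onto z; rewrite inE YS //.
    apply/andP/mapP => [[jS e]|[k]]; first by exists j => //; rewrite mem_filter jS e.
    rewrite mem_filter => /andP[e kS] /eqP; rewrite (el_inj j k nj (aS k kS)) => /eqP->.
    by split.
  rewrite (card_uniqP _); last first.
    rewrite map_inj_in_uniq ?filter_uniq // => j k.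
    rewrite !mem_filter => /andP[_ /aS nj] /andP[_ /aS nk] /eqP.
    by rewrite (el_inj j k nj nk) => /eqP.
  rewrite size_map size_filter /deg_in; apply: eq_in_count => j /aS nj.
  by rewrite !labn // labE.
have n5 : 4 < n by rewrite nE; case/andP: sF.
pose S := 0 :: iota 2 (n - 2).
have inS j : j < n -> (j \in S) = (j != 1).
  move=> nj; rewrite /S inE mem_iota; case: j nj => [|[|j]] //= nj.
  by rewrite subnKC ?(ltnW (ltnW (ltnW n5))).
have uS : uniq S by rewrite /S /= iota_uniq mem_iota.
have aS : all (gtn n) S.
  apply/allP => j; rewrite /S inE mem_iota => /orP[/eqP->|/andP[_]].
    by apply: leq_trans n5.
  by rewrite subnKC // (ltnW (ltnW (ltnW n5))).
have YS j : j < n -> (el j \in [set~ v']) = (j \in S).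
  move=> nj; rewrite inS // !inE -[v']/(el 1) el_inj //.
have cmY : cm [set~ v'] by apply: cmS cmF; exact: subsetT.
have hlab : map lab L \in cm_labels n.
  rewrite mem_filter; apply/andP; split; last first.
    apply: mem_prods; apply: (@all2_nthP _ _ 0 [::]).
      by rewrite !size_map size_iota.
    rewrite size_map => i ni; rewrite (nth_map 0) ?size_iota // nth_iota // add0n.
    rewrite labn // mem_iota /= add0n ltnS leqNgt; apply/negP=> lt.
    by have := before_find w lt; rewrite -/(el i) edge_irr.
  rewrite /cm_label size_map -/n; apply/and3P; split.
  - apply/allP => i; rewrite mem_iota add0n => /andP[_ ni].
    rewrite labn // labn //; have := nlab (el i).
    by rewrite labE negbK eq_sym.
  - apply/allP => i iS; have ni : i < n := allP aS i iS.
    rewrite (degE [set~ v']) //; apply: cm_deg => //; first exact: mk.1.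
    by rewrite YS.
  apply/allP => u uS'; have nu : u < n := allP aS u uS'.
  have YS' j : j < n -> (el j \in [set~ v'] :\ el u) = (j \in rem u S).
    by move=> nj; rewrite in_setD1 YS // el_inj // (mem_rem_uniq u uS) !inE.
  have nk := mk.2 (el u); rewrite YS // in nk; have {}nk := nk uS'.
  (* If no degree dropped to 2, a [K_4] minor would survive the deletion of [el u], against
     minimality. *)
  case: (boolP (has _ S)) => // /hasPn h; case: nk; apply: k4_of_min_degree.
    have : 0 < size (rem u S).
      by rewrite size_rem // /S /= size_iota subn_gt0; apply: leq_trans n5.
    case e : (rem u S) => [|j r] // _; apply/set0Pn; exists (el j).
    have jS : j \in rem u S by rewrite e mem_head.
    by rewrite YS' //; apply: (allP aS); apply: mem_rem jS.
  move=> t; have [i ni <-] := onto t; rewrite YS' // => iS.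
  have iS' : i \in S by apply: mem_rem iS.
  have iu : i != u by move: iS; rewrite (mem_rem_uniq u uS) inE => /andP[].
  have := h i iS'; rewrite iu /= -ltnNge (degE ([set~ v'] :\ el u) (rem u S)) ?rem_uniq //.
  by apply/allP => j /mem_rem; exact: (allP aS).
have hn : n \in [:: 5; 6; 7] by rewrite nE !inE; case/andP: sF; case: #|F'| => [|[|[|[|[|[|[|[|?]]]]]]]].
move: hn hlab; rewrite !inE => /or3P[]/eqP e hlab.
- apply: (split_concl (labf := lab) uL mL labE hlab (hints := hints_cm5)) => //.
  by rewrite -/L -/n e; exact: cm5_ok.
- apply: (split_concl (labf := lab) uL mL labE hlab (hints := hints_cm6)) => //.
  by rewrite -/L -/n e; exact: cm6_ok.
apply: (split_concl (labf := lab) uL mL labE hlab (hints := hints_cm7)) => //.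
by rewrite -/L -/n e; exact: cm7_ok.
Qed.

End SmallSplit.

(** * Extending a minimal K_4 minor by one vertex *)

Lemma nbrs_other (G : sgraph) (X : {set G}) u y : 1 < #|nbrs X u| ->
  exists2 z, z \in nbrs X u & z != y.
Proof.
rewrite (cardsD1 y) => d; have /card_gt0P[z] : 0 < #|nbrs X u :\ y|.
  by move: d; case: (y \in _); rewrite ?add1n ?add0n ?ltnS // => /ltnW.
by rewrite in_setD1 => /andP[zy zN]; exists z.
Qed.

(* A vertex attached to both ends of an edge [x y] of a [K_4] minor with bags
   [[x; y]], [b], [c] and [d]. *)
Lemma house_ear (G : sgraph) (v x y b c d : G) :
  uniq [:: v; x; b; y; c; d] -> edge x y ->
  edge v x -> edge v y -> ~~ edge v c -> ~~ edge v d ->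
  edge b c -> edge b d -> edge c d -> edge x b -> edge y c -> edge y d -> house G.
Proof.
rewrite cons_uniq => /andP[nv un] xy vx vy vc vd bc bd cd xb yc yd.
have t1 z l : touch [set u in l] [set z] = has (@edge G z) l.
  have -> : [set z] = [set u in [:: z]] by apply/setP=> u; rewrite !inE.
  by rewrite touchC touch_tch /tch /= orbF.
apply: (@house_lists G [:: x; b] [:: y] [:: c] [:: d] [set v]);
  rewrite ?t1 /tch /= ?orbF ?xy ?bc ?bd ?vx ?orbT //.
- by move=> u; rewrite inE; apply: contraTneq => ->.
- by apply/set0Pn; exists v; rewrite inE.
- exact: conn1.
Qed.

Lemma house_deg2 (G : sgraph) (v a b c d : G) :
  uniq [:: v; a; b; c; d] -> edge v a -> edge v b -> ~~ edge v c -> ~~ edge v d ->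
  edge a b -> edge a c -> edge a d -> edge b c -> edge b d -> edge c d -> house G.
Proof.
rewrite cons_uniq => /andP[nv un] va vb vc vd ab ac ad bc bd cd.
have t1 z l : touch [set u in l] [set z] = has (@edge G z) l.
  have -> : [set z] = [set u in [:: z]] by apply/setP=> u; rewrite !inE.
  by rewrite touchC touch_tch /tch /= orbF.
apply: (@house_lists G [:: a] [:: b] [:: c] [:: d] [set v]);
  rewrite ?t1 /tch /= ?orbF ?ab ?bc ?bd //.
- by move=> u; rewrite inE; apply: contraTneq => ->.
- by apply/set0Pn; exists v; rewrite inE.
- exact: conn1.
Qed.

(** Induction by contracting an edge inside a bag. The result is again minimal without [v], and [v]
    keeps two neighbours as soon as it has one off the edge. If no such edge exists, either [v] sees
    exactly the two ends of an edge inside a bag, or all bags are singletons. *)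
Lemma extend_minimal (F : sgraph) (v : F) :
  mink4 [set~ v] -> 1 < #|nbrs setT v| ->
  [\/ @cm F setT, @exc F setT | house F].
Proof.
have [n] := ubnP #|F|; elim: n F v => // n IH F v leFn mk dv.
have [[f [fX f0 fc ft]] mX] := mk.
have fv : 4 <= f v by rewrite leqNgt; apply/negP=> /fX; rewrite !inE eqxx.
(* A vertex in no bag could be deleted, against minimality. *)
have fspan u : u != v -> f u < 4.
  move=> uv; rewrite ltnNge; apply/negP=> fu.
  apply: (mX u); first by rewrite !inE.
  exists f; split=> // z fz; rewrite !inE; apply/andP; split; last by have := fX z fz; rewrite !inE.
  by apply: contraTneq fz => ->; rewrite -leqNgt.
have fv4 u : f u < 4 -> u != v by move/fX; rewrite !inE.
pose inner x y := [&& edge x y, f x == f y & f x < 4].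
case: (boolP [exists x, exists y, exists z, [&& inner x y, edge v z, z != x & z != y]]).
  move=> /existsP[x /existsP[y /existsP[z /and4P[/and3P[xy /eqP fxy fx] vz zx zy]]]].
  have xv := fv4 x fx; have yv : y != v by apply: fv4; rewrite -fxy.
  have vx : v != x by rewrite eq_sym.
  have vy : v != y by rewrite eq_sym.
  have nxy := edge_neq xy.
  pose F' := contract x y; pose v' : F' := cv x vy.
  have qm := contract_qmap xy.
  have pre_set (Y : {set F'}) (Z : {set F}) :
      (forall u, u != y -> forall h : u != y, (Sub u h \in Y) = (u \in Z)) -> (x \in Z) = (y \in Z) ->
      pre (contract_map x y) Y = Z.
    move=> h hxy; apply/setP=> u; rewrite inE /contract_map.
    have [->|uy] := eqVneq u y; first by rewrite insubT h.
    by rewrite insubT h.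
  have mk' : @mink4 F' [set~ v'].
    split.
      apply: (@k4_descend _ _ _ qm _ f) => //.
      - have key u t : contract_map x y u = Some t -> f u = f (val t).
          rewrite /contract_map; case: insubP => // a _ ea [<-].
          by rewrite ea; case: (eqVneq u y) => [->|].
        by move=> u w t /key-> /key->.
      - move=> u; rewrite /contract_map; case: insubP => //.
        case: (eqVneq u y) => [_|uy]; rewrite ?uy // => /negPn/eqP e _.
        by rewrite e eqxx in nxy.
      move=> u fu; rewrite (pre_set _ [set~ v]); first exact: fX.
        by move=> w _ h; rewrite !inE -val_eqE.
      by rewrite !inE xv yv.
    move=> t; rewrite !inE => tv kt.
    have kF := k4_quot qm kt; apply: (mX (val t)); first by rewrite !inE.
    apply: k4S kF; apply/subsetP=> u; rewrite inE /contract_map !inE.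
    have [->|uy] := eqVneq u y.
      rewrite insubT !inE -!val_eqE /= => /andP[_ _]; rewrite yv andbT eq_sym.
      exact: (valP t).
    by rewrite insubT !inE -!val_eqE.
  have dv' : 1 < #|@nbrs F' setT v'|.
    have [z' z'N z'z] := nbrs_other z dv; move: z'N; rewrite !inE /= => vz'.
    pose g u : F' := if insub u is Some t then t else cw xy.
    have gE u : val (g u) = if u == y then x else u.
      by rewrite /g; case: insubP => [t /negbTE-> //|/negPn->].
    have gN u : edge v u -> g u \in @nbrs F' setT v'.
      move=> e; rewrite !inE contractE -!val_eqE /= !gE (negbTE vx).
      case: (eqVneq u y) => [uy|uy].
        by rewrite vx eqxx /= [edge y v]edge_sym -uy e !orbT.
      by rewrite e andbT edge_neq.
    apply: leq_trans (_ : #|[set g z; g z']| <= _).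
      rewrite cards2 -val_eqE !gE (negbTE zy).
      by case: (eqVneq z' y) => _; rewrite ?zx // eq_sym z'z.
    by apply: subset_leq_card; apply/subsetP=> u; rewrite in_set2 => /orP[]/eqP->; exact: gN.
  have ex u w : u != v -> exists2 z, z \notin [:: u; w; v] & edge u z.
    move=> uv; have := mink4_deg mk (u := u); rewrite !inE => /(_ uv)/(nbrs_other w)[p].
    rewrite !inE => /andP[pv up] pw; exists p => //.
    by rewrite !inE !negb_or pw pv !andbT eq_sym edge_neq.
  have hx := ex x y xv.
  have hy : exists2 z, z \notin [:: x; y; v] & edge y z.
    have [p pn yp] := ex y x yv; exists p => //.
    by move: pn; rewrite !inE !negb_or => /and3P[-> -> ->].
  have leF' : #|F'| < n by rewrite -ltnS; apply: leq_trans leFn; rewrite ltnS card_sigC1.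
  case: (IH F' v' leF' mk' dv') => [hcm|hexc|]; last by move/(house_quot qm); constructor 3.
    apply: (cm_split xy vx hx hy dv mk' hcm).
    (* A complete multipartite minimal minor has 4 to 6 vertices; [v'] is one more. *)
    have cF : #|F'| = #|[set~ v']|.+1 by rewrite cardsC1 prednK //; apply/card_gt0P; exists v'.
    rewrite cF !ltnS cm_mink4_card //; last by apply: cmS hcm; exact: subsetT.
    have wX : cw xy \in [set~ v'] by rewrite !inE -val_eqE /= xv.
    have cmX : cm [set~ v'] by apply: cmS hcm; exact: subsetT.
    rewrite andbT (cardsD1 (cw xy)) wX add1n ltnS.
    apply: leq_trans (cm_deg cmX mk'.1 wX) _; apply: subset_leq_card.
    apply/subsetP=> t; rewrite !inE => /andP[-> e]; rewrite andbT eq_sym.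
    exact: edge_neq.
  exact: (exc_split xy vx hx hy dv mk' hexc).
move=> /existsPn noz.
have noz' x y z : inner x y -> edge v z -> z = x \/ z = y.
  move=> ixy vz; have /existsPn/(_ y)/existsPn/(_ z) := noz x.
  by rewrite ixy vz /= negb_and !negbK => /orP[]/eqP; [left|right].
case: (boolP [exists x, exists y, inner x y]) => [/existsP[x /existsP[y ixy]]|/existsPn noi].
  have /and3P[xy /eqP fxy fx] := ixy.
  have xv := fv4 x fx; have yv : y != v by apply: fv4; rewrite -fxy.
  have nxy := edge_neq xy.
  have [z0 vz0 z0y] := nbrs_other y dv; have [z1 vz1 z1x] := nbrs_other x dv.
  have vx : edge v x.
    by move: vz0; rewrite !inE /= => e; case: (noz' x y z0 ixy e) z0y => ez; subst z0; rewrite ?eqxx.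
  have vy : edge v y.
    by move: vz1; rewrite !inE /= => e; case: (noz' x y z1 ixy e) z1x => ez; subst z1; rewrite ?eqxx.
  have vN z : z != x -> z != y -> ~~ edge v z.
    by move=> zx zy; apply/negP=> e; case: (noz' x y z ixy e) => ez; [move: zx|move: zy]; rewrite ez eqxx.
  (* the bags of the other vertices are singletons *)
  have single u z : u != x -> u != y -> u != v -> f z = f u -> z = u.
    move=> ux uy uv fzu; apply/eqP; apply: contraT => zu.
    have fu := fspan u uv.
    have [] := @conn_cross _ _ [set u] (fc _ fu).
    - by exists u; rewrite !inE.
    - by apply/subsetPn; exists z; rewrite !inE ?fzu.
    move=> p [q [+ + /set1P pu _]]; subst p; rewrite !inE => _ /eqP fq uq.
    have iuq : inner u q by rewrite /inner uq fq eqxx fu.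
    case: (noz' u q x iuq vx) => [e|xq]; first by rewrite e eqxx in ux.
    case: (noz' u q y iuq vy) => [e|yq]; first by rewrite e eqxx in uy.
    by move: nxy; rewrite xq yq eqxx.
  have fsing u : u != x -> u != y -> u != v -> f u != f x.
    move=> ux uy uv; apply/negP=> /eqP e.
    by have := ux; rewrite -(single u x ux uy uv) ?eqxx.
  have adj u u' : u != x -> u != y -> u != v -> u' != x -> u' != y -> u' != v ->
      u != u' -> edge u u'.
    move=> ux uy uv ux' uy' uv' uu'.
    have nf : f u != f u' by apply: contraNneq uu' => /(single u' u ux' uy' uv')->.
    have key i j p q : i < j -> j < 4 -> f p = i -> f q = j -> p != x -> p != y -> p != v ->
      q != x -> q != y -> q != v -> edge p q.
      move=> ij j4 fp fq px py pv qx qy qv; have /touchP[a [b []]] := ft i j ij j4.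
      rewrite !inE -fp -fq => /eqP/(single p a px py pv)-> /eqP/(single q b qx qy qv)->//.
    move: nf; rewrite neq_ltn => /orP[] lt.
      by apply: (key (f u) (f u')) => //; exact: fspan.
    by rewrite edge_sym; apply: (key (f u') (f u)) => //; exact: fspan.
  have xory u : u != x -> u != y -> u != v -> edge x u || edge y u.
    move=> ux uy uv; have fux := fsing u ux uy uv; have fu := fspan u uv.
    have : touch (bag f (f u)) (bag f (f x)).
      move: fux; rewrite neq_ltn => /orP[] lt; first exact: ft.
      by rewrite touchC; apply: ft.
    move=> /touchP[a [b []]]; rewrite !inE => /eqP/(single u a ux uy uv)-> /eqP fb.
    have bv : b != v by apply: fv4; rewrite fb.
    rewrite edge_sym; have [->->//|bx] := eqVneq b x.
    have [->->//|by_] := eqVneq b y; first by rewrite orbT.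
    by have := fsing b bx by_ bv; rewrite fb eqxx.
  have other u w : u != v -> exists2 z, [/\ z != u, z != w & z != v] & edge u z.
    move=> uv; have := mink4_deg mk (u := u); rewrite !inE => /(_ uv)/(nbrs_other w)[p].
    rewrite !inE => /andP[pv up] pw; exists p => //.
    by rewrite pw pv eq_sym edge_neq.
  apply: Or33.
  have [b [bx by_ bv] xb] := other x y xv.
  have [c [cy cx cv'] yc] := other y x yv.
  (* Any vertex in a bag other than those of [x], [a] and [a']. *)
  have third a a' : exists2 z, [/\ z != x, z != y & z != v] & (z != a) && (z != a').
    case: (boolP (has (fun j => j \notin [:: f x; f a; f a']) (iota 0 4))) => [/hasP[j]|].
      rewrite mem_iota !inE !negb_or => j4 /and3P[jx ja ja'].
      have /set0Pn[z] := f0 j j4; rewrite inE => /eqP fz; exists z.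
        split; first by apply: contraNneq jx => <-; rewrite fz.
          by apply: contraNneq jx => zy; rewrite fxy -zy fz.
        by apply: fv4; rewrite fz.
      apply/andP; split; first by apply: contraNneq ja => <-; rewrite fz.
      by apply: contraNneq ja' => <-; rewrite fz.
    move/hasPn => h; have := @uniq_leq_size _ (iota 0 4) [:: f x; f a; f a'] (iota_uniq 0 4).
    by move=> H; have := H (fun j hj => negbNE (h j hj)).
  have ear p b1 c1 d1 q : edge p q -> edge v p -> edge v q ->
      [/\ b1 != p, b1 != q & b1 != v] -> [/\ c1 != p, c1 != q & c1 != v] ->
      [/\ d1 != p, d1 != q & d1 != v] -> (forall z, z != p -> z != q -> ~~ edge v z) ->
      (forall u u', u != p -> u != q -> u != v -> u' != p -> u' != q -> u' != v ->
         u != u' -> edge u u') ->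
      b1 != c1 -> b1 != d1 -> c1 != d1 -> edge p b1 -> edge q c1 -> edge q d1 -> house F.
    move=> pq vp vq [bp bq bv1] [cp cq cv1] [dp dq dv1] vN' adj' bc bd cd pb qc qd.
    apply: (@house_ear F v p q b1 c1 d1) => //; try exact: adj'; try exact: vN'.
    rewrite /= !inE !negb_or ![v == _]eq_sym bv1 cv1 dv1 [p == v]eq_sym [q == v]eq_sym.
    rewrite (edge_neq vp) (edge_neq vq) (edge_neq pb) (edge_neq pq) bq bc bd cd.
    by rewrite (edge_neq qc) (edge_neq qd) [p == c1]eq_sym [p == d1]eq_sym cp dp.
  (* Each of three vertices off [x], [y] sees [x] or [y], and each of [x], [y] sees one of them. So
     one end can absorb one of the three into its bag while the other end sees the two that
     remain. *)
  have tm b1 c1 d1 : [/\ b1 != x, b1 != y & b1 != v] -> [/\ c1 != x, c1 != y & c1 != v] ->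
      [/\ d1 != x, d1 != y & d1 != v] -> b1 != c1 -> b1 != d1 -> c1 != d1 ->
      edge x b1 -> edge y c1 -> edge y d1 -> house F.
    by move=> hb hc hd; apply: (ear x b1 c1 d1 y).
  have tm' b1 c1 d1 : [/\ b1 != x, b1 != y & b1 != v] -> [/\ c1 != x, c1 != y & c1 != v] ->
      [/\ d1 != x, d1 != y & d1 != v] -> b1 != c1 -> b1 != d1 -> c1 != d1 ->
      edge y b1 -> edge x c1 -> edge x d1 -> house F.
    move=> [? ? ?] [? ? ?] [? ? ?]; apply: (ear y b1 c1 d1 x) => //.
    - by rewrite edge_sym.
    - by move=> z zy zx; exact: vN.
    by move=> u u' uy ux uv uy' ux' uv'; exact: adj.
  have [d [dx dy dv1] /andP[db dc]] := third b c.
  have [bc|bc] := eqVneq b c.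
    subst c; have [e [ex_ ey ev] /andP[eb ed]] := third b d.
    case: (boolP (edge y d)) => yd.
      case/orP: (xory e ex_ ey ev) => e1; first by apply: (tm e b d); rewrite // eq_sym.
      by apply: (tm b d e); rewrite // eq_sym.
    have := xory d dx dy dv1; rewrite (negbTE yd) orbF => xd.
    case/orP: (xory e ex_ ey ev) => e1; first by apply: (tm' b d e); rewrite // eq_sym.
    by apply: (tm d b e); rewrite // eq_sym.
  case/orP: (xory d dx dy dv1) => e1.
    by apply: (tm' c b d); rewrite // eq_sym.
  by apply: (tm b c d); rewrite // eq_sym.
(* all bags are singletons: [F - v] is complete *)
have clique u u' : u != v -> u' != v -> u != u' -> edge u u'.
  have sing i z u1 : i < 4 -> f u1 = i -> f z = i -> z = u1.
    move=> i4 fu fz; apply/eqP; apply: contraT => zu.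
    have [] := @conn_cross _ _ [set u1] (fc _ i4).
    - by exists u1; rewrite !inE ?fu.
    - by apply/subsetPn; exists z; rewrite !inE ?fz.
    move=> p [q [+ + /set1P pu _]]; subst p; rewrite !inE => _ /eqP fq uq.
    by have /existsPn/(_ q) := noi u1; rewrite /inner uq fq fu eqxx i4.
  have key i j p q : i < j -> j < 4 -> f p = i -> f q = j -> edge p q.
    move=> ij j4 fp fq; have /touchP[a [b []]] := ft i j ij j4.
    by rewrite !inE => /eqP/(sing i a p (ltn_trans ij j4) fp)-> /eqP/(sing j b q j4 fq)->.
  move=> uv uv' uu'.
  have nf : f u != f u' by apply: contraNneq uu' => e; apply/eqP/(sing (f u')) => //; exact: fspan.
  move: nf; rewrite neq_ltn => /orP[] lt.
    by apply: (key (f u) (f u')) => //; exact: fspan.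
  by rewrite edge_sym; apply: (key (f u') (f u)) => //; exact: fspan.
(* With two nonneighbours [v] completes a full house. With at most one, the graph is [K_5] or [K_5]
   minus an edge, and both are complete multipartite. *)
case: (boolP [exists c, exists d, [&& c != v, d != v, c != d, ~~ edge v c & ~~ edge v d]]).
  move=> /existsP[c /existsP[d /and5P[cv1 dv1 cd vc vd]]]; apply: Or33.
  have /card_gt1P[a [b [+ + ab]]] := dv; rewrite !inE /= => va vb.
  have av : a != v by rewrite eq_sym edge_neq.
  have bv : b != v by rewrite eq_sym edge_neq.
  have neqs p q : edge v p -> ~~ edge v q -> p != q by move=> e; apply: contraNneq => <-.
  have [ac ad bc bd] : [/\ a != c, a != d, b != c & b != d] by rewrite !neqs.
  apply: (@house_deg2 F v a b c d) => //; try exact: clique.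
  by rewrite /= !inE !negb_or ![v == _]eq_sym av bv cv1 dv1 ab ac ad bc bd cd.
move=> /existsPn h; apply: Or31 => e c d _ _ _ cd.
have ncd := edge_neq cd.
have [->|ec] := eqVneq e c; first by rewrite cd orbT.
have [->|ed] := eqVneq e d; first by rewrite edge_sym cd.
have [ev|ev] := eqVneq e v.
  subst e; apply: contraT; rewrite negb_or => /andP[vc vd].
  have /existsPn/(_ d) := h c.
  by rewrite vc vd ncd ![_ == v]eq_sym ec ed.
have [cv1|cv1] := eqVneq c v; last by rewrite clique.
by rewrite (clique e d) ?orbT // -cv1 eq_sym.
Qed.

(** * Attaching a connected set to a minimal K_4 minor *)

Section MinMax.

Variables (T : finType) (P : {set T} -> Prop).

Lemma min_set X : P X -> exists Y : {set T}, [/\ Y \subset X, P Y & forall Z : {set T}, Z \proper Y -> ~ P Z].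
Proof.
have [n] := ubnP #|X|; elim: n X => // n IH X leX PX.
case: (classic (exists Z : {set T}, Z \proper X /\ P Z)) => [[Z [ZX PZ]]|h].
  have [|Y [YZ PY mY]] := IH Z _ PZ; first by apply: leq_trans (proper_card ZX) _.
  by exists Y; split=> //; apply: subset_trans YZ (proper_sub ZX).
by exists X; split=> // Z ZX PZ; apply: h; exists Z.
Qed.

Lemma max_set X : P X -> exists Y : {set T}, [/\ X \subset Y, P Y & forall Z : {set T}, Y \proper Z -> ~ P Z].
Proof.
have [n] := ubnP (#|T| - #|X|); elim: n X => // n IH X leX PX.
case: (classic (exists Z : {set T}, X \proper Z /\ P Z)) => [[Z [XZ PZ]]|h].
  have [|Y [ZY PY mY]] := IH Z _ PZ.
    apply: leq_trans (_ : #|T| - #|X| <= n); last by [].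
    by apply: ltn_sub2l; [apply: leq_trans (max_card (mem Z)) |]; exact: proper_card.
  by exists Y; split=> //; apply: subset_trans (proper_sub XZ) ZY.
by exists X; split=> // Z ZX PZ; apply: h; exists Z.
Qed.

End MinMax.

Lemma k4_card (G : sgraph) (X : {set G}) : k4 X -> 4 <= #|X|.
Proof.
move=> [f [fX f0 fc ft]].
have h i : i < 4 -> exists2 u, u \in X & f u = i.
  by move=> i4; have /set0Pn[u] := f0 i i4; rewrite inE => /eqP fu; exists u; rewrite ?fX ?fu.
have := @uniq_leq_size _ (iota 0 4) (map f (enum X)) (iota_uniq 0 4).
rewrite size_map -cardE; apply => i; rewrite mem_iota => i4.
by have [u uX <-] := h i i4; rewrite map_f ?mem_enum.
Qed.

Section Sets.

Variable G : sgraph.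
Implicit Types (X Y H Q R : {set G}) (u v : G).

(** A missing edge would give a vertex of degree at most 2, whose elimination leaves only three
    vertices. *)
Lemma k4_card4 X : k4 X -> #|X| <= 4 -> {in X &, forall u v, u != v -> edge u v}.
Proof.
move=> kX X4 u v uX vX uv; apply: contraT => nuv; exfalso.
have nb w z : w \in X -> z \in X -> w != z -> ~~ edge w z -> #|nbrs X w| <= 2.
  move=> wX zX wz nwz; have : #|nbrs X w| <= #|X :\ w :\ z|.
    apply: subset_leq_card; apply/subsetP=> y; rewrite !inE => /andP[-> e].
    by rewrite andbT; apply/andP; split; apply: contraTneq e => -> //; rewrite edge_irr.
  move/leq_trans; apply; move: X4; rewrite (cardsD1 w) wX (cardsD1 z (X :\ w)) !inE zX andbT.
  by rewrite eq_sym wz.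
have /k4_card := (k4_eliminate uX (nb u v uX vX uv nuv)).1 kX.
by move: X4; rewrite (cardsD1 u) uX add1n => h /(leq_trans h); rewrite ltnn.
Qed.

Lemma mink4_exists X : k4 X -> exists2 H : {set G}, H \subset X & mink4 H.
Proof.
move/(@min_set G (@k4 G)) => [H [HX kH mH]]; exists H => //; split=> // u uH.
by apply: mH; exact: properD1.
Qed.

Lemma k4_perm (s : {perm G}) X Y : (forall u, (s u \in Y) = (u \in X)) ->
  {in X &, forall u v, edge (s u) (s v) = edge u v} -> k4 Y -> k4 X.
Proof.
move=> sXY se [f [fY f0 fc ft]].
have fX u : f (s u) < 4 -> u \in X by move/fY; rewrite sXY.
have bagE i u : (u \in bag (fun u => f (s u)) i) = (s u \in bag f i) by rewrite !inE.
have bX i u : i < 4 -> u \in bag (fun u => f (s u)) i -> u \in X.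
  by move=> i4; rewrite inE => /eqP e; apply: fX; rewrite e.
exists (fun u => f (s u)); split=> //.
- move=> i i4; have /set0Pn[u ui] := f0 i i4; apply/set0Pn; exists ((s^-1)%g u).
  by rewrite bagE permKV.
- move=> i i4 S [u uB uS] clS.
  have /subsetP sub : bag f i \subset [set z | (s^-1)%g z \in S].
    apply: fc => //; first by exists (s u); [rewrite -bagE | rewrite inE permK].
    move=> p q pB qB pq; rewrite !inE => pS.
    have pB' : (s^-1)%g p \in bag (fun u => f (s u)) i by rewrite bagE permKV.
    have qB' : (s^-1)%g q \in bag (fun u => f (s u)) i by rewrite bagE permKV.
    apply: (clS _ _ pB' qB') => //.
    by rewrite -se ?permKV //; apply: bX i4 _.
  by apply/subsetP=> z; rewrite bagE => /sub; rewrite inE permK.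
move=> i j ij j4; have /touchP[p [q [pB qB pq]]] := ft i j ij j4.
have pB' : (s^-1)%g p \in bag (fun u => f (s u)) i by rewrite bagE permKV.
have qB' : (s^-1)%g q \in bag (fun u => f (s u)) j by rewrite bagE permKV.
apply/touchP; exists ((s^-1)%g p), ((s^-1)%g q); split=> //.
rewrite -se ?permKV //; [apply: (bX i) => // | exact: (bX j)].
exact: ltn_trans j4.
Qed.

(* Contracting the connected set [Q] to a vertex attached to [H]. *)
Section Attach.

Variables (H Q : {set G}).
Hypotheses (cQ : conn Q) (Q0 : Q != set0) (dHQ : [disjoint H & Q]).

Let T := option {h : G | h \in H}.

Definition attach_map (u : G) : option T :=
  if insub u is Some h then Some (Some h) else if u \in Q then Some None else None.

Let fib (t : T) := [set u | attach_map u == Some t].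

Let fibS (h : {h : G | h \in H}) : fib (Some h) = [set val h].
Proof.
apply/setP=> u; rewrite !inE /attach_map; case: insubP => [h' uH <-|uH].
  by apply/eqP/eqP => [[->]|/val_inj->].
by case: ifP => _; apply/esym/negbTE; apply: contraNneq uH => ->; exact: (valP h).
Qed.

Let fibN : fib None = Q.
Proof.
apply/setP=> u; rewrite !inE /attach_map; case: insubP => [h uH _|uH]; last by case: ifP.
by apply/esym/negbTE; rewrite (disjointFr dHQ uH).
Qed.

Definition attach_edge : rel T := fun s t => (s != t) && touch (fib s) (fib t).

Fact attach_sym : symmetric attach_edge.
Proof. by move=> s t; rewrite /attach_edge eq_sym touchC. Qed.

Fact attach_irr : irreflexive attach_edge.
Proof. by move=> s; rewrite /attach_edge eqxx. Qed.

Definition attach := SGraph attach_sym attach_irr.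

Lemma attach_qmap : @qmap G attach attach_map.
Proof.
split.
- move=> [h|]; last by rewrite [fiber _ _]fibN.
  by rewrite [fiber _ _]fibS; apply/set0Pn; exists (val h); rewrite inE.
- by move=> [h|]; [rewrite [fiber _ _]fibS; exact: conn1 | rewrite [fiber _ _]fibN].
by move=> s t st; rewrite -[LHS]/((s != t) && touch (fib s) (fib t)) st.
Qed.

Definition att u := touch [set u] Q.

Lemma attachSS (h h' : {h : G | h \in H}) :
  @edge attach (Some h) (Some h') = edge (val h) (val h').
Proof.
rewrite -[LHS]/((Some h != Some h') && touch (fib (Some h)) (fib (Some h'))) !fibS.
apply/andP/idP.
  by case=> _ /touchP[u [w []]]; rewrite !inE => /eqP-> /eqP->.
move=> e; split; last by apply/touchP; exists (val h), (val h'); rewrite !inE.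
by apply: contraTneq e => -[->]; rewrite edge_irr.
Qed.

Lemma attachSN (h : {h : G | h \in H}) : @edge attach (Some h) None = att (val h).
Proof.
by rewrite -[LHS]/((Some h != None) && touch (fib (Some h)) (fib None)) fibS fibN.
Qed.

Lemma attachNS (h : {h : G | h \in H}) : @edge attach None (Some h) = att (val h).
Proof. by rewrite edge_sym attachSN. Qed.

Lemma attach_pre (Y : {set attach}) : None \notin Y ->
  pre (F := attach) attach_map Y = [set val h | h in [set h | Some h \in Y]].
Proof.
move=> nY; apply/setP=> u; rewrite inE /attach_map; apply/idP/imsetP.
  case: insubP => [h uH <- hY|uH]; first by exists h; rewrite ?inE.
  by case: ifP => //; rewrite (negbTE nY).
by move=> [h]; rewrite inE => hY ->; rewrite valK.
Qed.

(** This is [extend_minimal] for [attach], read back in [H]. In the exceptional case [None] lies in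
    the independent part, so [Q] is attached to [a], [b] and [c] and to nothing else in [H]. *)
Lemma extend_set : mink4 H -> 1 < #|[set h in H | att h]| -> ~ house G ->
  [/\ cm H, {in H &, forall a b, edge a b -> att a || att b} &
    {in H &, forall a b, att a -> ~~ att b -> edge a b}] \/
  exists a b c, [/\ a \in H, b \in H & c \in H] /\
    [/\ edge a b, ~~ edge c a & ~~ edge c b] /\ [/\ att a, att b & att c] /\
    {in H :\: [set a; b; c], forall u, [&& edge u a, edge u b, edge u c & ~~ att u]}.
Proof.
move=> mH a1 nh; pose F := attach; have qm := attach_qmap.
have [[f [fX f0 fc ft]] mX] := mH.
have mk : @mink4 F [set~ None].
  pose f' u := if u \in H then f u else 4.
  have f'E i : i < 4 -> bag f' i = bag f i.
    move=> i4; apply/setP=> u; rewrite !inE /f'; case: ifP => // uH.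
    rewrite eq_sym (ltn_eqF i4); apply/esym/negbTE; apply: contraFneq uH => fu.
    by apply: fX; rewrite fu.
  split.
    apply: (@k4_descend _ F attach_map qm _ f').
    - move=> u w t; rewrite /attach_map /f'; case: insubP => [h uH <- [<-]|/negbTE->].
        by case: insubP => [h' wH <- [->]|_] //; case: ifP.
      by case: ifP => // _ [<-]; case: insubP => // /negbTE-> ; case: ifP.
    - by move=> u; rewrite /attach_map /f'; case: insubP => // /negbTE->.
    - move=> u; rewrite inE /f' /attach_map; case: ifP => // uH _.
      by rewrite insubT !inE.
    - by move=> i i4; rewrite f'E ?f0.
    - by move=> i i4; rewrite f'E //; exact: fc.
    by move=> i j ij j4; rewrite !f'E ?ft // (ltn_trans ij).
  move=> [h|]; rewrite !inE // => _ kh.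
  apply: (mX (val h) (valP h)); apply: k4S (k4_quot qm kh).
  rewrite attach_pre ?inE ?eqxx //; apply/subsetP=> u /imsetP[h' + ->].
  by rewrite !inE => /andP[hh _]; rewrite (valP h') andbT; apply: contraNneq hh => e; apply/eqP; congr Some; exact: val_inj.
have dv : 1 < #|@nbrs F setT None|.
  have /card_gt1P[p [q [+ + pq]]] := a1; rewrite !inE => /andP[pH ap] /andP[qH aq].
  apply/card_gt1P; exists (Some (Sub p pH)), (Some (Sub q qH)).
  rewrite !inE !attachNS ap aq; split=> //.
case: (extend_minimal mk dv) => [hcm|hexc|/(house_quot qm)//].
  left; split.
  - move=> e c d eH cH dH cd.
    have := hcm (Some (Sub e eH)) (Some (Sub c cH)) (Some (Sub d dH)).
    by rewrite !inE !attachSS /= => /(_ isT isT isT cd).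
  - move=> a b aH bH ab.
    have := hcm None (Some (Sub a aH)) (Some (Sub b bH)).
    by rewrite !inE !attachSS !attachNS /= => /(_ isT isT isT ab).
  move=> a b aH bH aa ab.
  have := hcm (Some (Sub b bH)) None (Some (Sub a aH)).
  rewrite !inE !attachSS !attachNS !attachSN /= => /(_ isT isT isT aa).
  by rewrite (negbTE ab) edge_sym.
right; have [_ [a [b [c [[ab ca cb _] [_ [nv [hU hI]]]]]]]] := exc_mink4 hexc mk.
have NU : None \in ~: [set a; b; c] by rewrite inE.
case: a ab ca nv hU hI NU => [[a aH]|]; last by rewrite !inE eqxx.
case: b cb => [[b bH]|]; last by rewrite !inE eqxx orbT.
case: c => [[c cH]|]; last by rewrite !inE eqxx !orbT.
rewrite !attachSS => cb ab ca nv hU hI NU.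
exists a, b, c; split=> //; split=> //; split.
  by have /and3P[] := hU None NU; rewrite !attachNS.
move=> u; rewrite !inE !negb_or => /andP[/andP[/andP[ua ub] uc] uH].
have uU : Some (Sub u uH) \in ~: [set Some (exist _ a aH); Some (exist _ b bH); Some (exist _ c cH)].
  rewrite !inE !negb_or; apply/andP; split; [apply/andP; split|].
  - by apply/eqP => -[e]; case/eqP: ua.
  - by apply/eqP => -[e]; case/eqP: ub.
  - by apply/eqP => -[e]; case/eqP: uc.
have /and3P[] := hU _ uU; rewrite !attachSS /= => -> -> ->.
by have := hI _ _ uU NU; rewrite attachSN.
Qed.

End Attach.

End Sets.

(** * 2-connected graphs *)

Section Outside.

Variable G : sgraph.
Implicit Types (X H Q R : {set G}) (u v : G).

Lemma conn_add Q q : conn Q -> att Q q -> conn (q |: Q).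
Proof. by move=> cQ qQ; apply: connU => //; exact: conn1. Qed.

Lemma attP Q u : reflect (exists2 q, q \in Q & edge u q) (att Q u).
Proof.
apply: (iffP (touchP _ _)) => [[a [q []]]|[q qQ e]]; last by exists u, q; rewrite !inE.
by rewrite inE => /eqP-> qQ e; exists q.
Qed.

Lemma att1 q u : att [set q] u = edge u q.
Proof. by apply/attP/idP => [[z /set1P->]|e] //; exists q; rewrite ?inE. Qed.

(** A maximal connected proper subset containing [p] lacks exactly one vertex, and this is [q]. *)
Lemma noncut Q p : conn Q -> p \in Q -> Q != [set p] ->
  exists q, [/\ q \in Q, q != p & conn (Q :\ q)].
Proof.
move=> cQ pQ Qp.
pose P (Y : {set G}) := [/\ conn Y, p \in Y & Y \proper Q].
have [|Y [_ [cY pY YQ] mY]] := @max_set _ P [set p].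
  by split; [exact: conn1 | rewrite inE | rewrite properEneq eq_sym Qp sub1set].
have [|y [q [_ qQ yY qY yq]]] := conn_cross (S := Y) cQ _ (proper_subn YQ); first by exists p.
have cqY : conn (q |: Y) by apply: conn_add => //; apply/attP; exists y; rewrite // edge_sym.
have qYQ : q |: Y = Q.
  apply/eqP; rewrite eqEproper subUset sub1set qQ proper_sub //=; apply/negP=> h.
  by apply: (mY (q |: Y)); [rewrite properUr // sub1set | split; rewrite ?inE ?pY ?orbT].
exists q; split=> //; first by apply: contraNneq qY => ->.
by rewrite -qYQ setU1K.
Qed.

Definition reach2 R Q := [/\ conn Q, Q != set0, [disjoint R & Q] &
  1 < #|[set h in R | att Q h]|].

Hypothesis h2 : forall z : G, conn [set~ z].

(** [Q] is a component of the complement of [R]. Were it attached to at most one vertex [z] of [R],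
    then [z] would separate it from the rest of [R]. *)
Lemma outside R : R != setT -> 1 < #|R| -> exists Q, reach2 R Q.
Proof.
move=> RT R1; have [u0 u0R] : exists u, u \notin R.
  by apply/existsP; rewrite -negb_forall; apply: contraNN RT => /forallP h;
     apply/eqP/setP => u; rewrite h inE.
pose P (Y : {set G}) := [/\ conn Y, u0 \in Y & [disjoint R & Y]].
have [|Q [_ [cQ uQ dQ] mQ]] := @max_set _ P [set u0].
  by split; [exact: conn1 | rewrite inE | rewrite disjoint_sym disjoints1].
have out q v : q \in Q -> v \notin R -> edge q v -> v \in Q.
  move=> qQ vR qv; apply: contraT => vQ; exfalso; apply: (mQ (v |: Q)).
    by rewrite properUr // sub1set.
  split; last 2 first.
  - by rewrite inE uQ orbT.
  - by rewrite disjoint_sym disjoint_subset; apply/subsetP=> z; rewrite !inE => /orP[/eqP->//|zQ];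
      rewrite (disjointFl dQ zQ).
  by apply: conn_add => //; apply/attP; exists q; rewrite // edge_sym.
exists Q; split=> //; first by apply/set0Pn; exists u0.
rewrite ltnNge; apply/negP=> /card_le1_eqP le1.
have [z zR hz] : exists2 z, z \in R & forall r, r \in R -> att Q r -> r = z.
  have [r|no] := pickP [pred r | (r \in R) && att Q r].
    move=> /= /andP[rR ar]; exists r => // r' r'R ar'; apply: le1; rewrite inE ?rR ?r'R //.
  have /card_gt0P[z zR] : 0 < #|R| by apply: ltn_trans R1.
  by exists z => // r rR ar; have := no r; rewrite /= rR ar.
have /subsetP sub : [set~ z] \subset Q.
  apply: h2.
    by exists u0; rewrite // !inE; apply: contraNneq u0R => ->.
  move=> u v uz vz uv uQ'; case: (boolP (v \in R)) => vR; last exact: (out u).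
  have := hz v vR; rewrite !inE in vz; case/eqP: vz.
  by apply: hz => //; apply/attP; exists u; rewrite // edge_sym.
have /card_gt1P[a [b [aR bR ab]]] := R1.
have [r rR rz] : exists2 r, r \in R & r != z.
  by have [az|az] := eqVneq a z; [exists b; rewrite // -az eq_sym | exists a].
by have := disjointFr dQ rR; rewrite sub // !inE.
Qed.

(** If a minimal [Q] has two vertices, it has two noncut vertices. Removing either leaves a
    connected set with at most one attachment, and the two remainders cover [Q]. *)
Lemma outside_min R : R != setT -> 1 < #|R| -> exists Q, reach2 R Q /\
  ((exists q, Q = [set q]) \/ #|[set h in R | att Q h]| <= 2).
Proof.
move=> RT R1; have [Q0 rQ0] := outside RT R1.
have [Q [_ [cQ Q0' dQ nQ] mQ]] := min_set rQ0.
exists Q; split=> //; have [p pQ] := set0Pn _ Q0'.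
have [->|Qp] := eqVneq Q [set p]; [by left; exists p | right].
have [q [qQ qp cq]] := noncut cQ pQ Qp.
have Qq : Q != [set q] by apply: contraTneq pQ => ->; rewrite inE eq_sym.
have [r [rQ rq cr]] := noncut cQ qQ Qq.
have le1 s : s \in Q -> conn (Q :\ s) -> (exists2 z, z \in Q & z != s) ->
    #|[set h in R | att (Q :\ s) h]| <= 1.
  move=> sQ cs [z zQ zs]; rewrite leqNgt; apply/negP=> h.
  apply: (mQ (Q :\ s)); first exact: properD1.
  split=> //; first by apply/set0Pn; exists z; rewrite !inE zs.
  by apply: disjointWr dQ; exact: subD1set.
have l1 : #|[set h in R | att (Q :\ q) h]| <= 1 by apply: le1 => //; exists p; rewrite // eq_sym.
have l2 : #|[set h in R | att (Q :\ r) h]| <= 1 by apply: le1 => //; exists q; rewrite // eq_sym.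
apply: leq_trans (_ : #|[set h in R | att (Q :\ q) h] :|: [set h in R | att (Q :\ r) h]| <= _).
  apply: subset_leq_card; apply/subsetP=> h; rewrite !inE => /andP[-> /attP[z zQ hz]] /=.
  have [zq|zq] := eqVneq z q; apply/orP; [right|left]; apply/attP; exists z => //.
    by rewrite !inE zQ zq eq_sym rq.
  by rewrite !inE zQ zq.
by apply: leq_trans (leq_card_setU _ _) _; rewrite -[2]/(1 + 1) leq_add.
Qed.

End Outside.

(** * Ears of complete multipartite graphs *)

Section CmEar.

Variable G : sgraph.
Variables (F Q : {set G}) (r1 r2 : G).
Hypotheses (cF : cm F) (dF : {in F, forall a, 2 < #|nbrs F a|}).
Hypotheses (cQ : conn Q) (Q0 : Q != set0) (dQ : [disjoint F & Q]).
Hypotheses (r12 : r1 != r2) (r1F : r1 \in F) (r2F : r2 \in F).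
Hypotheses (a1 : att Q r1) (a2 : att Q r2).
Hypothesis na : {in F, forall r, r != r1 -> r != r2 -> ~~ att Q r}.

Let third p q a : a \in F -> exists2 z, [/\ z \in F, z != p & z != q] & edge a z.
Proof.
move=> /dF; rewrite (cardsD1 p) (cardsD1 q (_ :\ _)) => d.
have /card_gt0P[z] : 0 < #|nbrs F a :\ p :\ q|.
  move: d; case: (p \in _); case: (q \in _); rewrite ?add1n ?add0n //.
  - by move/ltnW.
  - by move/ltnW.
  by move=> h; apply: leq_ltn_trans h.
by rewrite !inE => /and4P[zq zp zF az]; exists z.
Qed.

(** It remains to find four bags in [F] that separate [r1] from [r2]: [Q], attached to these two
    only, is then the fifth bag. *)
Let fin la' lb' lc ld : uniq ((r1 :: la') ++ (r2 :: lb') ++ lc ++ ld) ->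
  {subset la' ++ lb' ++ lc ++ ld <= F} ->
  linked (r1 :: la') -> linked (r2 :: lb') -> linked lc -> linked ld ->
  [/\ tch (r1 :: la') (r2 :: lb'), tch (r1 :: la') lc & tch (r1 :: la') ld] ->
  [/\ tch (r2 :: lb') lc, tch (r2 :: lb') ld & tch lc ld] -> house G.
Proof.
move=> un sub k1 k2 k3 k4 [t1 t2 t3] [t4 t5 t6].
have natt (l : seq G) : {subset l <= F} -> r1 \notin l -> r2 \notin l -> ~~ touch [set u in l] Q.
  move=> lF n1 n2; apply/negP => /touchP[u [q []]]; rewrite inE => ul qQ uq.
  have : att Q u by apply/attP; exists q.
  by apply/negP/na; [exact: lF | apply: contraNneq n1 => <- | apply: contraNneq n2 => <-].
have touches r (l : seq G) : r \in l -> att Q r -> touch [set u in l] Q.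
  by move=> rl; apply: touchS => //; rewrite sub1set inE.
have sF (l : seq G) : {subset l <= la' ++ lb' ++ lc ++ ld} -> {subset l <= F} by move=> h z /h /sub.
have [n1c n1d] : r1 \notin lc /\ r1 \notin ld.
  by move: un; rewrite /= !mem_cat !inE !mem_cat !negb_or -!andbA => /and5P[_ _ _ -> /andP[-> _]].
have [n2c n2d] : r2 \notin lc /\ r2 \notin ld.
  move: un; rewrite cat_uniq => /and3P[_ _]; rewrite cat_cons cons_uniq !mem_cat !negb_or.
  by case/andP=> /and3P[_ -> ->].
apply: (house_lists (E := Q) un) => //.
- move=> u; rewrite !mem_cat !inE -!orbA => uu.
  have : u \in F.
    case/or4P: uu => [/eqP->//|h|/eqP->//|h]; apply: sub; rewrite !mem_cat ?h ?orbT //.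
  by move=> uF; rewrite (disjointFr dQ uF).
- by apply: (touches r1); rewrite ?inE ?eqxx.
- by apply: (touches r2); rewrite ?inE ?eqxx.
- by apply: natt => //; apply: sF => z zl; rewrite !mem_cat zl !orbT.
- by apply: natt => //; apply: sF => z zl; rewrite !mem_cat zl !orbT.
Qed.

Lemma cm_ear : house G.
Proof.
have nsym p q : p != q -> q != p by rewrite eq_sym.
(* If [r1] and [r2] are nonadjacent they are twins, so three neighbours of [r1] are common
   neighbours. *)
have [e12|n12] := boolP (edge r1 r2); last first.
  have r2z z : z \in F -> edge r1 z -> edge r2 z.
    move=> zF e; have := cF r2F r1F zF e; rewrite edge_sym (negbTE n12) => //.
  have [t1 [t1F t11 t12] e1] := third r1 r2 r1F.
  have [t2 [t2F t21 t22] e2] := third t1 r2 r1F.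
  have [t3 [t3F t31 t32] e3] := third t1 t2 r1F.
  have f1 := r2z _ t1F e1; have f2 := r2z _ t2F e2; have f3 := r2z _ t3F e3.
  have g1 := edge_neq e1; have g2 := edge_neq e2; have g3 := edge_neq e3.
  have h1 := edge_neq f1; have h2 := edge_neq f2; have h3 := edge_neq f3.
  have main c d t : c \in F -> d \in F -> t \in F -> c != d -> c != t -> d != t ->
      edge c d -> edge r1 c -> edge r1 d -> edge r1 t -> house G.
    move=> cF' dF' tF cd ct dt ecd ec ed et.
    have fc := r2z _ cF' ec; have fd := r2z _ dF' ed; have ft := r2z _ tF et.
    apply: (@fin [:: t] [::] [:: c] [:: d]) => //=.
    - rewrite !inE !negb_or (edge_neq et) r12 (edge_neq ec) (edge_neq ed).
      by rewrite ![t == _]eq_sym (edge_neq ft) ct dt (edge_neq fc) (edge_neq fd) cd.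
    - by move=> z; rewrite !inE => /or3P[]/eqP->.
    - by rewrite /tch /= ec ed [edge t r2]edge_sym ft !orbT.
    - by rewrite /tch /= fc fd ecd.
  case: (boolP (edge t1 t2)) => t12e.
    by apply: (main t1 t2 t3) => //; apply: nsym.
  case: (boolP (edge t2 t3)) => t23e.
    by apply: (main t2 t3 t1) => //; apply: nsym.
  (* Now [t1], [t2], [t3] are in one class, and a further neighbour [p] of [t2] links [t2] to
     [t3]. *)
  have [p [pF p1 p2] ep] := third r1 r2 t2F.
  have t3p : edge t3 p.
    by have := cF t3F t2F pF ep; rewrite edge_sym (negbTE t23e).
  have pt1 : p != t1 by apply: contraNneq t12e => <-; rewrite edge_sym.
  apply: (@fin [:: t1] [::] [:: t2] [:: t3; p]) => //=.
  - rewrite !inE !negb_or g1 r12 g2 g3 ![r1 == p]eq_sym p1 ![t1 == _]eq_sym h1 t21 t31 pt1.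
    by rewrite h2 h3 [r2 == p]eq_sym p2 [t2 == t3]eq_sym t32 (edge_neq ep) (edge_neq t3p).
  - by move=> z; rewrite !inE => /or4P[]/eqP->.
  - by rewrite /tch /= e2 e3 [edge t1 r2]edge_sym f1 !orbT.
  - by rewrite /tch /= f2 f3 ep !orbT.
have e21 : edge r2 r1 by rewrite edge_sym.
have or12 z : z \in F -> edge z r1 || edge z r2 by move=> zF; exact: cF.
(* A common neighbour [t] forms a triangle with [r1] and [r2]. The last two bags consist of [t],
   another neighbour [s] of [t] and, if [s] misses [r1] or [r2], a neighbour [u] of the missed
   vertex. *)
have withT t : t \in F -> edge t r1 -> edge t r2 -> house G.
  move=> tF tr1 tr2; have tn1 := edge_neq tr1; have tn2 := edge_neq tr2.
  have [s [sF s1 s2] ts] := third r1 r2 tF; have tsn := edge_neq ts.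
  case: (boolP (edge s r1)) => sr1; case: (boolP (edge s r2)) => sr2.
  - apply: (@fin [::] [::] [:: t] [:: s]) => //=.
    + by rewrite !inE !negb_or r12 ![r1 == _]eq_sym tn1 s1 ![r2 == _]eq_sym tn2 s2 tsn.
    + by move=> z; rewrite !inE => /orP[]/eqP->.
    + by rewrite /tch /= e12 ![edge r1 _]edge_sym tr1 sr1.
    + by rewrite /tch /= ![edge r2 _]edge_sym tr2 sr2 ts.
  - have [u [uF u1 ut] r2u] := third r1 t r2F.
    have us : edge s u by have := cF sF r2F uF r2u; rewrite (negbTE sr2).
    have u2 : u != r2 by rewrite eq_sym edge_neq.
    have sun := edge_neq us.
    case: (boolP (edge u r1)) => ur1.
      apply: (@fin [::] [::] [:: t; s] [:: u]) => //=.
      + rewrite !inE !negb_or r12 ![r1 == _]eq_sym tn1 s1 u1 ![r2 == _]eq_sym tn2 s2 u2 tsn.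
        by rewrite eq_sym ut sun.
      + by move=> z; rewrite !inE => /or3P[]/eqP->.
      + by rewrite /tch /= e12 ![edge r1 _]edge_sym tr1 sr1 ur1.
      + by rewrite /tch /= ![edge r2 _]edge_sym tr2 us [edge u r2]edge_sym r2u !orbT.
    apply: (@fin [::] [::] [:: t] [:: s; u]) => //=.
    + rewrite !inE !negb_or r12 ![r1 == _]eq_sym tn1 s1 u1 ![r2 == _]eq_sym tn2 s2 u2 tsn.
      by rewrite eq_sym ut sun.
    + by move=> z; rewrite !inE => /or3P[]/eqP->.
    + by rewrite /tch /= e12 ![edge r1 _]edge_sym tr1 sr1.
    + by rewrite /tch /= [edge r2 t]edge_sym tr2 r2u ts !orbT.
  - have [u [uF u2 ut] r1u] := third r2 t r1F.
    have us : edge s u by have := cF sF r1F uF r1u; rewrite (negbTE sr1).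
    have u1 : u != r1 by rewrite eq_sym edge_neq.
    have sun := edge_neq us.
    case: (boolP (edge u r2)) => ur2.
      apply: (@fin [::] [::] [:: t; s] [:: u]) => //=.
      + rewrite !inE !negb_or r12 ![r1 == _]eq_sym tn1 s1 u1 ![r2 == _]eq_sym tn2 s2 u2 tsn.
        by rewrite eq_sym ut sun.
      + by move=> z; rewrite !inE => /or3P[]/eqP->.
      + by rewrite /tch /= e12 [edge r1 t]edge_sym tr1 r1u.
      + by rewrite /tch /= ![edge r2 _]edge_sym tr2 ur2 us !orbT.
    apply: (@fin [::] [::] [:: t] [:: s; u]) => //=.
    + rewrite !inE !negb_or r12 ![r1 == _]eq_sym tn1 s1 u1 ![r2 == _]eq_sym tn2 s2 u2 tsn.
      by rewrite eq_sym ut sun.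
    + by move=> z; rewrite !inE => /or3P[]/eqP->.
    + by rewrite /tch /= e12 [edge r1 t]edge_sym tr1 r1u orbT.
    + by rewrite /tch /= [edge r2 t]edge_sym tr2 [edge r2 s]edge_sym sr2 ts.
  by have := or12 s sF; rewrite (negbTE sr1) (negbTE sr2).
have [z [zF z2 _] r1z] := third r2 r2 r1F.
have [z' [z'F z'2 z'z] r1z'] := third r2 z r1F.
have [y [yF y1 _] r2y] := third r1 r1 r2F.
have [y' [y'F y'1 y'y] r2y'] := third r1 y r2F.
case: (boolP (edge z r2)) => zr2; first by apply: (withT z); rewrite // edge_sym.
case: (boolP (edge z' r2)) => z'r2; first by apply: (withT z'); rewrite // edge_sym.
case: (boolP (edge y r1)) => yr1; first by apply: (withT y); rewrite // edge_sym.
case: (boolP (edge y' r1)) => y'r1; first by apply: (withT y'); rewrite // edge_sym.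
(* The chosen neighbours of [r1] miss [r2] and conversely, so they are completely joined to each
   other and yield the bags [r1 z], [r2 y], [y'] and [z']. *)
have cross a b : a \in F -> b \in F -> ~~ edge a r1 -> edge r1 b -> edge a b.
  by move=> aF bF ar rb; have := cF aF r1F bF rb; rewrite (negbTE ar).
have yz := cross y z yF zF yr1 r1z; have yz' := cross y z' yF z'F yr1 r1z'.
have y'z := cross y' z y'F zF y'r1 r1z; have y'z' := cross y' z' y'F z'F y'r1 r1z'.
apply: (@fin [:: z] [:: y] [:: y'] [:: z']) => //=.
- rewrite !inE !negb_or r12 (edge_neq r1z) (edge_neq r1z') ![r1 == _]eq_sym y1 y'1.
  rewrite ![z == _]eq_sym (edge_neq yz) (edge_neq y'z) z'z [r2 == z]eq_sym z2.
  by rewrite (edge_neq r2y) (edge_neq r2y') [r2 == z']eq_sym z'2 [y == y']eq_sym y'y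
    (edge_neq yz') (edge_neq y'z').
- by move=> u; rewrite !inE => /or4P[]/eqP->.
- by rewrite /tch /= e12 r1z' [edge z y']edge_sym y'z !orbT.
- by rewrite /tch /= r2y' yz' y'z' !orbT.
Qed.

End CmEar.

(** * 2-connected graphs: a complete multipartite minimal minor *)

Section TwoConnected.

Variable G : sgraph.
Implicit Types (X H Q R : {set G}) (u v : G).
Hypothesis h2 : forall z : G, conn [set~ z].
Hypothesis nh : ~ house G.

Let sym u v : edge u v -> edge v u.
Proof. by rewrite edge_sym. Qed.

Lemma mink4_gt1 H : mink4 H -> 1 < #|H|.
Proof. by case=> /k4_card kH _; apply: leq_trans kH. Qed.

(* If one minimal [K_4] minor is complete multipartite, so is the whole graph. *)
Section CaseCm.

Variable H : {set G}.
Hypotheses (cH : cm H) (mH : mink4 H).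

Let dH a : a \in H -> 2 < #|nbrs H a| := @cm_deg G H a cH mH.1.

Let extend_cm K Q : cm K -> mink4 K -> reach2 K Q ->
  {in K &, forall a b, edge a b -> att Q a || att Q b} /\
  {in K &, forall a b, att Q a -> ~~ att Q b -> edge a b}.
Proof.
move=> cK mK [cQ Q0 dQ nQ]; case: (extend_set cQ Q0 dQ mK nQ nh) => [[]//|].
move=> [a [b [c [[aK bK cK'] [[ab ca cb] _]]]]].
by have := cK c a b cK' aK bK ab; rewrite (negbTE ca) (negbTE cb).
Qed.

(** Two neighbours in [H] are what [extend_set] requires; it then makes [H] together with [q]
    complete multipartite. *)
Let good q := (q \notin H) && (1 < #|nbrs H q|).

Let reach1 (K : {set G}) q : q \notin K -> 1 < #|nbrs K q| -> reach2 K [set q].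
Proof.
move=> qK dq; split; [exact: conn1 | by apply/set0Pn; exists q; rewrite inE | |].
  by rewrite disjoint_sym disjoints1.
have -> : [set h in K | att [set q] h] = nbrs K q; last by [].
by apply/setP=> z; rewrite !inE att1 edge_sym.
Qed.

Let good1 q : good q -> {in H &, forall a b, edge a b -> edge q a || edge q b}.
Proof.
move=> /andP[qH dq] a b aH bH ab; have [h _] := extend_cm cH mH (reach1 qH dq).
by have := h a b aH bH ab; rewrite !att1 ![edge _ q]edge_sym.
Qed.

Let good2 q : good q -> {in H &, forall a b, edge q a -> ~~ edge q b -> edge a b}.
Proof.
move=> /andP[qH dq] a b aH bH qa qb; have [_ h] := extend_cm cH mH (reach1 qH dq).
by apply: h; rewrite // att1 edge_sym.
Qed.

Let twin q h : good q -> h \in H -> ~~ edge q h -> {in H, forall i, edge q i = edge h i}.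
Proof.
move=> gq hH qh i iH; apply/idP/idP => [qi|hi].
  by rewrite edge_sym; exact: (good2 gq).
by have := good1 gq hH iH hi; rewrite (negbTE qh).
Qed.

Let good_deg q : good q -> 2 < #|nbrs H q|.
Proof.
move=> gq; case: (boolP [exists h in H, ~~ edge q h]) => [/exists_inP[h hH qh]|/existsPn all].
  have -> : nbrs H q = nbrs H h; last exact: dH.
  apply/setP=> i; rewrite !inE; case iH: (i \in H) => //=; exact: twin.
have -> : nbrs H q = H.
  apply/setP=> i; rewrite !inE; case iH: (i \in H) => //=.
  by have := all i; rewrite iH negbK.
by apply: leq_trans (k4_card mH.1).
Qed.

(* Exchanging [h] with a nonneighbour [q] outside [H] is an isomorphism. *)
Let swap q h : good q -> h \in H -> ~~ edge q h ->
  cm (q |: (H :\ h)) /\ mink4 (q |: (H :\ h)).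
Proof.
move=> gq hH qh; have /andP[qH _] := gq.
pose s := tperm h q; pose K := q |: (H :\ h).
have hq : h != q by apply: contraNneq qH => <-.
have sK u : (s u \in H) = (u \in K).
  rewrite /s !inE; case: tpermP => [->|->|/eqP uh /eqP uq].
  - by rewrite (negbTE qH) eqxx orbF (negbTE hq).
  - by rewrite hH eqxx.
  by rewrite uh (negbTE uq).
have tw := twin gq hH qh.
have sq : s q = h by rewrite /s tpermR.
have sD u : u != h -> u \in H -> s u = u.
  move=> uh uH; rewrite /s tpermD //; first by rewrite eq_sym.
  by apply: contraNneq qH => ->.
have se : {in K &, forall u v, edge (s u) (s v) = edge u v}.
  move=> u v; rewrite !inE => /orP[/eqP->|/andP[uh uH]] /orP[/eqP->|/andP[vh vH]].
  - by rewrite sq !edge_irr.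
  - by rewrite sq (sD v) // tw.
  - by rewrite sq (sD u) // edge_sym [RHS]edge_sym tw.
  by rewrite !sD.
have KH u : u \in K -> s u \in H by rewrite sK.
split.
  move=> e c d eK cK dK; rewrite -(se c d) // -(se e c) // -(se e d) //.
  by apply: cH; exact: KH.
split; first exact: (k4_perm sK se mH.1).
move=> u uK; have nk := mH.2 (s u) (KH u uK); apply: contra_not nk.
have sK' w : (s w \in K :\ u) = (w \in H :\ s u).
  rewrite !in_setD1 -sK /s tpermK; congr (~~ _ && _).
  exact: (can2_eq (tpermK h q) (tpermK h q)).
apply: (k4_perm sK') => v w; rewrite !in_setD1 => /andP[_ vH] /andP[_ wH].
have vK : s v \in K by rewrite -sK /s tpermK.
have wK : s w \in K by rewrite -sK /s tpermK.
by rewrite -(se _ _ vK wK) /s !tpermK.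
Qed.

Let adjacent_in h : h \in H -> exists a b,
  [/\ a \in H, b \in H & edge a b] /\ [/\ a != h & b != h].
Proof.
move=> hH; have [a aN ah] := nbrs_other h (ltnW (dH hH)).
move: aN; rewrite inE => /andP[aH ha]; have [b bN bh] := nbrs_other h (ltnW (dH aH)).
by move: bN; rewrite inE => /andP[bH ab]; exists a, b.
Qed.

Let swap_reach q q' h : good q -> good q' -> q != q' -> h \in H -> ~~ edge q h ->
  reach2 (q |: (H :\ h)) [set q'].
Proof.
move=> gq gq' qq' hH qh; have /andP[q'H _] := gq'; apply: reach1.
  by rewrite !inE negb_or eq_sym qq' (negbTE q'H) andbF.
apply: leq_trans (_ : #|nbrs H q' :\ h| <= _).
  by have := good_deg gq'; rewrite (cardsD1 h); case: (_ \in _); rewrite ?add1n ?add0n // => /ltnW.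
by apply: subset_leq_card; apply/subsetP=> z; rewrite !inE => /and3P[-> -> ->]; rewrite orbT.
Qed.

(** [q] replaces [h] in [H], which gives a minimal minor to which [q'] can be compared. A violation
    produces a [K_4] on [h], [q'] and the ends of an edge of [H], of which [q] sees only these
    ends. *)
Let pair1 q q' h : good q -> good q' -> h \in H -> ~~ edge q q' -> ~~ edge q h -> ~~ edge q' h.
Proof.
move=> gq gq' hH qq' qh; have [->//|nqq] := eqVneq q' q; apply/negP => q'h.
have nqq' : q != q' by rewrite eq_sym.
have [cK mK] := swap gq hH qh; have [E1 E2] := extend_cm cK mK (swap_reach gq gq' nqq' hH qh).
have qK : q \in q |: (H :\ h) by rewrite !inE eqxx.
have full i : i \in H -> i != h -> edge q' i /\ edge q i.
  move=> iH ih; have iK : i \in q |: (H :\ h) by rewrite !inE ih iH orbT.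
  have q'i : edge q' i.
    apply: contraT => q'i; have hi := good2 gq' hH iH q'h q'i.
    have qi : edge q i by rewrite (twin gq hH qh).
    have := E1 q i qK iK qi; rewrite !att1 (negbTE qq') edge_sym.
    by rewrite (negbTE q'i).
  split=> //; rewrite edge_sym; apply: E2 => //; first by rewrite att1 edge_sym.
  by rewrite att1.
have [a [b [[aH bH ab] [ah bh]]]] := adjacent_in hH.
have [q'a qa] := full a aH ah; have [q'b qb] := full b bH bh.
have ha : edge h a by rewrite -(twin gq hH qh).
have hb : edge h b by rewrite -(twin gq hH qh).
have /andP[qH _] := gq; have /andP[q'H _] := gq'.
apply: nh; apply: (@house_deg2 G q a b h q') => //; try exact: sym.
rewrite /= !inE !negb_or (edge_neq qa) (edge_neq qb) nqq' ah bh (edge_neq ab).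
rewrite ![_ == q']eq_sym (edge_neq q'a) (edge_neq q'b) (edge_neq q'h).
by rewrite /= ?andbT; apply: contraNneq qH => ->.
Qed.

Let pair2 q q' h : good q -> good q' -> h \in H -> edge q q' -> edge q h || edge q' h.
Proof.
move=> gq gq' hH qq'; apply: contraT; rewrite negb_or => /andP[qh q'h].
have nqq' := edge_neq qq'.
have [cK mK] := swap gq hH qh; have [E1 E2] := extend_cm cK mK (swap_reach gq gq' nqq' hH qh).
have qK : q \in q |: (H :\ h) by rewrite !inE eqxx.
have full i : i \in H -> i != h -> edge h i.
  move=> iH ih; have iK : i \in q |: (H :\ h) by rewrite !inE ih iH orbT.
  apply: contraT => hi; have q'i : ~~ edge q' i by rewrite (twin gq' hH q'h).
  have qi : ~~ edge q i by rewrite (twin gq hH qh).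
  have := E2 q i qK iK; rewrite !att1 [edge i q']edge_sym => /(_ qq' q'i).
  by rewrite (negbTE qi).
have [a [b [[aH bH ab] [ah bh]]]] := adjacent_in hH.
have ha := full a aH ah; have hb := full b bH bh.
have qa : edge q a by rewrite (twin gq hH qh).
have qb : edge q b by rewrite (twin gq hH qh).
have q'a : edge q' a by rewrite (twin gq' hH q'h).
have q'b : edge q' b by rewrite (twin gq' hH q'h).
have /andP[qH _] := gq; have /andP[q'H _] := gq'.
exfalso; apply: nh; apply: (@house_deg2 G h a b q q') => //; try exact: sym; try by rewrite edge_sym.
rewrite /= !inE !negb_or (edge_neq ha) (edge_neq hb) (edge_neq ab) nqq'.
rewrite ![_ == q']eq_sym (edge_neq q'a) (edge_neq q'b) ![_ == q]eq_sym (edge_neq qa) (edge_neq qb).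
by rewrite /= ?andbT; apply/andP; split; [apply: contraNneq qH|apply: contraNneq q'H] => ->.
Qed.

(** If [q1] and [q3] were adjacent, the two preceding facts would make all three vertices complete
    to [H]. Then [q1], [q3] and an edge of [H] form a [K_4] of which [q2] sees only that edge. *)
Let triple q1 q2 q3 : good q1 -> good q2 -> good q3 ->
  ~~ edge q1 q2 -> ~~ edge q2 q3 -> ~~ edge q1 q3.
Proof.
move=> g1 g2 g3 n12 n23; apply/negP => e13.
have n21 : ~~ edge q2 q1 by rewrite edge_sym.
have f2 h : h \in H -> edge q2 h.
  move=> hH; apply: contraT => q2h.
  have q1h := pair1 g2 g1 hH n21 q2h; have q3h := pair1 g2 g3 hH n23 q2h.
  by have := pair2 g1 g3 hH e13; rewrite (negbTE q1h) (negbTE q3h).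
have f1 h : h \in H -> edge q1 h.
  move=> hH; apply: contraT => q1h.
  by have := pair1 g1 g2 hH n12 q1h; rewrite f2.
have n32 : ~~ edge q3 q2 by rewrite edge_sym.
have f3 h : h \in H -> edge q3 h.
  move=> hH; apply: contraT => q3h.
  by have := pair1 g3 g2 hH n32 q3h; rewrite f2.
have [h hH] : exists h, h \in H by apply/card_gt0P; apply: ltn_trans (mink4_gt1 mH).
have [a [b [[aH bH ab] _]]] := adjacent_in hH.
apply: nh; apply: (@house_deg2 G q2 a b q1 q3) => //; try exact: f2;
  try (by apply: sym; exact: f1); try (by apply: sym; exact: f3).
rewrite /= !inE !negb_or (edge_neq ab) (edge_neq e13) (edge_neq (f2 a aH)) (edge_neq (f2 b bH)).
rewrite ![_ == q1]eq_sym ![_ == q3]eq_sym (edge_neq (f1 a aH)) (edge_neq (f1 b bH)).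
rewrite (edge_neq (f3 a aH)) (edge_neq (f3 b bH)) /= ?andbT.
by apply/andP; split; [apply: contraNneq n23 => <-| apply: contraNneq n12 => <-].
Qed.

Let R := H :|: [set q | good q].

Let cR : cm R.
Proof.
have RP z : z \in R -> z \in H \/ good z by rewrite !inE => /orP[|]; [left|right].
have col a b e : e \in H -> a \in H -> good b -> edge b a -> edge e a || edge e b.
  move=> eH aH gb ba; case: (boolP (edge b e)) => be; first by rewrite [edge e b]edge_sym be orbT.
  by rewrite edge_sym (good2 gb aH eH ba be).
have gcol a b e : good e -> a \in H -> good b -> edge b a -> edge e a || edge e b.
  move=> ge aH gb ba; case: (boolP (edge e b)) => eb; rewrite ?orbT // orbF; apply: contraT => ea.
  by have := pair1 ge gb aH eb ea; rewrite ba.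
move=> e c d /RP[eH|ge] /RP[cH'|gc] /RP[dH'|gd] cd.
- exact: cH.
- by apply: col => //; rewrite edge_sym.
- by rewrite orbC; apply: col.
- by have := pair2 gc gd eH cd; rewrite ![edge e _]edge_sym.
- exact: good1.
- by apply: gcol => //; rewrite edge_sym.
- by rewrite orbC; apply: gcol.
apply: contraT; rewrite negb_or => /andP[ec ed].
by have := triple gc ge gd; rewrite [edge c e]edge_sym => /(_ ec ed); rewrite cd.
Qed.

Let sHR : H \subset R.
Proof. exact: subsetUl. Qed.

Let R_deg a : a \in R -> 2 < #|nbrs H a|.
Proof. by rewrite !inE => /orP[/dH|/good_deg]. Qed.

(** If [R] is a proper subset, a minimal [Q] outside has just two attachments in [R], or is a single
    vertex, which sees at most one vertex of [H] because it is not good. In both cases two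
    attachments [r1], [r2] include all those in [H], and [Q] is an ear of [H] enlarged by [r1] and
    [r2]. *)
Lemma cm_all : cm [set: G].
Proof.
suff <- : R = setT by exact: cR.
apply/eqP; apply: contraT => RT.
have R1 : 1 < #|R| by apply: leq_trans (mink4_gt1 mH) (subset_leq_card sHR).
have [Q [[cQ Q0 dQ nQ] hQ]] := outside_min h2 RT R1.
suff [r1 [r2 [r12 [r1R r2R] [a1 a2] na]]] : exists r1 r2, [/\ r1 != r2, r1 \in R /\ r2 \in R,
    att Q r1 /\ att Q r2 & {in H, forall r, r != r1 -> r != r2 -> ~~ att Q r}].
  pose F := r1 |: (r2 |: H).
  have sF : F \subset R by rewrite !subUset !sub1set r1R r2R.
  apply: False_ind; apply: nh; apply: (@cm_ear G F Q r1 r2) => //.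
  - exact: cmS sF cR.
  - move=> a aF; apply: leq_trans (R_deg (subsetP sF a aF)) _.
    apply: subset_leq_card; apply/subsetP=> z; rewrite !inE => /andP[-> ->].
    by rewrite !orbT.
  - by apply: disjointWl dQ.
  - by rewrite !inE eqxx.
  - by rewrite !inE eqxx orbT.
  move=> r; rewrite !inE => /or3P[/eqP->|/eqP->|rH] n1 n2; rewrite ?eqxx // in n1 n2 *.
  exact: na.
have /card_gt1P[p [p' [+ + pp]]] := nQ; rewrite !in_set => /andP[pR ap] /andP[p'R ap'].
have pR' : p \in R by rewrite !inE.
have p'R' : p' \in R by rewrite !inE.
case: hQ => [[q Qq]|c2]; last first.
  exists p, p'; split=> // r rH rp rp'; apply/negP=> ar.
  have : [set p; p'; r] \subset [set h in R | att Q h].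
    apply/subsetP=> z; rewrite in_setU in_set2 in_set1 -orbA in_set.
    by move=> /or3P[]/eqP->; rewrite ?pR' ?p'R' ?ap ?ap' ?ar ?(subsetP sHR).
  move/subset_leq_card/leq_trans/(_ c2); rewrite setUC cardsU1 cards2 pp !inE negb_or rp rp'.
  by [].
subst Q; have qR : q \notin R by rewrite -disjoints1 disjoint_sym.
have le1 : #|nbrs H q| <= 1.
  rewrite leqNgt; apply: contra qR => dq; rewrite !inE /good dq andbT.
  by rewrite orbN.
move/card_le1_eqP: le1 => le1.
have [h /andP[hH ah]|no] := pickP [pred h | (h \in H) && att [set q] h]; last first.
  exists p, p'; split=> // r rH _ _; apply/negP=> ar.
  by have := no r; rewrite /= rH ar.
have [r rR [ar rh]] : exists2 r, r \in R & att [set q] r /\ r != h.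
  have [e|ph] := eqVneq p h; last by exists p.
  by exists p'; rewrite // -e eq_sym.
exists h, r; split=> //; first by rewrite eq_sym.
  by split=> //; exact: (subsetP sHR).
move=> z zH zh _; apply: contra zh => az; apply/eqP/le1; rewrite inE ?zH ?hH /=.
  by rewrite att1 edge_sym in ah.
by rewrite att1 edge_sym in az.
Qed.

End CaseCm.

End TwoConnected.

(** * 2-connected graphs: only exceptional minimal minors *)

Section CaseExc.

Variable G : sgraph.
Implicit Types (X H Q R : {set G}) (u v : G).
Hypothesis h2 : forall z : G, conn [set~ z].
Hypothesis nh : ~ house G.
Hypothesis nocm : forall H, mink4 H -> cm H -> False.

Variables a b c : G.
Hypotheses (ab : edge a b) (ca : ~~ edge c a) (cb : ~~ edge c b).
Hypotheses (nca : c != a) (ncb : c != b).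

Let W := [set w | [&& edge w a, edge w b & edge w c]].

Variables u1 u2 : G.
Hypotheses (u1W : u1 \in W) (u2W : u2 \in W) (u12 : u1 != u2).

Let WP w : w \in W -> [/\ edge w a, edge w b & edge w c].
Proof. by rewrite inE => /and3P. Qed.

Let W_neq w : w \in W -> [/\ w != a, w != b & w != c].
Proof. by move=> /WP[wa wb wc]; rewrite !edge_neq. Qed.

Let sym u v : edge u v -> edge v u.
Proof. by rewrite edge_sym. Qed.

(** Adjacent [u], [v] in [W] would form a [K_4] with [a] and [b], which is a complete multipartite
    minimal minor. *)
Let W_indep : {in W &, forall u v, ~~ edge u v}.
Proof.
move=> u v uW vW; apply/negP => uv.
have [ua ub uc] := WP uW; have [va vb vc] := WP vW.
have [nua nub nuc] := W_neq uW; have [nva nvb nvc] := W_neq vW.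
pose H := [set z in [:: a; b; u; v]].
have clH : {in H &, forall p q, p != q -> edge p q}.
  move=> p q; rewrite !inE => /or4P[]/eqP-> /or4P[]/eqP->; rewrite ?eqxx // => _ //;
    by apply: sym.
have cH : #|H| = 4.
  have un : uniq [:: a; b; u; v].
    rewrite /= !inE !negb_or (edge_neq ab) ![a == _]eq_sym nua nva ![b == _]eq_sym nub nvb.
    by rewrite (edge_neq uv).
  by rewrite -[RHS]/(size [:: a; b; u; v]) -(card_uniqP un); apply: eq_card => z; rewrite inE.
have mH : mink4 H.
  split; first by apply: k4_clique; rewrite ?cH.
  by move=> z zH /k4_card; have := cardsD1 z H; rewrite zH cH add1n => -[<-].
apply: (nocm mH) => e p q eH pH qH pq; have [->|ep] := eqVneq e p; first by rewrite pq orbT.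
by rewrite clH.
Qed.

(** For every pair in [W] this is a minimal minor, which allows the trichotomy to be applied
    anywhere in the exceptional graph. *)
Let core u u' := [set z in [:: a; b; u; u'; c]].

Let core_mink4 u u' : u \in W -> u' \in W -> u != u' -> mink4 (core u u').
Proof.
move=> uW vW uu'; have [ua ub uc] := WP uW; have [va vb vc] := WP vW.
have [nua nub nuc] := W_neq uW; have [nva nvb nvc] := W_neq vW.
have un : uniq [:: a; b; u; u'; c].
  rewrite /= !inE !negb_or (edge_neq ab) ![a == _]eq_sym nua nva nca.
  by rewrite ![b == _]eq_sym nub nvb ncb uu' nuc nvc.
have cC : #|core u u'| = 5.
  rewrite -[RHS]/(size [:: a; b; u; u'; c]) -(card_uniqP un).
  by apply: eq_card => z; rewrite inE.
split.
  apply: (@k4_lists _ [:: a] [:: b] [:: u] [:: u'; c]);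
    rewrite /tch /= ?orbF ?(sym ua) ?(sym ub) ?(sym va) ?(sym vb) ?uc ?orbT //.
  by move=> z zl; rewrite /core in_set.
move=> z zC kz; have c4 : #|core u u' :\ z| <= 4.
  by have := cardsD1 z (core u u'); rewrite zC cC add1n => -[<-].
have cl := k4_card4 kz c4.
have inC p : p \in [:: a; b; u; u'; c] -> p != z -> p \in core u u' :\ z.
  by move=> pl pz; rewrite in_setD1 pz inE.
have mem_c : [/\ a \in [:: a; b; u; u'; c], b \in [:: a; b; u; u'; c] & c \in [:: a; b; u; u'; c]].
  by rewrite !inE !eqxx !orbT.
have [aL bL cL] := mem_c; have nba : b != a by rewrite eq_sym edge_neq.
have [za|za] := eqVneq z a.
  by move/negP: cb; apply; apply: cl => //; apply: inC => //; rewrite za.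
have [zc|zc] := eqVneq z c.
  have uL : u \in [:: a; b; u; u'; c] by rewrite !inE eqxx !orbT.
  have vL : u' \in [:: a; b; u; u'; c] by rewrite !inE eqxx !orbT.
  by move/negP: (W_indep uW vW); apply; apply: cl => //; apply: inC => //; rewrite zc.
by move/negP: ca; apply; apply: cl => //; apply: inC => //; rewrite eq_sym.
Qed.

(** [Q] is attached to all vertices of some exceptional triple of the core. Within the core only [c]
    misses both ends of an edge, and that edge is [a b], so the triple is [a], [b], [c]. *)
Let see_core u u' Q : u \in W -> u' \in W -> u != u' -> reach2 (core u u') Q ->
  [/\ att Q a, att Q b & att Q c].
Proof.
move=> uW vW uu' [cQ Q0 dQ nQ]; have [ua ub uc] := WP uW; have [va vb vc] := WP vW.
have inC p : p \in [:: a; b; u; u'; c] -> p \in core u u' by move=> pl; rewrite /core in_set.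
case: (extend_set cQ Q0 dQ (core_mink4 uW vW uu') nQ nh) => [[cC _ _]|].
  have := cC c a b; rewrite (negbTE ca) (negbTE cb) => h.
  by have := h (inC c _) (inC a _) (inC b _) ab; rewrite !inE !eqxx !orbT => /(_ isT isT isT).
move=> [a' [b' [c' [[a'C b'C c'C] [[ab' ca' cb'] [[aa ba ca''] _]]]]]].
have uu : ~~ edge u u' by exact: W_indep.
have ba' := sym ab.
have au := sym ua; have bu := sym ub; have cu := sym uc.
have au' := sym va; have bu' := sym vb; have cu' := sym vc.
have coreP z : z \in core u u' -> [\/ z = a, z = b, z = c | z = u \/ z = u'].
  rewrite /core in_set !inE => /or4P[|||/orP[]]/eqP->.
  - by constructor 1.
  - by constructor 2.
  - by constructor 4; left.
  - by constructor 4; right.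
  by constructor 3.
have nuu : ~~ edge u' u by rewrite edge_sym.
have nac : ~~ edge a c by rewrite edge_sym.
have nbc : ~~ edge b c by rewrite edge_sym.
have irr z : edge z z = false by rewrite edge_irr.
case: (coreP _ c'C) => [e|e|e|[]e]; move: ab' ca' cb' aa ba ca''; rewrite e;
  case: (coreP _ a'C) => [->|->|->|[]->]; case: (coreP _ b'C) => [->|->|->|[]->];
  rewrite ?irr ?ab ?ba' ?ua ?ub ?uc ?va ?vb ?vc ?au ?bu ?cu ?au' ?bu' ?cu'
    ?(negbTE uu) ?(negbTE nuu) ?(negbTE nac) ?(negbTE nbc) ?(negbTE ca) ?(negbTE cb) //.
Qed.

Let R := [set a; b; c] :|: W.

(** A minimal [Q] outside [R] is attached to the three vertices [a], [b], [c]. Hence it is a single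
    vertex, which sees all three and so belongs to [W]. *)
Let RT : R = setT.
Proof.
apply/eqP; apply: contraT => nRT.
have sW : W \subset R by exact: subsetUr.
have R1 : 1 < #|R|.
  by apply/card_gt1P; exists u1, u2; rewrite !(subsetP sW).
have [Q [[cQ Q0 dQ nQ] hQ]] := outside_min h2 nRT R1.
have sC u u' : u \in W -> u' \in W -> core u u' \subset R.
  move=> uW vW; apply/subsetP=> z; rewrite inE /R in_setU => zl.
  move: zl; rewrite !inE => /or4P[/eqP->|/eqP->|/eqP->|/orP[]/eqP->]; rewrite ?eqxx ?orbT //.
    by move: uW; rewrite !inE => ->; rewrite orbT.
  by move: vW; rewrite !inE => ->; rewrite orbT.
have [sa sb sc] : [/\ att Q a, att Q b & att Q c].
  have /card_gt1P[r [r' [+ + rr]]] := nQ; rewrite !inE => /andP[rR ar] /andP[r'R ar'].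
  (* Any two vertices of [R] lie in a common core. *)
  have [u [u' [uW vW uu' [rC r'C]]]] : exists u u', [/\ u \in W, u' \in W, u != u' &
      r \in core u u' /\ r' \in core u u'].
    have abcC x y z : [|| (z == a) || (z == b) | z == c] -> z \in core x y.
      by rewrite !inE -orbA => /or3P[]->; rewrite ?orbT.
    have WW z : [&& edge z a, edge z b & edge z c] -> z \in W by rewrite inE.
    have oth z : exists2 y, y \in W & z != y.
      by have [->|h] := eqVneq z u1; [exists u2 | exists u1].
    have corl x y : x \in core x y by rewrite !inE eqxx !orbT.
    have corr x y : y \in core x y by rewrite !inE eqxx !orbT.
    case/orP: rR => [rabc|/WW rW]; case/orP: r'R => [r'abc|/WW r'W].
    - by exists u1, u2; split=> //; split; apply: abcC.
    - by have [y yW h] := oth r'; exists r', y; split=> //; split=> //; apply: abcC.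
    - by have [y yW h] := oth r; exists r, y; split=> //; split=> //; apply: abcC.
    by exists r, r'.
  apply: (see_core uW vW uu'); split=> //; first exact: disjointWl (sC u u' uW vW) dQ.
  by apply/card_gt1P; exists r, r'; split=> //; rewrite in_set ?rC ?r'C ?ar ?ar'.
case: hQ => [[q Qq]|].
  subst Q; have : q \in R.
    by rewrite !inE ![edge q _]edge_sym -!att1 sa sb sc orbT.
  by move=> qR; have := disjointFr dQ qR; rewrite inE eqxx.
have : [set a; b; c] \subset [set h in R | att Q h].
  by apply/subsetP=> z; rewrite !inE -!orbA => /or3P[]/eqP->; rewrite eqxx ?orbT ?sa ?sb ?sc.
move/subset_leq_card; rewrite setUC cardsU1 cards2 !inE negb_or nca ncb (edge_neq ab) => h3 /(leq_trans h3).
by [].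
Qed.

(** Deleting a vertex of the triple leaves two vertices that cover all edges. If [v] is in [W], its
    nonneighbours lie in the independent set [W], so no edge [p q] avoids it. *)
Lemma exc_no_k4 v p q : edge p q -> ~~ edge v p -> ~~ edge v q -> ~ k4 [set~ v].
Proof.
move=> pq vp vq; have inR z : z \in R by rewrite RT inE.
have vpn : v != p by apply: contraNneq vq => ->.
have cover s t : (forall z, z \in R -> z != v -> z != s -> z != t -> z \in W) -> ~ k4 [set~ v].
  move=> h; apply: (@k4_cover2 _ s t) => x y; rewrite !inE !negb_or.
  move=> /andP[/andP[xs xt] xv] /andP[/andP[ys yt] yv].
  by apply: W_indep; apply: h.
have := inR v; rewrite !in_setU !in_set1 -!orbA => /or4P[/eqP e|/eqP e|/eqP e|vW].
- by apply: (cover b c) => z; rewrite !in_setU !in_set1 -e => /orP[/orP[/orP[]|]|] // /eqP->; rewrite eqxx.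
- by apply: (cover a c) => z; rewrite !in_setU !in_set1 -e => /orP[/orP[/orP[]|]|] // /eqP->; rewrite eqxx.
- by apply: (cover a b) => z; rewrite !in_setU !in_set1 -e => /orP[/orP[/orP[]|]|] // /eqP->; rewrite eqxx.
have [va vb vc] := WP vW.
have nb z : ~~ edge v z -> z \in W.
  move=> vz; have := inR z; rewrite !in_setU !in_set1 -!orbA => /or4P[/eqP e|/eqP e|/eqP e|//];
  by move: vz; rewrite e ?va ?vb ?vc.
by have := W_indep (nb p vp) (nb q vq); rewrite pq.
Qed.

End CaseExc.

Lemma two_connected_house (G : sgraph) (v p q : G) :
  (forall z : G, conn [set~ z]) -> edge p q -> ~~ edge v p -> ~~ edge v q ->
  k4 [set~ v] -> house G.
Proof.
move=> h2 pq vp vq kv; apply: NNPP => nh.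
have [H HX mH] := mink4_exists kv.
have HT : H != setT by apply/eqP => e; have := subsetP HX v; rewrite e !inE eqxx => /(_ isT).
have nocm (K : {set G}) : mink4 K -> cm K -> False.
  move=> mK cK; have := cm_all h2 nh cK mK (x := v) (y := p) (z := q).
  by rewrite !inE (negbTE vp) (negbTE vq) => /(_ isT isT isT pq).
have [Q rQ] := outside h2 HT (mink4_gt1 mH).
have [cQ Q0 dQ nQ] := rQ.
case: (extend_set cQ Q0 dQ mH nQ nh) => [[cH _ _]|]; first by case: (nocm H).
move=> [a [b [c [[aH bH cH] [[ab ca cb] [_ hU]]]]]].
have nca : c != a by apply: contraNneq cb => ->.
have ncb : c != b by apply: contraNneq ca => ->; rewrite edge_sym.
have /card_gt1P[u1 [u2 [+ + u12]]] := mink4_deg mH cH; rewrite !inE => /andP[u1H cu1] /andP[u2H cu2].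
have inW u : u \in H -> edge c u -> [&& edge u a, edge u b & edge u c].
  move=> uH cu; have := hU u; rewrite !inE uH andbT => h.
  have /h/and4P[-> -> -> _] // : ~~ ((u == a) || (u == b) || (u == c)).
  apply/negP => /orP[/orP[]|] /eqP e; move: cu; rewrite e ?(negbTE ca) ?(negbTE cb) //.
  by rewrite edge_irr.
apply: (@exc_no_k4 G h2 nh nocm a b c ab ca cb nca ncb u1 u2 _ _ u12 v p q pq vp vq kv);
  by rewrite inE inW.
Qed.

(** * Blocks *)

Section Blocks.

Variable G : sgraph.
Implicit Types (x y z u v w : G) (p : seq G).

Definition avoid z : rel G := fun u v => [&& u != z, v != z & edge u v].

Definition joined z u v := (u != z) && connect (avoid z) u v.

(** The vertex set of the block of an edge [x y]: no single vertex separates its members from both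
    ends. If [z] is an end, only the other end counts, since [joined z] never reaches [z]. This form
    is first-order in the relations [joined z], which suits the program. *)
Definition block x y := [set u | [forall z, [|| u == z, joined z u x | joined z u y]]].

Lemma path_joined z u p : path (@edge G) u p -> z \notin u :: p -> joined z u (last u p).
Proof.
move=> pp zp; apply/andP; split; first by move: zp; rewrite inE negb_or eq_sym => /andP[].
apply/connectP; exists p => //; elim: p u pp zp => //= a p IH u /andP[ua pa].
rewrite inE negb_or => /andP[zu zap]; rewrite IH // andbT /avoid eq_sym zu ua andbT.
by move: zap; rewrite inE negb_or eq_sym => /andP[].
Qed.

Lemma joined_path z u v : joined z u v ->
  exists p, [/\ path (@edge G) u p, v = last u p, z \notin u :: p & uniq (u :: p)].
Proof.
case/andP=> uz /connectP[p pp ->]; case/shortenP: pp => p' pp' up' _.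
exists p'; split=> //; first by apply: sub_path pp' => a b /and3P[].
elim: p' u uz pp' {up'} => [|a q IH] w wz; first by rewrite inE eq_sym.
by move=> /= /andP[/and3P[_ az _] /(IH a az) h]; rewrite inE negb_or eq_sym wz.
Qed.

Section Edge.

Variables x y : G.
Hypothesis xy : edge x y.

Let B := block x y.

(* A simple path inside a block cannot leave it: it would have to cross a cut
   vertex twice. *)
Lemma path_block w t p : w \in B -> t = x \/ t = y -> path (@edge G) w p ->
  uniq (w :: p) -> last w p = t -> {subset p <= B}.
Proof.
move=> wB txy pp up lt q qp; rewrite inE; apply/forallP => z.
apply: contraT; rewrite !negb_or => /and3P[qz nx ny].
have nt a : a = x \/ a = y -> ~~ joined z q a by case=> ->.
case/path.splitP: qp pp up lt => p1 p2; rewrite cat_path last_rcons last_cat last_rcons.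
move=> /andP[pp1 pp2] up lt.
have zp2 : z \in p2.
  have := nt t txy; rewrite -lt; apply: contraNT => zp; apply: path_joined => //.
  by rewrite inE negb_or eq_sym qz.
have zp1 : z \notin w :: rcons p1 q.
  move: up; rewrite -cat_cons cat_uniq => /and3P[_ /hasPn h _].
  exact: h.
have jq : joined z w q by have := path_joined pp1 zp1; rewrite last_rcons.
have wz : w != z by case/andP: jq.
have cs : connect_sym (avoid z).
  by apply: sym_connect_sym => a b; rewrite /avoid edge_sym andbCA.
have := wB; rewrite inE => /forallP/(_ z); rewrite (negbTE wz) /=.
have tr a : a = x \/ a = y -> joined z w a -> False.
  move=> ha /andP[_ ca]; case/negP: (nt a ha); rewrite /joined qz.
  by apply: connect_trans ca; rewrite cs; case/andP: jq.
by case/orP=> h; [case: (tr x (or_introl erefl) h) | case: (tr y (or_intror erefl) h)].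
Qed.

(** Paths avoiding [z] lead from every vertex to [x] or [y] inside the block, and the edge [x y]
    links the two ends when both survive. *)
Lemma conn_block z : conn (B :\ z).
Proof.
move=> S [u0 u0B u0S] clS.
have clS' a b : a \in B :\ z -> b \in B :\ z -> edge a b -> (a \in S) = (b \in S).
  by move=> aB bB ab; apply/idP/idP; apply: clS; rewrite // edge_sym.
have key w t : w \in B :\ z -> t = x \/ t = y -> joined z w t ->
    t \in B :\ z /\ (w \in S) = (t \in S).
  rewrite in_setD1 => /andP[wz wB] ht /joined_path[p [pp lt zp up]].
  have pB := path_block wB ht pp up (esym lt).
  have inB a : a \in w :: p -> a \in B :\ z.
    move=> ap; rewrite in_setD1; apply/andP; split; first by apply: contraNneq zp => <-.
    by move: ap; rewrite inE => /orP[/eqP->|/pB].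
  split; first by rewrite lt; apply: inB; exact: mem_last.
  rewrite lt; elim: p w pp inB {lt zp up pB wz wB} => //= a p IH w /andP[wa pa] inB.
  rewrite -(IH a) //; last by move=> b bp; apply: inB; rewrite inE bp orbT.
  by apply: clS'; rewrite ?inB ?inE ?eqxx ?orbT.
have toxy w : w \in B :\ z -> exists t, [/\ t = x \/ t = y, t \in B :\ z & (w \in S) = (t \in S)].
  move=> wB; have := wB; rewrite in_setD1 => /andP[wz]; rewrite inE => /forallP/(_ z).
  rewrite (negbTE wz) /= => /orP[] j; [exists x | exists y];
    [have [] := key w x wB (or_introl erefl) j | have [] := key w y wB (or_intror erefl) j];
    by split=> //; auto.
apply/subsetP=> w wB; have [t [ht tB ->]] := toxy w wB.
have [t0 [ht0 t0B e0]] := toxy u0 u0B; have t0S : t0 \in S by rewrite -e0.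
case: ht tB => ->; case: ht0 t0B t0S => -> // h1 h2 h3.
  by rewrite (clS' x y).
by rewrite -(clS' x y).
Qed.

End Edge.

Lemma block_house x y v c d : edge x y -> v \in block x y -> c \in block x y ->
  d \in block x y -> edge c d -> ~~ edge v c -> ~~ edge v d ->
  k4 (block x y :\ v) -> house G.
Proof.
move=> xy vB cB dB cd vc vd [f [fX f0 fc ft]].
apply: (house_quot (induced_qmap (block x y))).
have qm := induced_qmap (block x y); have fibE := @induced_fiber G (block x y).
have gE u t : induced_map (block x y) u = Some t -> u = val t.
  by move=> e; have := fibE t => /setP/(_ u); rewrite !inE e eqxx => /esym/eqP.
have preD (t : induced (block x y)) :
    pre (induced_map (block x y)) [set~ t] = block x y :\ val t.
  apply/setP=> u; rewrite inE in_setD1 /induced_map; case: insubP => [s uB <-|/negbTE->].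
    by rewrite in_setC in_set1 (valP s) andbT.
  by rewrite andbF.
apply: (@two_connected_house (induced (block x y)) (Sub v vB) (Sub c cB) (Sub d dB)) => //.
  by move=> z; apply: (conn_preK qm); rewrite preD; exact: conn_block.
apply: (k4_descend qm _ _ _ f0 fc ft).
- by move=> u w t /gE-> /gE->.
- move=> u; rewrite /induced_map; case: insubP => // uB _; rewrite leqNgt.
  by apply: contra uB => /fX; rewrite in_setD1 => /andP[].
by move=> u /fX; rewrite preD.
Qed.

(** Take a model whose union is minimal. A full house minus one vertex is connected, so if [z]
    separated the union, all bags but that of [z] would be on one side, and the other side could be
    dropped from the bag of [z]. *)
Lemma house_minimal : house G -> exists f : G -> nat,
  [/\ forall i, i < 5 -> bag f i != set0, forall i, i < 5 -> conn (bag f i),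
      forall i j, i < j -> j < 5 -> touch (bag f i) (bag f j) = house_edge i j &
      forall z, conn ([set u | f u < 5] :\ z)].
Proof.
move=> [f0 [h0 hc ht]].
pose P (U : {set G}) := exists f : G -> nat, [/\ forall i, i < 5 -> bag f i != set0,
   forall i, i < 5 -> conn (bag f i),
   forall i j, i < j -> j < 5 -> touch (bag f i) (bag f j) = house_edge i j &
   [set u | f u < 5] = U].
have [|U [_ [f [b0 bc bt fU]] mU]] := @min_set _ P [set u | f0 u < 5].
  by exists f0.
exists f; split=> // z S [a aU aS] clS; rewrite fU in aU clS *.
apply/subsetP=> b bU; apply: contraT => bS; exfalso.
have inU u : (u \in U :\ z) = (u != z) && (f u < 5) by rewrite in_setD1 -fU inE.
have side u w : u \in U :\ z -> w \in U :\ z -> edge u w -> (u \in S) = (w \in S).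
  by move=> uU wU uw; apply/idP/idP; apply: clS; rewrite // edge_sym.
have bagU i u : i < 5 -> i != f z -> u \in bag f i -> u \in U :\ z.
  move=> i5 iz; rewrite inE => /eqP fu; rewrite inU fu i5 andbT.
  by apply: contraNneq iz => <-; rewrite fu.
have mono i u w : i < 5 -> i != f z -> f u = i -> f w = i -> (u \in S) = (w \in S).
  move=> i5 iz fu fw.
  have hS (p q : G) : p \in bag f i -> q \in bag f i -> p \in S -> q \in S.
    move=> pB qB pS; apply: (subsetP (bc i i5 S _ _)) qB; first by exists p.
    by move=> u' w' u'B w'B; apply: clS; apply: (bagU i).
  by apply/idP/idP; apply: hS; rewrite inE ?fu ?fw.
have adj i j u w : i < j -> j < 5 -> house_edge i j -> i != f z -> j != f z ->
    f u = i -> f w = j -> (u \in S) = (w \in S).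
  move=> ij j5 hij iz jz fu fw; have i5 := ltn_trans ij j5.
  have : touch (bag f i) (bag f j) by rewrite bt.
  move=> /touchP[p [q [pB qB pq]]].
  rewrite (mono i u p) //; last by move: pB; rewrite inE => /eqP.
  rewrite (mono j w q) //; last by move: qB; rewrite inE => /eqP.
  by apply: side pq; [apply: (bagU i) | apply: (bagU j)].
have rep i : exists u, i < 5 -> f u = i.
  case: (ltnP i 5) => i5; last by exists z.
  by have /set0Pn[u] := b0 i i5; rewrite inE => /eqP; exists u.
(* Bag 0 touches every other bag and fixes the reference side; bag 1, which does so too, replaces it
   if [z] lies in bag 0. *)
have [s hs] : exists s : bool, forall u, f u < 5 -> f u != f z -> (u \in S) = s.
  have [ra h0a] := rep 0; have [rb h0b] := rep 1.
  have fa := h0a isT; have fb := h0b isT.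
  have [e0|n0] := eqVneq (f z) 0.
    exists (rb \in S) => u; case e: (f u) => [|[|[|[|[|]]]]] // _; rewrite ?e0 // => _.
    - by apply: (mono 1); rewrite ?e0.
    - by apply/esym/(adj 1 2); rewrite ?e0.
    - by apply/esym/(adj 1 3); rewrite ?e0.
    - by apply/esym/(adj 1 4); rewrite ?e0.
  have n0' : 0 != f z by rewrite eq_sym.
  exists (ra \in S) => u; case e: (f u) => [|[|[|[|[|]]]]] // _ nz.
  - by apply: (mono 0).
  - by apply/esym/(adj 0 1).
  - by apply/esym/(adj 0 2).
  - by apply/esym/(adj 0 3).
  by apply/esym/(adj 0 4).
pose D := [set u in U :\ z | (u \in S) != s].
have D_bag u : u \in D -> f u = f z.
  rewrite inE inU => /andP[/andP[_ fu] us]; apply/eqP; apply: contraNT us => nz.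
  by rewrite hs.
have zD : z \notin D by rewrite inE inU eqxx.
have [e eD] : exists e, e \in D.
  by case es: s; [exists b | exists a]; rewrite inE ?bU ?aU es ?(negbTE bS) ?aS.
have DN u w : u \in D -> w \notin D -> w != z -> f w < 5 -> ~~ edge u w.
  move=> uD wD wz fw; apply: contra wD => uw; rewrite inE inU wz fw /=.
  move: uD; rewrite inE => /andP[uU us]; rewrite -(side u w) //.
  by rewrite inU wz fw.
have fz5 : f z < 5 by rewrite -(D_bag e eD); move: eD; rewrite inE inU => /andP[/andP[]].
pose f' u := if u \in D then 5 else f u.
have bag' i : i < 5 -> bag f' i = bag f i :\: D.
  move=> i5; apply/setP=> u; rewrite in_setD ![_ \in bag _ _]inE /f'.
  by case: (u \in D) => //=; rewrite eq_sym (ltn_eqF i5).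
have bagN i : i < 5 -> i != f z -> bag f' i = bag f i.
  move=> i5 iz; rewrite bag' //; apply/setP=> u; rewrite in_setD.
  case uD: (u \in D) => //=; rewrite inE (D_bag u uD) eq_sym; exact/esym/negbTE.
have zB : z \in bag f' (f z) by rewrite bag' // !in_setD zD inE /=.
have tch i : i < 5 -> i != f z -> touch (bag f' (f z)) (bag f' i) = touch (bag f (f z)) (bag f i).
  move=> i5 iz; rewrite (bagN i i5 iz); apply/idP/idP; first by apply: touchS => //; rewrite bag' // subsetDl.
  move=> /touchP[p [q [pB qB pq]]]; apply/touchP; exists p, q; split=> //.
  rewrite bag' // in_setD pB andbT; apply/negP => pD.
  have qi : f q = i by move: qB; rewrite inE => /eqP.
  have qD : q \notin D by apply: contraNN iz => /D_bag <-; rewrite qi.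
  have qz : q != z by apply: contraNneq iz => <-; rewrite qi.
  by have := DN p q pD qD qz; rewrite pq qi => /(_ i5).
apply: (mU [set u | f' u < 5]).
  rewrite -fU; apply/properP; split.
    by apply/subsetP=> u; rewrite !inE /f'; case: ifP.
  exists e; first by rewrite inE (D_bag e eD).
  by rewrite inE /f' eD.
exists f'; split=> //.
- move=> i i5; have [->|iz] := eqVneq i (f z); last by rewrite bagN ?b0.
  by apply/set0Pn; exists z.
- move=> i i5; have [->|iz] := eqVneq i (f z); last by rewrite bagN //; exact: bc.
  rewrite bag' // => T [t tB tT] clT.
  (* [D] meets the rest of the union only through [z], so a closed set takes [D] along exactly when
     it contains [z]. *)
  pose T' := if z \in T then T :|: D else T :\: D.
  have inT u : u \notin D -> (u \in T') = (u \in T).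
    by move=> uD; rewrite /T'; case: ifP => _; rewrite ?in_setU ?in_setD (negbTE uD) ?orbF.
  have sub : bag f (f z) \subset T'.
    apply: (bc _ fz5).
      by move: tB; rewrite in_setD => /andP[tD tB]; exists t; rewrite ?inT.
    move=> u w uB wB uw.
    have fu : f u < 5 by move: uB; rewrite inE => /eqP->.
    have fw : f w < 5 by move: wB; rewrite inE => /eqP->.
    have fromz w' : z \in T' -> w' \in D -> w' \in T'.
      by rewrite (inT z zD) /T' => zT wD; rewrite zT in_setU wD orbT.
    have toz w' : w' \in D -> w' \in T' -> z \in T'.
      by rewrite (inT z zD) /T'; case: (z \in T) => // wD; rewrite in_setD wD.
    case: (boolP (u \in D)) => uD; case: (boolP (w \in D)) => wD uT.
    - exact: fromz (toz u uD uT) wD.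
    - have [->|wz] := eqVneq w z; first exact: toz uT.
      by have := DN u w uD wD wz fw; rewrite uw.
    - have [uz|uz] := eqVneq u z; first by apply: fromz; rewrite // -uz.
      by have := DN w u wD uD uz fu; rewrite edge_sym uw.
    rewrite inT //; apply: (clT u w) => //; rewrite ?in_setD ?uD ?wD //.
    by rewrite -inT.
  by apply/subsetP=> u; rewrite in_setD => /andP[uD uB]; rewrite -inT // (subsetP sub).
move=> i j ij j5; have i5 := ltn_trans ij j5.
have [iz|iz] := eqVneq i (f z).
  by rewrite iz tch -?iz ?bt // neq_ltn ij orbT.
have [jz|jz] := eqVneq j (f z).
  by rewrite jz touchC tch // touchC -jz bt.
by rewrite !bagN ?bt.
Qed.

Lemma house_block : house G <-> exists x y v c d,
  [/\ edge x y, v \in block x y, c \in block x y & d \in block x y] /\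
  [/\ edge c d, ~~ edge v c, ~~ edge v d & k4 (block x y :\ v)].
Proof.
split; last first.
  by move=> [x [y [v [c [d [[xy vB cB dB] [cd vc vd kB]]]]]]]; exact: (block_house xy vB cB dB cd vc vd kB).
case/house_minimal=> f [b0 bc bt cU].
(* Bags 2 and 3 are those missed by bag 4, so one edge between them both names the block and avoids
   [v]. *)
have /touchP[x [y [+ + xy]]] : touch (bag f 2) (bag f 3) by rewrite bt.
rewrite !inE => /eqP fx /eqP fy.
have UB u : f u < 5 -> u \in block x y.
  move=> fu; rewrite inE; apply/forallP => z; have [//|uz] := eqVneq u z.
  have toj t : t != z -> f t < 5 -> joined z u t.
    move=> tz ft; rewrite /joined uz /=.
    have inU w : (w \in [set w | f w < 5] :\ z) = (w != z) && (f w < 5) by rewrite !inE.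
    have /subsetP/(_ t) : [set w | f w < 5] :\ z \subset [set w | connect (avoid z) u w].
      apply: (cU z); first by exists u; rewrite ?inU ?uz ?inE ?connect0.
      move=> p q; rewrite !inU !inE => /andP[pz _] /andP[qz _] pq up.
      by apply: connect_trans up _; apply: connect1; rewrite /avoid pz qz.
    by rewrite inU tz ft inE; exact.
  have [xz|xz] := eqVneq x z; last by rewrite toj ?fx.
  by rewrite (toj y) ?fy ?orbT // -xz eq_sym edge_neq.
have /set0Pn[v] := b0 4 isT; rewrite inE => /eqP fv.
have nv t : 1 < f t -> f t < 4 -> ~~ edge v t.
  move=> t1 t4; apply/negP => e; have := bt (f t) 4 t4 isT.
  rewrite /house_edge eqxx t1 /= => /touchP[]; exists t, v.
  by rewrite !inE fv !eqxx edge_sym.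
exists x, y, v, x, y; rewrite !UB ?fv ?fx ?fy //; split=> //; split=> //.
- by apply: nv; rewrite fx.
- by apply: nv; rewrite fy.
exists f; split.
- move=> u fu; rewrite in_setD1 UB ?(ltn_trans fu) // andbT.
  by apply: contraTneq fu => ->; rewrite fv.
- by move=> i i4; apply: b0; exact: ltn_trans i4 _.
- by move=> i i4; apply: bc; exact: ltn_trans i4 _.
move=> i j ij j4; rewrite bt ?(ltn_trans j4) // /house_edge.
by rewrite (ltn_eqF j4).
Qed.

End Blocks.

(** * Structured programs on the random access machine *)

Inductive cmd := Atom of instr | Seq of cmd & cmd | While of nat & cmd.

Definition is_jump i := if i is IJumpZ _ _ then true else false.

(* Register 0 is clobbered at the end of each round: the compiled loop jumps
   back unconditionally by testing a register that it has just cleared. *)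
Inductive bigstep : cmd -> memory -> nat -> memory -> Prop :=
| bigstep_atom i m : ~~ is_jump i -> bigstep (Atom i) m 1 (exec i (0, m)).2
| bigstep_seq c1 c2 m t1 m1 t2 m2 : bigstep c1 m t1 m1 -> bigstep c2 m1 t2 m2 ->
    bigstep (Seq c1 c2) m (t1 + t2) m2
| bigstep_stop r c m : m r = 0 -> bigstep (While r c) m 1 m
| bigstep_loop r c m t1 m1 t2 m2 : m r != 0 -> bigstep c m t1 m1 ->
    bigstep (While r c) (update m1 0 0) t2 m2 ->
    bigstep (While r c) m (t1 + 3 + t2) m2.

(** Jump targets are absolute, so the start address [a] is a parameter. The exit of a loop lies past
    the test, the body and the two closing instructions, hence the offset 3. *)
Fixpoint code a c : program :=
  match c with
  | Atom i => [:: i]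
  | Seq c1 c2 => code a c1 ++ code (a + size (code a c1)) c2
  | While r c => let p := code a.+1 c in
      IJumpZ r (a + size p + 3) :: p ++ [:: IConst 0 0; IJumpZ 0 a]
  end.

Lemma step_at p pre i post m : p = pre ++ i :: post ->
  step p (size pre, m) = exec i (size pre, m).
Proof. by move=> ->; rewrite /step /= onth_cat ltnn subnn. Qed.

Lemma code_correct c m t m' : bigstep c m t m' -> forall p pre post,
  p = pre ++ code (size pre) c ++ post ->
  iter t (step p) (size pre, m) = (size pre + size (code (size pre) c), m').
Proof.
elim=> {c m t m'} [i m nj|c1 c2 m t1 m1 t2 m2 _ IH1 _ IH2|r c m r0|r c m t1 m1 t2 m2 r0 _ IH1 _ IH2]
  p pre post pE.
- by rewrite /= (step_at _ pE) addn1; case: i nj {pE}.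
- rewrite /= -catA in pE; rewrite addnC iterD (IH1 _ _ _ pE).
  rewrite catA in pE; have := IH2 p (pre ++ code (size pre) c1) post.
  rewrite size_cat => -> //.
  by rewrite /= size_cat addnA.
- by rewrite /= in pE *; rewrite (step_at _ pE) /= r0 eqxx /= size_cat /=; congr (_, _); lia.
set a := size pre in pE *; set b := size (code a.+1 c).
pose j := IJumpZ r (a + b + 3).
have e1 : p = rcons pre j ++ code a.+1 c ++ [:: IConst 0 0; IJumpZ 0 a] ++ post.
  by rewrite pE /= cat_rcons -catA.
have h1 := IH1 p (rcons pre j) _; rewrite size_rcons in h1.
have e2 := e1; rewrite catA /= in e2.
have e3 : p = rcons (rcons pre j ++ code a.+1 c) (IConst 0 0) ++ IJumpZ 0 a :: post.
  by rewrite e2 [in RHS](cat_rcons (IConst 0 0)).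
have sE : size (rcons pre j ++ code a.+1 c) = a.+1 + b by rewrite size_cat size_rcons.
have -> : t1 + 3 + t2 = t2 + (1 + (1 + (t1 + 1))) by lia.
rewrite !iterD [iter 1 _ _]/= (step_at m pE) /= (negbTE r0) (h1 _ e1) -/b -sE.
rewrite (step_at _ e2) /=.
have := step_at (update m1 0 0) e3; rewrite size_rcons /= => ->.
exact: IH2 pE.
Qed.

Lemma code_run c m t m' : bigstep c m t m' ->
  iter t (step (code 0 c)) (0, m) = (size (code 0 c), m').
Proof. by move=> h; apply: (code_correct h (pre := [::]) (post := [::])); rewrite cats0. Qed.

(** A total correctness triple with a time bound. The postcondition may itself be such a triple,
    which is how sequences are chained. *)
Definition runs c m T (Q : memory -> Prop) :=
  exists t m', [/\ bigstep c m t m', t <= T & Q m'].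

Lemma runsW c m T T' (Q Q' : memory -> Prop) : runs c m T Q -> T <= T' ->
  (forall m', Q m' -> Q' m') -> runs c m T' Q'.
Proof.
move=> [t [m' [h tT q]]] TT QQ; exists t, m'; split; [exact: h | lia | exact: QQ].
Qed.

Lemma runs_atom i m T (Q : memory -> Prop) : ~~ is_jump i -> 0 < T -> Q (exec i (0, m)).2 ->
  runs (Atom i) m T Q.
Proof. by move=> ni T0 q; exists 1, (exec i (0, m)).2; split=> //; constructor. Qed.

Lemma runs_seq T1 T2 c1 c2 m T (Q : memory -> Prop) :
  runs c1 m T1 (fun m1 => runs c2 m1 T2 Q) -> T1 + T2 <= T -> runs (Seq c1 c2) m T Q.
Proof.
move=> [t1 [m1 [h1 l1 [t2 [m2 [h2 l2 q]]]]]] TT; exists (t1 + t2), m2; split=> //; last by lia.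
exact: bigstep_seq h1 h2.
Qed.

Lemma runs_stop r c m T (Q : memory -> Prop) : m r = 0 -> 0 < T -> Q m -> runs (While r c) m T Q.
Proof. by move=> r0 T0 q; exists 1, m; split=> //; constructor. Qed.

Lemma runs_loop T1 T2 r c m T (Q : memory -> Prop) : m r != 0 ->
  runs c m T1 (fun m1 => runs (While r c) (update m1 0 0) T2 Q) -> T1 + 3 + T2 <= T ->
  runs (While r c) m T Q.
Proof.
move=> r0 [t1 [m1 [h1 l1 [t2 [m2 [h2 l2 q]]]]]] TT.
by exists (t1 + 3 + t2), m2; split=> //; [exact: bigstep_loop h1 h2 | lia].
Qed.

(** [I j] is the invariant with [j] rounds to go. A round costs three extra steps, the test and the
    jump back, which also clears register 0. *)
Lemma runs_count (I : nat -> memory -> Prop) r c T k m :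
  (forall j m', I j m' -> (m' r == 0) = (j == 0)) ->
  (forall j m', j < k -> I j.+1 m' -> runs c m' T (fun m1 => I j (update m1 0 0))) ->
  I k m -> runs (While r c) m (k * (T + 3) + 1) (I 0).
Proof.
move=> Ir Ic; elim: k m Ic => [|k IH] m Ic Im; first by apply: runs_stop => //; apply/eqP; rewrite (Ir _ _ Im).
apply: (@runs_loop T (k * (T + 3) + 1)); first by rewrite (Ir _ _ Im).
  apply: runsW (Ic k m (ltnSn k) Im) (leqnn _) _ => m' Im'.
  by apply: IH => // j m1 jk; apply: Ic; exact: ltnW.
by rewrite mulSn; lia.
Qed.

(** * First-order programs *)

(* Formulas and programs about binary relations on a finite set; variables are
   de Bruijn levels, so [Ex] and [For] bind the level equal to their depth. *)
Inductive form :=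
| Rel of nat & nat & nat
| Eqv of nat & nat
| Not of form
| And of form & form
| Ex of form.

Inductive prog :=
| Def of nat & form
| Then of prog & prog
| For of prog.

Section Semantics.

Variable T : finType.
Implicit Types (R : nat -> rel T) (e : seq T).

Fixpoint holds R e f : bool :=
  match f with
  | Rel k i j => if onth e i is Some u then if onth e j is Some v then R k u v else false
                 else false
  | Eqv i j => onth e i == onth e j
  | Not f => ~~ holds R e f
  | And f g => holds R e f && holds R e g
  | Ex f => [exists u, holds R (rcons e u) f]
  end.

Definition define k (S : rel T) R : nat -> rel T := fun k' => if k' == k then S else R k'.

(** The order [rev (enum T)] is that of the compiled loop, whose counter runs downwards. *)
Fixpoint perform R e c : nat -> rel T :=
  match c with
  | Def k f => define k (fun u v => holds R (rcons (rcons e u) v) f) R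
  | Then c1 c2 => perform (perform R e c1) e c2
  | For c => foldl (fun R u => perform R (rcons e u) c) R (rev (enum T))
  end.

End Semantics.

Fixpoint mentions k f :=
  match f with
  | Rel k' _ _ => k' == k
  | Eqv _ _ => false
  | Not f | Ex f => mentions k f
  | And f g => mentions k f || mentions k g
  end.

(** A compiled [Def] overwrites its relation entry by entry while further entries are still being
    evaluated; this is sound because the formula does not read that relation. *)
Lemma holds_unmentioned (T : finType) (R R' : nat -> rel T) k f e : ~~ mentions k f ->
  (forall k', k' != k -> R k' =2 R' k') -> holds R e f = holds R' e f.
Proof.
move=> nf RR; elim: f e nf => [k' i j|//|f IH|f IH g IHg|f IH] e //= nf.
- by case: onth => // u; case: onth => // v; apply: RR.
- by rewrite IH.
- by move: nf; rewrite negb_or => /andP[nf ng]; rewrite IH ?IHg.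
by apply: eq_existsb => u; apply: IH.
Qed.

(* Registers 0 to 5 are scratch: 1 holds an address, 2 a loop counter, 3 the
   value of the last formula, 4 a condition.  Registers 6 to 9 hold the number
   of vertices, 1, the address of the first relation and the size of a relation.
   Level [d] owns a variable and an accumulator for [Ex]. *)
Definition var d := 10 + 2 * d.
Definition acc d := 11 + 2 * d.

Definition mov d a := Seq (Atom (IConst 0 0)) (Atom (IAdd d a 0)).

Definition multiply_add s := While 2 (Seq (Atom (IAdd 1 1 s)) (Atom (ISub 2 2 7))).

Notation "a ;; b" := (Seq a b) (at level 60, right associativity).

Definition address k i j :=
  mov 1 8;; Atom (IConst 2 k);; multiply_add 9;; mov 2 (var i);; multiply_add 6;;
  Atom (IAdd 1 1 (var j)).

(** Register 7 holds 1, so negation is subtraction from it. Equality adds the two truncated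
    differences. The loop of [And] is a conditional that runs at most once. [Ex] counts the
    witnesses, and a double negation turns the count into a truth value. *)
Fixpoint eval d f :=
  match f with
  | Rel k i j => address k i j;; Atom (ILoad 3 1)
  | Eqv i j => Atom (ISub 1 (var i) (var j));; Atom (ISub 2 (var j) (var i));;
      Atom (IAdd 1 1 2);; Atom (ISub 3 7 1)
  | Not f => eval d f;; Atom (ISub 3 7 3)
  | And f g => eval d f;; mov 4 3;; While 4 (eval d g;; Atom (IConst 4 0))
  | Ex f => Atom (IConst (acc d) 0);; mov (var d) 6;;
      While (var d) (Atom (ISub (var d) (var d) 7);; eval d.+1 f;; Atom (IAdd (acc d) (acc d) 3));;
      Atom (ISub 3 7 (acc d));; Atom (ISub 3 7 3)
  end.

(** The counter is decremented before the body, which therefore sees the ranks from the number of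
    vertices minus 1 down to 0. *)
Definition each d c := mov (var d) 6;; While (var d) (Atom (ISub (var d) (var d) 7);; c).

Fixpoint translate d c :=
  match c with
  | Def k f => each d (each d.+1 (eval d.+2 f;; address k d d.+1;; Atom (IStore 1 3)))
  | Then c1 c2 => translate d c1;; translate d c2
  | For c => each d (translate d.+1 c)
  end.

Fixpoint eval_cost f n :=
  match f with
  | Rel k _ _ => 5 * (n + k) + 20
  | Eqv _ _ => 4
  | Not f => eval_cost f n + 1
  | And f g => eval_cost f n + eval_cost g n + 10
  | Ex f => n * (eval_cost f n + 5) + 10
  end.

Fixpoint cost c n :=
  match c with
  | Def k f => n * (n * (eval_cost f n + 5 * (n + k) + 17) + 15) + 10
  | Then c1 c2 => cost c1 n + cost c2 n
  | For c => n * (cost c n + 5) + 10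
  end.

Ltac mem := rewrite /update /=; repeat (case: eqP => /= ?); try lia.
Ltac atom := apply: runs_atom => //=.

Lemma multiply_add_runs s m : m 7 = 1 -> 2 < s ->
  runs (multiply_add s) m (m 2 * 5 + 1)
    (fun m' => m' 1 = m 1 + m 2 * m s /\ forall r, 2 < r -> m' r = m r).
Proof.
move=> m7 s2.
pose I j (m' : memory) := [/\ m' 2 = j, m' 1 + j * m s = m 1 + m 2 * m s &
  forall r, 2 < r -> m' r = m r].
have h := @runs_count I 2 (Atom (IAdd 1 1 s) ;; Atom (ISub 2 2 7)) 2 (m 2) m.
apply: runsW (h _ _ _) _ _ => //; last first.
- by move=> m' [_ e f]; split=> //; rewrite -e addn0.
- move=> j m' _ [m2 e f].
  apply: (@runs_seq 1 1) => //; atom; atom; split.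
  + by mem; rewrite (f 7) // m2 m7 subn1.
  + by mem; rewrite -e mulSn (f s) //; lia.
  + by move=> r r2; mem; apply: f.
by move=> j m' [->].
Qed.

Lemma address_runs k i j m : m 7 = 1 ->
  runs (address k i j) m (5 * (m (var i) + k) + 10)
    (fun m' => m' 1 = m 8 + k * m 9 + m (var i) * m 6 + m (var j) /\
               forall r, 2 < r -> m' r = m r).
Proof.
move=> m7; have [vi vj] : 9 < var i /\ 9 < var j by rewrite /var; lia.
apply: (@runs_seq 2 (5 * (m (var i) + k) + 8)); last by lia.
apply: (@runs_seq 1 1) => //; atom; atom.
apply: (@runs_seq 1 (5 * (m (var i) + k) + 7)); last by lia.
atom.
apply: (@runs_seq (5 * k + 1) (5 * m (var i) + 6)); last by lia.
apply: runsW (multiply_add_runs _ _) _ _ => //; first by rewrite [X in X * 5]/=; mem.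
move=> m1 [e1 f1].
apply: (@runs_seq 2 (5 * m (var i) + 4)); last by lia.
apply: (@runs_seq 1 1) => //; atom; atom.
set m2 := update _ 2 _.
have f2 r : 2 < r -> m2 r = m r by move=> r2; rewrite /m2; mem; rewrite f1 //; mem.
have e2 : m2 1 = m 8 + k * m 9 by rewrite /m2; mem; rewrite e1; mem.
have c2 : m2 2 = m (var i) by rewrite /m2; mem; rewrite f1; mem.
apply: (@runs_seq (5 * m (var i) + 1) 1); last by lia.
apply: runsW (multiply_add_runs _ _) _ _ => //; [by rewrite f2 | by rewrite c2; lia|].
move=> m3 [e3 f3]; atom; split; last by move=> r r2; mem; rewrite f3 ?f2.
by mem; rewrite e3 e2 c2 f2 // f3 ?f2 //; lia.
Qed.

(** * Correctness and cost of compiled programs *)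

Section Machine.

(* Levels are bounded by [D], so that all named registers lie below [top];
   relation [k] is stored row by row from register [m 8 + k * #|T| ^ 2] on. *)
Variables (D : nat) (T : finType).
Implicit Types (R : nat -> rel T) (e : seq T) (m : memory).

Let top := 10 + 2 * D.
Let n := #|T|.

Fixpoint scoped d f :=
  match f with
  | Rel _ i j | Eqv i j => (i < d) && (j < d)
  | Not f => scoped d f
  | And f g => scoped d f && scoped d g
  | Ex f => (d < D) && scoped d.+1 f
  end.

Fixpoint well_scoped d c :=
  match c with
  | Def k f => [&& d.+1 < D, ~~ mentions k f & scoped d.+2 f]
  | Then c1 c2 => well_scoped d c1 && well_scoped d c2
  | For c => (d < D) && well_scoped d.+1 c
  end.

(** Preserved are the parameters from register 6 on, the levels below [d] and the stored relations;
    scratch registers and deeper levels may change. *)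
Definition kept d r := (5 < r < var d) || (top <= r).

Definition frame d m m' := forall r, kept d r -> m' r = m r.

Definition represents R e m :=
  [/\ [/\ m 6 = n, m 7 = 1, m 9 = n * n & top <= m 8], size e <= D,
      forall i u, onth e i = Some u -> m (var i) = enum_rank u &
      forall k u v, m (m 8 + k * (n * n) + enum_rank u * n + enum_rank v) = R k u v].

Lemma onth_lt (e : seq T) i u : onth e i = Some u -> i < size e.
Proof. by move=> h; rewrite -onthTE h. Qed.

Lemma represents_frame R e m m' : represents R e m -> frame (size e) m m' -> represents R e m'.
Proof.
move=> [[m6 m7 m9 m8] sD hv hR] fr.
have h r : 5 < r -> r < 10 -> m' r = m r by move=> r5 r9; apply: fr; rewrite /kept /var; lia.
split=> //; first by rewrite !h.
- move=> i u iu; rewrite -(hv _ _ iu) fr // /kept /var.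
  by have := onth_lt iu; lia.
by move=> k u v; rewrite -hR (h 8) // fr // /kept; lia.
Qed.

Lemma represents_rcons R e m u : represents R e m -> size e < D ->
  m (var (size e)) = enum_rank u -> represents R (rcons e u) m.
Proof.
move=> [hm sD hv hR] eD mu; split=> //; first by rewrite size_rcons.
move=> i w; rewrite -cats1 onth_cat; case: ltnP => ie; first exact: hv.
by case: (i - size e) (subnK ie) => [<- [<-]|k _]; rewrite ?add0n // /= onth_default.
Qed.

Lemma represents_belast R e m u : represents R (rcons e u) m -> represents R e m.
Proof.
move=> [hm sD hv hR]; split=> //; first by rewrite size_rcons in sD; lia.
move=> i w iw; apply: hv; rewrite -cats1 onth_cat (onth_lt iw) //.
Qed.

Lemma represents_eq R R' e m : (forall k, R k =2 R' k) -> represents R e m -> represents R' e m.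
Proof. by move=> RR [hm sD hv hR]; split=> // k u v; rewrite -RR. Qed.

Lemma enum_rank_lt (u : T) : enum_rank u < n.
Proof. exact: ltn_ord. Qed.

Lemma eqn_enum_rank (u v : T) : (enum_rank u == enum_rank v :> nat) = (u == v).
Proof. exact: (inj_eq enum_rank_inj). Qed.

Lemma eval_runs f R e m : represents R e m -> scoped (size e) f ->
  runs (eval (size e) f) m (eval_cost f n)
    (fun m' => m' 3 = holds R e f /\ frame (size e) m m').
Proof.
elim: f e m => [k i j|i j|f IH|f IHf g IHg|f IH] e m rep /=.
- case/andP=> ie je; have [[m6 m7 m9 m8] sD hv hR] := rep.
  case iu: (onth e i) (onthTE e i) => [u|]; last by rewrite ie.
  case jv: (onth e j) (onthTE e j) => [v|]; last by rewrite je.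
  move=> _ _.
  have ur := enum_rank_lt u.
  apply: (@runs_seq (5 * (n + k) + 10) 1); last by lia.
  apply: runsW (address_runs k i j m7) _ _; first by rewrite (hv _ _ iu); lia.
  move=> m1 [e1 f1]; atom; split.
    rewrite /update /= e1 f1; last by rewrite /top in m8; lia.
    by rewrite (hv _ _ iu) (hv _ _ jv) m6 m9 hR.
  by move=> r kr; rewrite /update; case: eqP => [r3|_]; [move: kr|apply: f1; move: kr];
    rewrite /kept /top; lia.
- case/andP=> ie je; have [[m6 m7 m9 m8] sD hv hR] := rep.
  case iu: (onth e i) (onthTE e i) => [u|]; last by rewrite ie.
  case jv: (onth e j) (onthTE e j) => [v|]; last by rewrite je.
  move=> _ _; apply: (@runs_seq 1 3) => //; atom; apply: (@runs_seq 1 2) => //; atom.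
  apply: (@runs_seq 1 1) => //; atom; atom; split; last first.
    by move=> r; rewrite /kept /top => kr; mem.
  have -> : (Some u == Some v) = (enum_rank u == enum_rank v :> nat).
    by rewrite eqn_enum_rank (inj_eq (@Some_inj _)).
  by rewrite -(hv _ _ iu) -(hv _ _ jv) /update /=; mem.
- move=> sf; apply: (@runs_seq (eval_cost f n) 1) => //.
  apply: runsW (IH e m rep sf) _ _ => // m1 [e1 f1]; have [[m6 m7 _ _] _ _ _] := rep.
  atom; split; last by move=> r kr; rewrite -f1 // /update; case: eqP kr => // ->.
  rewrite /update /= e1 f1 ?m7; first by case: holds.
  by rewrite /kept /var; lia.
- case/andP=> sf sg; apply: (@runs_seq (eval_cost f n) (eval_cost g n + 10)); last by lia.
  apply: runsW (IHf e m rep sf) _ _ => // m1 [e1 f1].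
  apply: (@runs_seq 2 (eval_cost g n + 8)); last by lia.
  apply: (@runs_seq 1 1) => //; atom; atom.
  set m2 := update _ 4 _.
  have f2 : frame (size e) m m2.
    by move=> r kr; rewrite -f1 //; move: kr; rewrite /kept /top => kr; rewrite /m2; mem.
  have e2 : m2 4 = holds R e f by rewrite -e1 /m2; mem.
  have r2 : represents R e m2 := represents_frame rep f2.
  case hf: (holds R e f) in e1 e2 *; last first.
    by apply: runs_stop; rewrite ?e2 ?addnS //; split; rewrite // /m2 /update /= e1.
  apply: (@runs_loop (eval_cost g n + 1) 1); last by lia.
    by rewrite e2.
  apply: (@runs_seq (eval_cost g n) 1) => //.
  apply: runsW (IHg e m2 r2 sg) _ _ => // m3 [e3 f3]; atom.
  apply: runs_stop => //; split; first by rewrite /update /= e3.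
  move=> r kr; rewrite -f2 // -f3 //; move: kr; rewrite /kept /top => kr; mem.
case/andP=> eD sf; have [[m6 m7 m9 m8] sD hv hR] := rep.
set d := size e in eD sf *.
have [a9 v9] : 9 < acc d /\ 9 < var d by rewrite /acc /var; lia.
pose I j m' := [/\ m' (var d) = j,
  (m' (acc d) != 0) = [exists u, (j <= enum_rank u) && holds R (rcons e u) f] & frame d m m'].
apply: (@runs_seq 1 (n * (eval_cost f n + 5) + 9)); last by lia.
atom; apply: (@runs_seq 2 (n * (eval_cost f n + 5) + 7)); last by lia.
apply: (@runs_seq 1 1) => //; atom; atom; set m1 := update _ (var d) _.
have I1 : I n m1.
  split; first by rewrite /m1 /acc /var; mem.
  - have -> : m1 (acc d) = 0 by rewrite /m1 /var /acc; mem.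
    by apply/esym/existsP => -[u /andP[]]; have := enum_rank_lt u; lia.
  by move=> r; rewrite /kept /top /var => kr; rewrite /m1 /acc /var; mem.
apply: (@runs_seq (n * (eval_cost f n + 2 + 3) + 1) 2); last by lia.
apply: runsW (@runs_count I _ _ (eval_cost f n + 2) n m1 _ _ I1) _ _ => //.
- by move=> j m' [->].
- move=> j m' jn [vj aj fj].
  apply: (@runs_seq 1 (eval_cost f n + 1)); last by lia.
  atom; set m2 := update _ _ _.
  have f2 : frame d m m2.
    by move=> r kr; rewrite -fj //; move: kr; rewrite /kept /top /var => kr; rewrite /m2 /var; mem.
  pose u := enum_val (Ordinal jn).
  have ru : enum_rank u = j :> nat by rewrite enum_valK.
  have r2 : represents R (rcons e u) m2.
    apply: represents_rcons => //; first exact: represents_frame rep f2.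
    rewrite -/d ru /m2 /update eqxx vj fj ?m7; last by rewrite /kept; lia.
    by rewrite subn1.
  apply: (@runs_seq (eval_cost f n) 1) => //.
  have := IH (rcons e u) m2 r2; rewrite size_rcons => /(_ sf) h.
  apply: runsW h _ _ => // m3 [e3 f3]; atom.
  have vk : kept d.+1 (var d) && kept d.+1 (acc d) by rewrite /kept /var /acc; lia.
  case/andP: vk => vk ak.
  split.
  + have -> : update (update m3 (acc d) (m3 (acc d) + m3 3)) 0 0 (var d) = m3 (var d).
      by rewrite /acc /var; mem.
    by rewrite f3 // -[RHS]ru; have [_ _ + _] := r2; apply; rewrite -cats1 onth_cat ltnn subnn.
  + have -> : update (update m3 (acc d) (m3 (acc d) + m3 3)) 0 0 (acc d) = m3 (acc d) + m3 3.
      by rewrite /acc /var; mem.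
    have -> : m3 (acc d) = m' (acc d) by rewrite f3 // /m2 /acc /var; mem.
    rewrite e3 addn_eq0 negb_and aj eqb0 negbK; apply/orP/existsP.
      case=> [/existsP[w /andP[jw hw]]|hu]; [exists w | exists u]; rewrite ?hw ?hu andbT; lia.
    case=> w /andP[jw hw]; have [wj|wj] := eqVneq (enum_rank w : nat) j.
      by right; have -> : u = w by apply: enum_rank_inj; apply: val_inj; rewrite /= ru wj.
    by left; apply/existsP; exists w; rewrite hw andbT; lia.
  move=> r kr; rewrite -f2 // -f3; last by move: kr; rewrite /kept /var; lia.
  by move: kr; rewrite /kept /top /var => kr; rewrite /acc; mem.
move=> m2 [_ a2 f2]; have k7 : m2 7 = 1 by rewrite f2 ?m7 // /kept; lia.
apply: (@runs_seq 1 1) => //; atom; atom; split.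
  have -> : [exists u, holds R (rcons e u) f] = (m2 (acc d) != 0).
    by rewrite a2; apply: eq_existsb => u; rewrite leq0n.
  by rewrite /update /=; mem.
by move=> r kr; rewrite -f2 //; move: kr; rewrite /kept /top => kr; mem.
Qed.

Lemma each_runs (J : nat -> memory -> Prop) d c t m : d < D ->
  (forall j m' m1, J j m' -> frame d m' m1 -> J j m1) ->
  (forall j m', J j m' -> m' 6 = n /\ m' 7 = 1) ->
  (forall (u : T) m', J (enum_rank u).+1 m' -> m' (var d) = enum_rank u ->
     runs c m' t (fun m1 => J (enum_rank u) m1 /\ m1 (var d) = enum_rank u)) ->
  J n m -> runs (each d c) m (n * (t + 5) + 10) (J 0).
Proof.
move=> dD Jf J7 Jc Jn.
have fr a m' : a < 6 \/ a = var d -> forall x, frame d m' (update m' a x).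
  by move=> h x r; rewrite /kept /top /var in h * => kr; mem.
apply: (@runs_seq 2 (n * (t + 4) + 1)); last by lia.
apply: (@runs_seq 1 1) => //; atom; atom.
apply: runsW (@runs_count (fun j m' => m' (var d) = j /\ J j m') _ _ (t + 1) n _ _ _ _) _ _.
- by move=> j m' [->].
- move=> j m' jn [vj Jj]; have [_ m7] := J7 _ _ Jj.
  apply: (@runs_seq 1 t); last by lia.
  atom; set m2 := update _ _ _.
  pose u := enum_val (Ordinal jn).
  have ru : enum_rank u = j :> nat by rewrite enum_valK.
  have h := Jc u m2; rewrite ru in h.
  apply: runsW (h _ _) (leqnn _) _.
  - by apply: Jf Jj _; apply: fr; right.
  - by rewrite /m2 /update eqxx vj m7 subn1.
  move=> m1 [Jm1 vm1]; split; first by rewrite -[RHS]vm1 /update /var.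
  by apply: Jf Jm1 _; apply: fr; left.
- split; first by rewrite /var; mem; rewrite addn0 (proj1 (J7 _ _ Jn)).
  by apply: (Jf) (fr _ _ _ _); [apply: Jf Jn (fr _ _ _ _); left | right].
- by lia.
by move=> m' [].
Qed.

Lemma represents_store R e m k u v (b : bool) : represents R e m ->
  represents (define k (fun a c => if (a == u) && (c == v) then b else R k a c) R) e
    (update m (m 8 + k * (n * n) + enum_rank u * n + enum_rank v) b).
Proof.
move=> [[m6 m7 m9 m8] sD hv hR]; set a := _ + enum_rank v.
have h r : r < top -> update m a b r = m r by rewrite /a => rt; mem.
split=> //; first by rewrite !h // /top; lia.
- by move=> i w iw; rewrite h ?(hv _ _ iw) //; have := onth_lt iw; rewrite /top /var; lia.
move=> k' u' v'; rewrite (h 8) /update; last by rewrite /top; lia.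
have [ru rv] := (enum_rank_lt u, enum_rank_lt v).
have [ru' rv'] := (enum_rank_lt u', enum_rank_lt v').
(* Division with remainder recovers row and column, so distinct entries have distinct addresses. *)
have inj x y x' y' z : y < z -> y' < z -> x * z + y = x' * z + y' -> x = x' /\ y = y'.
  move=> yz yz' e1; have z0 : 0 < z by lia.
  move: (congr1 (divn^~ z) e1) (congr1 (modn^~ z) e1).
  by rewrite /= !divnMDl // !divn_small // !addn0 !modnMDl !modn_small.
rewrite /define; case: (eqVneq k' k) => [->|kk].
  case: (boolP ((u' == u) && (v' == v))) => [/andP[/eqP-> /eqP->]|uv]; first by rewrite eqxx.
  case: eqP => // /eqP; rewrite /a -!addnA !eqn_add2l => /eqP /inj [] // e1 e2.
  move: uv; have -> : u' = u by apply: enum_rank_inj; apply: val_inj.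
  have -> : v' = v by apply: enum_rank_inj; apply: val_inj.
  by rewrite !eqxx.
case: eqP => // /eqP; rewrite /a -!addnA eqn_add2l => /eqP /inj [] //.
- by nia.
- by nia.
by move/eqP: kk.
Qed.

Lemma represents_store_at R R' e m k u v (b : bool) : represents R e m ->
  R' k u v = b ->
  (forall k' u' v', (k', u', v') != (k, u, v) -> R' k' u' v' = R k' u' v') ->
  represents R' e (update m (m 8 + k * (n * n) + enum_rank u * n + enum_rank v) b).
Proof.
move=> rep Rb RR; apply: represents_eq (represents_store k u v b rep) => k' u' v'.
rewrite /define; case: eqP => [->|/eqP kk]; last by rewrite RR // !xpair_eqE (negbTE kk).
by case: ifP => [/andP[/eqP-> /eqP->]|uv]; rewrite ?Rb // RR // !xpair_eqE eqxx /= uv.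
Qed.

Lemma translate_runs c R e m : represents R e m -> well_scoped (size e) c ->
  runs (translate (size e) c) m (cost c n) (represents (perform R e c) e).
Proof.
elim: c R e m => [k f|c1 IH1 c2 IH2|c IH] R e m rep /=.
- case/and3P=> eD kf sf.
  pose new u v := holds R (rcons (rcons e u) v) f.
  (* The state in the middle of a definition: [P] is the set of pairs already updated, and both
     loops enlarge it from the high ranks downwards. *)
  pose mix (P : rel T) := define k (fun u v => if P u v then new u v else R k u v) R.
  have mixE (P Q : rel T) : P =2 Q -> forall k', mix P k' =2 mix Q k'.
    by move=> PQ k' a b; rewrite /mix /define; case: ifP; rewrite // PQ.
  apply: runsW (each_runs (J := fun j => represents (mix (fun a _ => j <= enum_rank a)) e)
    (t := n * (eval_cost f n + 5 * (n + k) + 17) + 10) _ _ _ _ _) _ _.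
  + by lia.
  + by move=> j m' m1; exact: represents_frame.
  + by move=> j m' [[]].
  + move=> u m' rep1 vu.
    pose Q j (a b : T) := (enum_rank u < enum_rank a) || (a == u) && (j <= enum_rank b).
    have Q0 : Q 0 =2 (fun a _ => enum_rank u <= enum_rank a).
      by move=> a b; rewrite /Q leq0n andbT [in RHS]leq_eqVlt eqn_enum_rank orbC eq_sym.
    have Qn : Q n =2 (fun a _ => enum_rank u < enum_rank a).
      by move=> a b; rewrite /Q [n <= _]leqNgt enum_rank_lt andbF orbF.
    have sE : (size e).+1 = size (rcons e u) by rewrite size_rcons.
    apply: runsW (each_runs (J := fun j => represents (mix (Q j)) (rcons e u))
      (t := eval_cost f n + 5 * (n + k) + 12) _ _ _ _ _) _ _ => //.
    * by move=> j m2 m1; rewrite sE; exact: represents_frame.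
    * by move=> j m2 [[]].
    * move=> v m2 rep2 vv; rewrite sE in vv eD.
      have rep3 := represents_rcons rep2 eD vv.
      have e2 : (size e).+2 = size (rcons (rcons e u) v) by rewrite !size_rcons.
      rewrite e2 in sf *.
      apply: (@runs_seq (eval_cost f n) (5 * (n + k) + 12)); last by lia.
      apply: runsW (eval_runs rep3 sf) _ _ => // m3 [r3 f3].
      have rep4 := represents_frame rep3 f3; have [[n6 n7 n9 n8] sD hv hR] := rep4.
      have on1 : onth (rcons (rcons e u) v) (size e) = Some u.
        by rewrite -!cats1 -catA onth_cat ltnn subnn.
      have on2 : onth (rcons (rcons e u) v) (size e).+1 = Some v.
        by rewrite sE -cats1 onth_cat ltnn subnn.
      apply: (@runs_seq (5 * (n + k) + 10) 1); last by lia.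
      apply: runsW (address_runs k (size e) (size e).+1 n7) _ _.
        by rewrite (hv _ _ on1); have := enum_rank_lt u; lia.
      move=> m4 [r4 f4]; atom; rewrite r4 (hv _ _ on1) (hv _ _ on2) n6 n9 f4 // r3.
      have fr4 : frame (size (rcons (rcons e u) v)) m3 m4.
        by move=> r kr; apply: f4; move: kr; rewrite /kept /top; lia.
      have rep5 := represents_frame rep4 fr4.
      have <- : m4 8 = m3 8 by apply: f4.
      set h := holds _ _ _.
      have hE : h = new u v.
        apply: (holds_unmentioned _ kf) => k' kk a b.
        by rewrite /mix /define (negbTE kk).
      have rep6 : represents (mix (Q (enum_rank v))) (rcons (rcons e u) v)
        (update m4 (m4 8 + k * (n * n) + enum_rank u * n + enum_rank v) h).
        apply: represents_store_at rep5 _ _.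
          by rewrite /mix /define eqxx /Q eqxx leqnn orbT.
        move=> k' a b; rewrite !xpair_eqE /mix /define; case: (k' == k) => //= ab.
        rewrite /Q; case: (eqVneq a u) ab => //= _ bv.
        by rewrite [enum_rank v < _]ltn_neqAle eqn_enum_rank (eq_sym v) bv.
      split; first exact: represents_belast rep6.
      by have [_ _ + _] := rep6; apply.
    * apply: represents_eq (mixE _ _ (fun a b => esym (Qn a b))) _.
      by apply: represents_rcons => //; lia.
    * by lia.
    move=> m1 rep1'; split; last first.
      by have [_ _ + _] := rep1'; apply; rewrite -cats1 onth_cat ltnn subnn.
    by apply: represents_eq (mixE _ _ Q0) _; exact: represents_belast rep1'.
  + apply: represents_eq rep => k' a b; rewrite /mix /define.
    by case: eqP => // ->; rewrite leqNgt enum_rank_lt.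
  + by lia.
  move=> m1; apply: represents_eq => k' a b; rewrite /mix /define /=.
  by case: eqP => // ->.
- case/andP=> s1 s2; apply: (@runs_seq (cost c1 n) (cost c2 n)) => //.
  by apply: runsW (IH1 _ _ _ rep s1) _ _ => // m1 rep1; exact: IH2.
case/andP=> eD sc.
pose F := foldl (fun R u => perform R (rcons e u) c) R.
apply: runsW (each_runs (J := fun j => represents (F (rev (drop j (enum T)))) e)
  (t := cost c n) _ _ _ _ _) _ _ => //.
- by move=> j m' m1; exact: represents_frame.
- by move=> j m' [[]].
- move=> u m' rep1 vu.
  have := IH _ (rcons e u) m' (represents_rcons rep1 eD vu); rewrite size_rcons => /(_ sc) h.
  apply: runsW h _ _ => // m1 rep2; split; last first.
    by have [_ _ + _] := rep2; apply; rewrite -cats1 onth_cat ltnn subnn.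
  rewrite (drop_nth u) -?cardE ?enum_rank_lt // nth_enum_rank rev_cons.
  by rewrite /F foldl_rcons; exact: represents_belast rep2.
- by rewrite drop_oversize -?cardE.
by move=> m'; rewrite drop0.
Qed.

End Machine.

(** * Input format and running time *)

(** The base [n.+1] is positive, so exponents can be raised freely when bounds are added. *)
Definition poly_bounded (t : nat -> nat) := exists c k, forall n, t n <= c * n.+1 ^ k.

Lemma poly_bounded_const a : poly_bounded (fun=> a).
Proof. by exists a, 0 => n; rewrite muln1. Qed.

Lemma poly_bounded_id : poly_bounded id.
Proof. by exists 1, 1 => n; rewrite mul1n expn1. Qed.

Lemma poly_bounded_add s t : poly_bounded s -> poly_bounded t -> poly_bounded (fun n => s n + t n).
Proof.
move=> [c [k h]] [c' [k' h']]; exists (c + c'), (k + k') => n.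
have [e e'] : n.+1 ^ k <= n.+1 ^ (k + k') /\ n.+1 ^ k' <= n.+1 ^ (k + k').
  by rewrite !leq_pexp2l ?leq_addr ?leq_addl.
rewrite mulnDl leq_add //; first by apply: leq_trans (h n) _; rewrite leq_mul2l e orbT.
by apply: leq_trans (h' n) _; rewrite leq_mul2l e' orbT.
Qed.

Lemma poly_bounded_mul s t : poly_bounded s -> poly_bounded t -> poly_bounded (fun n => s n * t n).
Proof.
move=> [c [k h]] [c' [k' h']]; exists (c * c'), (k + k') => n.
by rewrite expnD mulnACA leq_mul.
Qed.

Lemma poly_bounded_eval_cost f : poly_bounded (eval_cost f).
Proof.
by elim: f => *; rewrite /=; do ?(apply: poly_bounded_add || apply: poly_bounded_mul) => //;
  (apply: poly_bounded_const || apply: poly_bounded_id).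
Qed.

Lemma poly_bounded_cost c : poly_bounded (cost c).
Proof.
elim: c => [k f|c1 h1 c2 h2|c h] /=; do ?(apply: poly_bounded_add || apply: poly_bounded_mul) => //;
  by [apply: poly_bounded_const | apply: poly_bounded_id | apply: poly_bounded_eval_cost].
Qed.

(** The word of a graph on [n] vertices has length [n * n]. The factor [2 ^ k] comes from
    [n.+1 <= 2 * (n * n)] for positive [n], and the additive constant covers [n = 0]. *)
Lemma poly_bounded_square t : poly_bounded t ->
  exists c k, forall n, t n <= c * (n * n) ^ k + c.
Proof.
move=> [c [k h]]; exists (c * 2 ^ k), k => n; apply: leq_trans (h n) _.
case: n => [|n]; first by rewrite exp1n muln1; have := expn_gt0 2 k; nia.
rewrite -mulnA -expnMn (leq_trans _ (leq_addr _ _)) // leq_mul2l.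
by case: k {h} => [|k]; rewrite ?expn0 ?leqnn ?orbT // leq_exp2r // orbC; nia.
Qed.

(* The input is moved beyond the named registers: register [r] to [N + top + r],
   where [N] is the length of the input.  Register 1 holds a diagonal entry of
   the adjacency matrix, hence 0, and can receive [N] at once. *)
Definition copy_low top := fix copy s :=
  if s is s'.+1 then
    copy s';; Atom (IConst 0 (top + s.+1));; Atom (IAdd 0 0 1);; Atom (IStore 0 s.+1)
  else Atom (IConst 0 0).

(** The remaining input registers are [top] to [N], and register 2 starts at their number, which is
    0 for a short input. All targets lie beyond [N + top], so no unread entry is overwritten. *)
Definition copy_high top :=
  Atom (IConst 7 1);; Atom (IConst 3 top.-1);; Atom (ISub 2 1 3);;
  While 2 (Atom (IAdd 4 2 3);; Atom (ILoad 5 4);; Atom (IAdd 4 4 1);; Atom (IConst 0 top);;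
           Atom (IAdd 4 4 0);; Atom (IStore 4 5);; Atom (ISub 2 2 7)).

(* Subtracts the successive odd numbers. *)
Definition square_root :=
  mov 2 1;; Atom (IConst 4 1);; Atom (IConst 6 0);;
  While 2 (Atom (ISub 2 2 4);; Atom (IAdd 4 4 7);; Atom (IAdd 4 4 7);; Atom (IAdd 6 6 7)).

(** Register 1, the first matrix entry, lands in [N + top.+1], the base of relation 0. Registers
    beyond the input contain 0, so all other relations start empty. *)
Definition prelude top :=
  Atom (IAdd 1 0 1);; copy_low top top.-2;; copy_high top;; square_root;;
  mov 9 1;; Atom (IConst 0 top.+1);; Atom (IAdd 8 1 0).

Section Prelude.

Variables (top n : nat) (m0 : memory).
Hypothesis top10 : 9 < top.
Let N := n * n.
Hypotheses (m00 : m0 0 = N) (m01 : m0 1 = 0) (m0N : forall r, N < r -> m0 r = 0).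

Lemma copy_low_runs s m : s.+1 < top -> m 1 = N -> (forall r, 1 < r -> m r = m0 r) ->
  runs (copy_low top s) m (3 * s + 1) (fun m' => [/\ m' 1 = N,
    forall r, 1 < r -> r <= N + top -> m' r = m0 r &
    forall a, 0 < a -> m' (N + top + a) = if a <= s.+1 then m0 a else 0]).
Proof.
move=> + m1 mr; elim: s => [|s IH] st.
  atom; split; [by mem | by move=> r r1 _; mem; apply: mr|].
  move=> a a0; have -> : update m 0 0 (N + top + a) = 0.
    by mem; rewrite mr ?m0N; lia.
  by case: a a0 => [|[|a]] // _; rewrite ?m01.
apply: (@runs_seq (3 * s + 1) 3); last by lia.
apply: runsW (IH _) (leqnn _) _; first by lia.
move=> m' [e1 er ea]; apply: (@runs_seq 1 2) => //; atom; apply: (@runs_seq 1 1) => //; atom; atom.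
have -> : update (update m' 0 (top + s.+2)) 0 (top + s.+2 + m' 1) s.+2 = m0 s.+2.
  by rewrite /update /= er; lia.
have -> : update (update m' 0 (top + s.+2)) 0 (top + s.+2 + m' 1) 0 = N + top + s.+2.
  by rewrite /update /= e1; lia.
split.
- by mem.
- by move=> r r1 rN; mem; apply: er.
move=> a a0; rewrite /update eqn_add2l; case: (eqVneq a s.+2) => [->|ne]; first by rewrite leqnn.
have -> : (a <= s.+2) = (a <= s.+1) by lia.
by mem; rewrite ea.
Qed.

Lemma copy_high_runs m : m 1 = N -> (forall r, 1 < r -> r <= N + top -> m r = m0 r) ->
  (forall a, 0 < a -> m (N + top + a) = if a < top then m0 a else 0) ->
  runs (copy_high top) m (N * 10 + 4)
    (fun m' => [/\ m' 1 = N, m' 7 = 1 & forall a, 0 < a -> m' (N + top + a) = m0 a]).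
Proof.
move=> e1 er ea.
apply: (@runs_seq 1 (N * 10 + 3)); last by lia.
atom; apply: (@runs_seq 1 (N * 10 + 2)); last by lia.
atom; apply: (@runs_seq 1 (N * 10 + 1)); last by lia.
atom; set m1 := update _ 2 _.
pose I j m' := [/\ [/\ m' 2 = j, m' 1 = N, m' 3 = top.-1 & m' 7 = 1], j <= N - top.-1,
  forall r, top <= r -> r <= N + top -> m' r = m0 r &
  forall a, 0 < a -> (a < top) || (top.-1 + j < a) -> m' (N + top + a) = m0 a].
apply: runsW (@runs_count I _ _ 7 (N - top.-1) m1 _ _ _) _ _.
- by move=> j m' [[->]].
- move=> j m' jN [[k2 k1 k3 k7] _ hr ha].
  apply: (@runs_seq 1 6) => //; atom; apply: (@runs_seq 1 5) => //; atom.
  apply: (@runs_seq 1 4) => //; atom; apply: (@runs_seq 1 3) => //; atom.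
  apply: (@runs_seq 1 2) => //; atom; apply: (@runs_seq 1 1) => //; atom; atom.
  rewrite /update /= k2 k1 k3 k7.
  have -> : j.+1 + top.-1 = j + top by lia.
  have -> : (j + top == 4) = false by lia.
  rewrite hr; [|lia|lia]; split.
  + by split; mem.
  + by lia.
  + by move=> r r1 r2; mem; apply: hr.
  move=> a a0 ha'; case: (eqVneq a (j + top)) => [->|ne].
    by rewrite [X in X == 0](_ : _ = (N + top + j + top).+1.-1) //; mem.
  by mem; apply: ha; lia.
- split.
  + by rewrite /m1; split; mem.
  + by [].
  + by move=> r r1 r2; rewrite /m1; mem; apply: er; lia.
  move=> a a0 ha'; rewrite /m1; mem; rewrite ea //; case: ltnP ha' => //= aT ha'.
  by rewrite m0N //; lia.
- by lia.
move=> m' [[_ k1 _ k7] _ _ ha]; split=> // a a0; apply: ha => //; lia.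
Qed.

Lemma square_root_runs m : m 1 = N -> m 7 = 1 ->
  runs square_root m (n * 10 + 10)
    (fun m' => m' 6 = n /\ forall r, r = 1 \/ 6 < r -> m' r = m r).
Proof.
move=> e1 e7.
apply: (@runs_seq 2 (n * 10 + 8)); last by lia.
apply: (@runs_seq 1 1) => //; atom; atom.
apply: (@runs_seq 1 (n * 10 + 7)); last by lia.
atom; apply: (@runs_seq 1 (n * 10 + 6)); last by lia.
atom; set m1 := update _ 6 _.
(* After [i] rounds the first [i] odd numbers, of sum [i * i], have been subtracted. *)
pose I j m' := exists i, [/\ i + j = n, m' 2 = n * n - i * i, m' 4 = 2 * i + 1, m' 6 = i &
  forall r, r = 1 \/ 6 < r -> m' r = m r].
apply: runsW (@runs_count I _ _ 4 n m1 _ _ _) _ _.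
- move=> j m' [i [<- -> _ _ _]]; case: j => [|j]; first by rewrite addn0 subnn.
  by apply/negbTE; rewrite -lt0n subn_gt0; nia.
- move=> j m' jn [i [ij k2 k4 k6 fr]].
  have k7 : m' 7 = 1 by rewrite fr //; right.
  apply: (@runs_seq 1 3) => //; atom; apply: (@runs_seq 1 2) => //; atom.
  apply: (@runs_seq 1 1) => //; atom; atom; rewrite /update /= k2 k4 k6 k7.
  exists i.+1; split=> /=; try by lia.
  by move=> r hr; mem; apply: fr.
- exists 0; split=> //; last by move=> r hr; rewrite /m1; mem.
  by rewrite /m1 /update /= addn0 subn0.
- by lia.
by move=> m' [i [<- _ _ -> fr]]; rewrite addn0.
Qed.

Lemma prelude_runs :
  runs (prelude top) m0 (3 * top + N * 10 + n * 10 + 30)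
    (fun m' => [/\ m' 6 = n, m' 7 = 1, m' 8 = N + top.+1 & m' 9 = N] /\
               forall a, m' (N + top.+1 + a) = m0 a.+1).
Proof.
apply: (@runs_seq 1 (3 * top + N * 10 + n * 10 + 25)); last by lia.
atom; rewrite m00 m01 addn0.
apply: (@runs_seq (3 * top) (N * 10 + n * 10 + 25)); last by lia.
apply: runsW (copy_low_runs (s := top.-2) _ _ _) _ _ => //; [lia | by move=> r r1; mem | lia |].
move=> m1 [e1 er ea].
apply: (@runs_seq (N * 10 + 4) (n * 10 + 20)); last by lia.
apply: runsW (copy_high_runs e1 er _) (leqnn _) _.
  by move=> a a0; rewrite ea //; have -> : (a <= top.-2.+1) = (a < top) by lia.
move=> m2 [f1 f7 fa].
apply: (@runs_seq (n * 10 + 10) 5); last by lia.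
apply: runsW (square_root_runs f1 f7) (leqnn _) _ => m3 [g6 gr].
have g1 : m3 1 = N by rewrite gr //; left.
have g7 : m3 7 = 1 by rewrite gr //; right.
apply: (@runs_seq 2 2) => //; apply: (@runs_seq 1 1) => //; atom; atom.
apply: (@runs_seq 1 1) => //; atom; atom; split.
  by rewrite /update /= g1 addn0.
have gt7 a : 9 < N + top.+1 + a by lia.
move=> a; rewrite -fa // -gr; last by right; lia.
have -> : N + top + a.+1 = N + top.+1 + a by lia.
by move: (gt7 a) => ?; mem.
Qed.

End Prelude.

Lemma nth_allpairs (S T : Type) (f : S -> T -> bool) (s : seq S) (t : seq T) x y i j :
  i < size s -> j < size t ->
  nth false [seq f u v | u <- s, v <- t] (i * size t + j) = f (nth x s i) (nth y t j).
Proof.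
move=> + jt; elim: s i => // a s IH [|i] /= it; rewrite nth_cat size_map.
  by rewrite mul0n add0n jt (nth_map y).
by rewrite mulSn -addnA ltnNge leq_addr /= addKn IH.
Qed.

Definition input (G : sgraph) : nat -> rel G := fun k u v => (k == 0) && edge u v.

Lemma prog_polytime D c f (P : sgraph -> Prop) : well_scoped D 0 c -> scoped D 0 f ->
  (forall G : sgraph, holds (perform (@input G) [::] c) [::] f <-> P G) ->
  polytime_decidable adjacency_word P.
Proof.
move=> sc sf cP; pose top := 10 + 2 * D.
pose t n := (3 * top + n * n * 10 + n * 10 + 30) + (cost c n + (eval_cost f n + 2)).
have [C [K tCK]] : exists C K, forall n, t n <= C * (n * n) ^ K + C.
  apply: poly_bounded_square.
  do ?(apply: poly_bounded_add || apply: poly_bounded_mul);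
  by [apply: poly_bounded_const | apply: poly_bounded_id | apply: poly_bounded_eval_cost
     | apply: poly_bounded_cost].
exists (code 0 (prelude top;; translate 0 c;; eval 0 f;; Atom (IConst 1 0);; Atom (IAdd 0 3 1))).
exists C, K => G.
have szw : size (adjacency_word G) = #|G| * #|G| by rewrite size_allpairs -cardE.
set m0 := (init (adjacency_word G)).2.
have m0S i : m0 i.+1 = nth false (adjacency_word G) i by [].
have out r : #|G| * #|G| < r -> m0 r = 0.
  by case: r => // r h; rewrite m0S nth_default // szw.
have ent (u v : G) : nth false (adjacency_word G) (enum_rank u * #|G| + enum_rank v) = edge u v.
  have := @nth_allpairs _ _ (@edge G) (enum G) (enum G) u v (enum_rank u) (enum_rank v).
  by rewrite -cardE !nth_enum_rank => -> //; apply: ltn_ord.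
(* The first entry is a diagonal one, or absent when the graph is empty. *)
have m01 : m0 1 = 0.
  rewrite m0S; case: (pickP (mem G)) => [x _|G0]; last first.
    by rewrite nth_default // szw (eq_card0 G0).
  have Gpos : 0 < #|G| by apply/card_gt0P; exists x.
  have := ent (enum_val (Ordinal Gpos)) (enum_val (Ordinal Gpos)).
  by rewrite enum_valK /= => ->; rewrite edge_irr.
have : runs (prelude top;; translate 0 c;; eval 0 f;; Atom (IConst 1 0);; Atom (IAdd 0 3 1))
  m0 (t #|G|) (fun m => m 0 = holds (perform (@input G) [::] c) [::] f).
  apply: (@runs_seq (3 * top + #|G| * #|G| * 10 + #|G| * 10 + 30) (cost c #|G| + (eval_cost f #|G| + 2))) => //.
  apply: runsW (prelude_runs (n := #|G|) _ _ m01 out) (leqnn _) _; first by rewrite /top; lia.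
    by rewrite /m0 /= szw.
  move=> m [[e6 e7 e8 e9] em].
  have rep : represents D (@input G) [::] m.
    split; [by split=> //; rewrite e8 /top; lia | by [] | by move=> i u; rewrite onth0n|].
    move=> k u v; rewrite e8 -2!addnA em m0S /input.
    case: k => [|k]; first by rewrite ent.
    by rewrite nth_default // szw mulSn -addnA leq_addr.
  apply: (@runs_seq (cost c #|G|) (eval_cost f #|G| + 2)) => //.
  apply: runsW (translate_runs rep sc) (leqnn _) _ => m1 rep1.
  apply: (@runs_seq (eval_cost f #|G|) 2) => //.
  apply: runsW (eval_runs rep1 sf) (leqnn _) _ => m2 [e3 _].
  by apply: (@runs_seq 1 1) => //; atom; atom; rewrite /update /= e3 addn0.
case=> s [m [bs st mE]]; exists s.
have -> : run (code 0 (prelude top;; translate 0 c;; eval 0 f;; Atom (IConst 1 0);; Atom (IAdd 0 3 1)))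
    (adjacency_word G) s = (size (code 0 (prelude top;; translate 0 c;; eval 0 f;;
      Atom (IConst 1 0);; Atom (IAdd 0 3 1))), m) by exact: code_run bs.
split; first by rewrite szw (leq_trans st).
- by rewrite /halted.
by rewrite /accepting /= mE -cP eqb0 negbK.
Qed.

(** * The decision algorithm *)

(** Pointwise equal adjacency relations may give different records, but the minor property depends
    only on their values. *)
Lemma k4_ext (G : sgraph) (e : rel G) es ei (X : {set G}) : e =2 @edge G ->
  @k4 (@SGraph G e es ei) X <-> k4 X.
Proof.
move=> ee; split=> -[f [fX f0 fc ft]]; exists f; split=> //.
- by move=> i i4 S hS clS; apply: (fc i i4 S hS) => u v uB vB uv; apply: clS; rewrite // -ee.
- move=> i j ij j4; have /touchP[u [v [uB vB uv]]] := ft i j ij j4.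
  by apply/touchP; exists u, v; split; rewrite // -ee.
- by move=> i i4 S hS clS; apply: (fc i i4 S hS) => u v uB vB uv; apply: clS; rewrite // /edge /= ee.
move=> i j ij j4; have /touchP[u [v [uB vB uv]]] := ft i j ij j4.
by apply/touchP; exists u, v; split; rewrite // /edge /= ee.
Qed.

Section Elimination.

Variable T : finType.
Implicit Types (M : rel T) (l u v : T).

(* The diagonal of [M] is the current vertex set, the rest of [M] the current
   graph; eliminated vertices keep their edges. *)
Definition alive M := [set u | M u u].

(** Symmetrising and ignoring the diagonal, which encodes the vertex set, turns every relation into
    a graph. *)
Definition graph_edge M : rel T := fun u v => (u != v) && (M u v || M v u).

Fact graph_edge_sym M : symmetric (graph_edge M).
Proof. by move=> u v; rewrite /graph_edge eq_sym orbC. Qed.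

Fact graph_edge_irr M : irreflexive (graph_edge M).
Proof. by move=> u; rewrite /graph_edge eqxx. Qed.

Definition graph_of M := SGraph (graph_edge_sym M) (graph_edge_irr M).

Definition adjacent M l a := [&& l != a, M l a & M a a].

Definition low M l := M l l && ~~ [exists a, [exists b, [exists c,
  [&& adjacent M l a, adjacent M l b, adjacent M l c, a != b, b != c & c != a]]]].

Definition eliminate l M : rel T := fun u v =>
  if u == v then M u u && ~~ (low M l && (u == l))
  else M u v || [&& low M l, l != u, l != v, M l u & M l v].

Definition has_k4 M := @k4 (graph_of M) (alive M).

Lemma adjacentE M l a : symmetric M -> adjacent M l a = (a \in @nbrs (graph_of M) (alive M) l).
Proof.
by move=> sM; rewrite /adjacent !inE /edge /= /graph_edge (sM a l) orbb [RHS]andbC andbA.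
Qed.

Lemma lowP M l : symmetric M -> low M l = (l \in alive M) && (#|@nbrs (graph_of M) (alive M) l| <= 2).
Proof.
move=> sM; rewrite /low [in RHS]inE; congr (_ && _); rewrite leqNgt; congr (~~ _).
apply/idP/card_gt2P => [/existsP[a /existsP[b /existsP[c]]]|[a [b [c [[ha hb hc] [ab bc ca]]]]]].
  by rewrite !adjacentE // => /and5P[ha hb hc ab /andP[bc ca]]; exists a, b, c.
apply/existsP; exists a; apply/existsP; exists b; apply/existsP; exists c.
by rewrite !adjacentE // ha hb hc ab bc.
Qed.

Lemma eliminate_sym l M : symmetric M -> symmetric (eliminate l M).
Proof.
move=> sM u v; rewrite /eliminate eq_sym (sM u v); case: eqP => [->//|_].
by congr (_ || _); case: (low M l); case: (l != u); case: (l != v); rewrite //= andbC.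
Qed.

Lemma eliminate_low l M : low M l -> alive (eliminate l M) = alive M :\ l.
Proof. by move=> lM; apply/setP=> u; rewrite !inE /eliminate eqxx lM andbC. Qed.

Lemma eliminate_high l M : ~~ low M l -> eliminate l M =2 M.
Proof.
by move=> /negbTE lM u v; rewrite /eliminate lM; case: eqP => [->|_]; rewrite ?andbT ?orbF.
Qed.

Lemma aliveE M M' : M =2 M' -> alive M = alive M'.
Proof. by move=> MM; apply/setP=> u; rewrite !inE MM. Qed.

Lemma has_k4E M M' : M =2 M' -> has_k4 M -> has_k4 M'.
Proof.
move=> MM; rewrite /has_k4 (aliveE MM); apply: (proj1 (@k4_ext (graph_of M') _ _ _ _ _)) => u v.
by rewrite /edge /= /graph_edge !MM.
Qed.

Lemma lowE M M' l : M =2 M' -> low M l = low M' l.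
Proof.
move=> MM; rewrite /low /adjacent MM; congr (_ && ~~ _).
by do 3 apply: eq_existsb => ?; rewrite !MM.
Qed.

Lemma eliminateE l M M' : M =2 M' -> eliminate l M =2 eliminate l M'.
Proof. by move=> MM u v; rewrite /eliminate (lowE _ MM) !MM. Qed.

Lemma eliminate_has_k4 l M : symmetric M -> has_k4 M <-> has_k4 (eliminate l M).
Proof.
move=> sM; case lM: (low M l); last first.
  by split; apply: has_k4E => u v; rewrite eliminate_high ?lM.
have := lM; rewrite lowP // => /andP[lX d2].
have e : @fill_edge (graph_of M) l =2 graph_edge (eliminate l M).
  move=> u v; rewrite /fill_edge /edge /= /graph_edge /eliminate [v == u]eq_sym.
  case: eqP => //= _; rewrite !(sM v) !(sM _ l) !orbb lM /= .
  by case: (M u v); case: (l != u); case: (l != v); case: (M l u); case: (M l v).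
rewrite /has_k4 eliminate_low // (@k4_eliminate (graph_of M) l _ lX d2).
have h := @k4_ext (@fill (graph_of M) l) (graph_edge (eliminate l M)) (@graph_edge_sym _)
  (@graph_edge_irr _) (alive M :\ l).
by apply: iff_sym; apply: h => u v; rewrite -e.
Qed.

Definition sweep M s := foldl (fun M l => eliminate l M) M s.

Lemma sweepE M M' s : M =2 M' -> sweep M s =2 sweep M' s.
Proof. by elim: s M M' => // l s IH M M' MM; apply: IH; exact: eliminateE. Qed.

Lemma sweep_sym M s : symmetric M -> symmetric (sweep M s).
Proof. by elim: s M => //= l s IH M sM; apply: IH; exact: eliminate_sym. Qed.

Lemma sweep_has_k4 M s : symmetric M -> has_k4 M <-> has_k4 (sweep M s).
Proof.
elim: s M => //= l s IH M sM; rewrite -IH; [exact: eliminate_has_k4 | exact: eliminate_sym].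
Qed.

Lemma alive_eliminate l M : alive (eliminate l M) \subset alive M.
Proof.
case lM: (low M l); first by rewrite eliminate_low // subD1set.
by rewrite (aliveE (eliminate_high _)) ?lM.
Qed.

Lemma alive_sweep M s : alive (sweep M s) \subset alive M.
Proof. by elim: s M => //= l s IH M; apply: subset_trans (IH _) (alive_eliminate l M). Qed.

Lemma sweepP M s :
  #|alive (sweep M s)| < #|alive M| \/ sweep M s =2 M /\ {in s, forall l, ~~ low M l}.
Proof.
elim: s M => [|l s IH] M; first by right.
case lM: (low M l).
  left; apply: leq_ltn_trans (subset_leq_card (alive_sweep _ s)) _.
  rewrite eliminate_low // proper_card // properD1 //.
  by move: lM; rewrite /low inE => /andP[].
have eM := eliminate_high (negbT lM).
case: (IH (eliminate l M)) => [h|[h1 h2]]; [left | right].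
  by rewrite (aliveE eM) in h.
split; first by move=> u v; exact: etrans (h1 u v) (eM u v).
move=> a; rewrite inE => /orP[/eqP->|/h2]; first by rewrite lM.
by rewrite (lowE _ eM).
Qed.

Definition sweeps M s t := iter t (fun M => sweep M s) M.

Lemma sweepsE M M' s t : M =2 M' -> sweeps M s t =2 sweeps M' s t.
Proof. by move=> MM; elim: t => // t IH; apply: sweepE. Qed.

(** Every sweep removes a vertex or meets no low vertex; in the second case all later sweeps change
    nothing. *)
Lemma sweepsP M t : #|alive (sweeps M (rev (enum T)) t)| + t <= #|alive M| \/
  forall l, ~~ low (sweeps M (rev (enum T)) t) l.
Proof.
elim: t => [|t]; first by left; rewrite addn0.
rewrite /sweeps iterS -/(sweeps _ _ _); set M' := sweeps M _ t => IH.
case: (sweepP M' (rev (enum T))) => [h|[h1 h2]]; last first.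
  by right=> l; rewrite (lowE _ h1) h2 // mem_rev mem_enum.
case: IH => IH; first by left; lia.
exfalso; move: h; suff -> : alive (sweep M' (rev (enum T))) = alive M' by rewrite ltnn.
apply: aliveE; move: IH; elim: (rev _) (M') => //= l s IHs M1 nl u v.
have e := eliminate_high (nl l).
by rewrite IHs ?e // => a; rewrite (lowE _ e).
Qed.

(** After [#|T|] sweeps no alive vertex is low. A surviving vertex then means minimum degree 3 on a
    nonempty set, hence a [K_4] minor; without survivors there is none. *)
Lemma sweeps_k4 M t : symmetric M -> #|T| <= t ->
  has_k4 M <-> [exists u, sweeps M (rev (enum T)) t u u].
Proof.
move=> sM Tt; have [sM' ->] : symmetric (sweeps M (rev (enum T)) t) /\
    (has_k4 M <-> has_k4 (sweeps M (rev (enum T)) t)).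
  elim: (t) => //= t' [s1 e1]; split; first exact: sweep_sym.
  by rewrite e1; exact: sweep_has_k4.
have := sweepsP M t; set M' := sweeps _ _ _ in sM' * => h.
split=> [[f [fX f0 _ _]]|/existsP[u uu]].
  have /set0Pn[u] := f0 0 isT; rewrite inE => /eqP fu.
  by have := fX u; rewrite fu inE => /(_ isT) uu; apply/existsP; exists u.
have uM : u \in alive M' by rewrite inE.
apply: k4_of_min_degree; first by apply/set0Pn; exists u.
move=> l lM; case: h => [h|/(_ l)]; last by rewrite lowP // lM /= -ltnNge.
have h1 : 0 < #|alive M'| by apply/card_gt0P; exists u.
have h2 : #|alive M| <= #|T| by exact: max_card.
by lia.
Qed.

End Elimination.

Definition Or f g := Not (And (Not f) (Not g)).

(* Relation 0 is the graph, 1 the answer, 2 the block and 3 the connectivity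
   relation being computed, 4 a scratch copy for redefinitions, 5 the graph that
   undergoes elimination.  Unary relations ignore their second argument. *)
Definition redefine d k f := Then (Def 4 f) (Def k (Rel 4 d d.+1)).

Definition avoid_form z i j :=
  And (And (Not (Eqv i z)) (Not (Eqv j z))) (Or (Eqv i j) (Rel 0 i j)).

(* Levels: x = 0, y = 1, z = 2. *)
Definition block_prog :=
  Then (Def 2 (Eqv 2 2)) (For (Then
    (Then (Def 3 (avoid_form 2 3 4)) (For (redefine 4 3 (Ex (And (Rel 3 4 6) (Rel 3 6 5))))))
    (redefine 3 2 (And (Rel 2 3 4) (Or (Eqv 3 2) (Or (Rel 3 3 0) (Rel 3 3 1))))))).

Definition adjacent_form l a := And (Not (Eqv l a)) (And (Rel 5 l a) (Rel 5 a a)).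

Definition low_form d l :=
  let a := d in let b := d.+1 in let c := d.+2 in
  And (Rel 5 l l) (Not (Ex (Ex (Ex
    (And (adjacent_form l a) (And (adjacent_form l b) (And (adjacent_form l c)
      (And (Not (Eqv a b)) (And (Not (Eqv b c)) (Not (Eqv c a))))))))))).

Definition eliminate_form d l i j :=
  Or (And (Eqv i j) (And (Rel 5 i i) (Not (And (low_form d l) (Eqv i l)))))
     (And (Not (Eqv i j)) (Or (Rel 5 i j)
       (And (low_form d l) (And (Not (Eqv l i)) (And (Not (Eqv l j))
         (And (Rel 5 l i) (Rel 5 l j))))))).

(* Levels: x = 0, y = 1, v = 2, round = 3, l = 4. *)
Definition sweeps_prog :=
  Then (Def 5 (Or (And (Eqv 3 4) (And (Rel 2 3 3) (Not (Eqv 3 2)))) (Rel 0 3 4)))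
    (For (For (redefine 5 5 (eliminate_form 7 4 5 6)))).

Definition house_form :=
  And (Rel 0 0 1) (And (Rel 2 2 2) (And (Ex (Rel 5 5 5))
    (Ex (Ex (And (Rel 2 5 5) (And (Rel 2 6 6) (And (Rel 0 5 6)
      (And (Not (Rel 0 2 5)) (Not (Rel 0 2 6)))))))))).

Definition house_prog :=
  For (For (Then block_prog
    (For (Then sweeps_prog (redefine 3 1 (Or (Rel 1 3 4) house_form)))))).

Lemma eq_Some (T : eqType) (a b : T) : (Some a == Some b) = (a == b).
Proof. by []. Qed.

(** * Correctness of the decision program *)

Section Correctness.

Variable G : sgraph.
Implicit Types (R : nat -> rel G) (u v x y z l : G).

Definition near z : rel G := fun u v => ((u != z) && (v != z)) && ((u == v) || edge u v).

Definition compose_rel (C : rel G) : rel G := fun u v => [exists w, C u w && C w v].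

(** [near z] is reflexive off [z], so [t] squarings cover all paths with at most [t] edges, and a
    simple path has fewer than [#|G|] edges. *)
Lemma compose_near z t u v : #|G| <= t ->
  iter t compose_rel (near z) u v = [&& u != z, v != z & connect (avoid z) u v].
Proof.
move=> Gt; apply/idP/idP.
  elim: t {Gt} u v => [|t IH] u v /=.
    case/andP=> /andP[uz vz] uv; rewrite uz vz; case/orP: uv => [/eqP->|uv]; first exact: connect0.
    by apply: connect1; rewrite /avoid uz vz.
  case/existsP=> w /andP[/IH/and3P[uz _ uw] /IH/and3P[_ vz wv]].
  by rewrite uz vz (connect_trans uw wv).
case/and3P=> uz vz /connectP[p pp ->]; case/shortenP: pp => q qq uq _.
have sq : size q <= t.
  have h : size (u :: q) <= #|G| by rewrite -(card_uniqP uq) max_card.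
  exact: leq_trans (ltnW h) Gt.
have refl s w : w != z -> iter s compose_rel (near z) w w.
  move=> wz; elim: s => [|s IH]; first by rewrite /near /= wz eqxx.
  by apply/existsP; exists w; apply/andP; split.
elim: t q u uz qq sq {Gt uq} => [|t IH] [|a q] u uz /= qq sq //.
- exact: (refl 0).
- exact: (refl t.+1).
case/andP: qq => /and3P[_ az ua] aq; apply/existsP; exists a; apply/andP; split; last exact: IH.
elim: t {IH sq} => [|t IHt]; first by rewrite /= /near uz az ua orbT.
by apply/existsP; exists a; apply/andP; split=> //; apply: refl.
Qed.

Lemma perform_compose R s x y z : let R' := foldl (fun R w => perform R [:: x; y; z; w]
      (redefine 4 3 (Ex (And (Rel 3 4 6) (Rel 3 6 5))))) R s in
  [/\ R' 0 = R 0, R' 1 = R 1, R' 2 = R 2 & R' 3 = iter (size s) compose_rel (R 3)].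
Proof.
elim: s R => [|w s IH] R; first by [].
rewrite [size _]/= iterSr.
exact: (IH (perform R [:: x; y; z; w] (redefine 4 3 (Ex (And (Rel 3 4 6) (Rel 3 6 5)))))).
Qed.

Definition block_step := Then
    (Then (Def 3 (avoid_form 2 3 4)) (For (redefine 4 3 (Ex (And (Rel 3 4 6) (Rel 3 6 5))))))
    (redefine 3 2 (And (Rel 2 3 4) (Or (Eqv 3 2) (Or (Rel 3 3 0) (Rel 3 3 1))))).

Lemma perform_block_step R x y z : let R' := perform R [:: x; y; z] block_step in
  [/\ R' 0 = R 0, R' 1 = R 1 & R 0 = @edge G -> forall u v, R' 2 u v =
    R 2 u v && [|| u == z, joined z u x | joined z u y]].
Proof.
set R1 := perform R [:: x; y; z] (Def 3 (avoid_form 2 3 4)).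
have [] := perform_compose R1 (rev (enum G)) x y z.
set R2 := foldl _ _ _ => e0 e1 e2 e3; split; [exact: e0 | exact: e1 | move=> RE u v].
have R1E : R1 3 =2 near z.
  move=> a b; change ((~~ (Some a == Some z) && ~~ (Some b == Some z)) &&
    ~~ (~~ (Some a == Some b) && ~~ R 0 a b) = near z a b).
  by rewrite !eq_Some RE negb_and !negbK.
have CE a b : R2 3 a b = [&& a != z, b != z & connect (avoid z) a b].
  rewrite e3 size_rev -cardE -(@compose_near z #|G|) //.
  elim: #|_| a b => [|t IH] a b; first exact: R1E.
  by rewrite !iterS; apply: eq_existsb => w; congr (_ && _); exact: IH.
change (R2 2 u v && ~~ (~~ (Some u == Some z) && ~~ ~~ (~~ R2 3 u x && ~~ R2 3 u y)) =
  R 2 u v && [|| u == z, joined z u x | joined z u y]).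
rewrite eq_Some (_ : forall a b c, ~~ (~~ a && ~~ ~~ (~~ b && ~~ c)) = [|| a, b | c]); last by do 3 case.
rewrite e2 !CE /joined; congr (_ && _).
have nz w : u != z -> connect (avoid z) u w -> w != z.
  move=> uz /connectP[p + ->]; elim: p u uz => //= a p IH a0 _ /andP[/and3P[_ az _]].
  exact: IH.
have hE w : [&& u != z, w != z & connect (avoid z) u w] = (u != z) && connect (avoid z) u w.
  by apply/and3P/andP => [[]|[uz uw]]; split=> //; exact: nz uw.
by rewrite !hE.
Qed.

Lemma perform_block R x y : let R' := perform R [:: x; y] block_prog in
  [/\ R' 0 = R 0, R' 1 = R 1 & R 0 = @edge G -> forall u v, R' 2 u v = (u \in block x y)].
Proof.
pose R1 := perform R [:: x; y] (Def 2 (Eqv 2 2)).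
have key s R0 : let R' := foldl (fun R z => perform R [:: x; y; z] block_step) R0 s in
  [/\ R' 0 = R0 0, R' 1 = R0 1 & R0 0 = @edge G -> forall u v, R' 2 u v =
    R0 2 u v && all (fun z => [|| u == z, joined z u x | joined z u y]) s].
  elim: s R0 => [|z s IH] R0; first by split=> // _ u v; rewrite andbT.
  have [f0 f1 f2] := perform_block_step R0 x y z.
  have [g0 g1 g2] := IH (perform R0 [:: x; y; z] block_step).
  split; [exact: etrans g0 f0 | exact: etrans g1 f1 | move=> RE u v].
  by rewrite [LHS]g2 ?f0 // f2 // -andbA.
have [h0 h1 h2] := key (rev (enum G)) R1; split; [exact: h0 | exact: h1 | move=> RE u v].
rewrite [LHS]h2 // inE; have -> : R1 2 u v = (Some u == Some u) by [].
rewrite eqxx /=; apply/allP/forallP => h z; last by move=> _; exact: h.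
by apply: h; rewrite mem_rev mem_enum.
Qed.

Lemma perform_sweeps R x y v : let R' := perform R [:: x; y; v] sweeps_prog in
  [/\ R' 0 = R 0, R' 1 = R 1, R' 2 = R 2 & R 0 = @edge G ->
    (forall a b, R 2 a b = (a \in block x y)) ->
    k4 (block x y :\ v) <-> [exists u, R' 5 u u]].
Proof.
pose f0 := Or (And (Eqv 3 4) (And (Rel 2 3 3) (Not (Eqv 3 2)))) (Rel 0 3 4).
pose R1 := perform R [:: x; y; v] (Def 5 f0).
pose step w R l := perform R [:: x; y; v; w; l] (redefine 5 5 (eliminate_form 7 4 5 6)).
have stepE w R0 l : step w R0 l 5 =2 eliminate l (R0 5).
  move=> a b; rewrite /eliminate.
  (* True by conversion; the formula is then generalised, so that simplifying the surrounding one
     does not unfold it. *)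
  have lowE' : holds R0 [:: x; y; v; w; l; a; b] (low_form 7 4) = low (R0 5) l.
    by [].
  change (holds R0 [:: x; y; v; w; l; a; b] (eliminate_form 7 4 5 6) = 
    if a == b then R0 5 a a && ~~ (low (R0 5) l && (a == l))
    else R0 5 a b || [&& low (R0 5) l, l != a, l != b, R0 5 l a & R0 5 l b]).
  rewrite /eliminate_form; move: (low_form 7 4) lowE' => f e.
  rewrite /= e !eq_Some; case: (low _ _); case: (a == b); case: (R0 5 a b); case: (R0 5 a a);
    by case: (a == l); case: (l == a); case: (l == b); case: (R0 5 l a); case: (R0 5 l b).
have sweep5 (t : G) (s : seq G) (R0 : nat -> rel G) : let R' := foldl (step t) R0 s in
  [/\ R' 0 = R0 0, R' 1 = R0 1, R' 2 = R0 2 & R' 5 =2 sweep (R0 5) s].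
  elim: s R0 => [|l s IH] R0; first by [].
  have [h0 h1 h2 h5] := IH (step t R0 l); split; [exact: h0 | exact: h1 | exact: h2 |].
  by move=> a b; rewrite [LHS]h5; exact: sweepE (stepE t R0 l) a b.
have sweeps5 (s : seq G) (R0 : nat -> rel G) : let R' := foldl (fun R t => foldl (step t) R (rev (enum G))) R0 s in
  [/\ R' 0 = R0 0, R' 1 = R0 1, R' 2 = R0 2 &
      R' 5 =2 sweeps (R0 5) (rev (enum G)) (size s)].
  elim: s R0 => [|t s IH] R0; first by [].
  have [g0 g1 g2 g5] := sweep5 t (rev (enum G)) R0.
  have [h0 h1 h2 h5] := IH (foldl (step t) R0 (rev (enum G))).
  split; [exact: etrans h0 g0 | exact: etrans h1 g1 | exact: etrans h2 g2 |].
  by move=> a b; rewrite [LHS]h5 /sweeps [size _]/= iterSr; exact: (sweepsE _ _ g5).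
have [h0 h1 h2 h5] := sweeps5 (rev (enum G)) R1.
split; [exact: h0 | exact: h1 | exact: h2 | move=> RE RB].
have R15 a b : R1 5 a b = (a == b) && (a \in block x y :\ v) || edge a b.
  change (~~ (~~ ((Some a == Some b) && (R 2 a a && ~~ (Some a == Some v))) && ~~ R 0 a b) =
    (a == b) && (a \in block x y :\ v) || edge a b).
  by rewrite negb_and !negbK !eq_Some RE RB in_setD1 [_ && (a != v)]andbC.
have sR : symmetric (R1 5).
  by move=> a b; rewrite !R15 [edge b a]edge_sym [b == a]eq_sym; case: eqP => [->|].
have aR : alive (R1 5) = block x y :\ v by apply/setP=> a; rewrite inE R15 eqxx edge_irr orbF.
have eR : graph_edge (R1 5) =2 @edge G.
  move=> a b; rewrite /graph_edge -(sR a b) orbb R15.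
  by have [->|_] := eqVneq a b; rewrite ?edge_irr.
have -> : [exists u, foldl (fun R t => foldl (step t) R (rev (enum G))) R1 (rev (enum G)) 5 u u]
    = [exists u, sweeps (R1 5) (rev (enum G)) #|G| u u].
  by apply: eq_existsb => u; rewrite h5 size_rev -cardE.
rewrite -sweeps_k4 // /has_k4 aR.
exact: iff_sym (@k4_ext G _ _ _ _ eR).
Qed.

(** The three nested loops accumulate a disjunction in relation 1; under an invariant such a loop
    computes an existential. *)
Lemma foldl_disjunction (F : (nat -> rel G) -> G -> nat -> rel G) (inv : (nat -> rel G) -> Prop)
    (Q : G -> Prop) :
  (forall R z, inv R -> inv (F R z) /\ forall u, F R z 1 u u <-> R 1 u u \/ Q z) ->
  forall s R, inv R -> inv (foldl F R s) /\
    forall u, foldl F R s 1 u u <-> R 1 u u \/ exists2 z, z \in s & Q z.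
Proof.
move=> step; elim=> [|z s IH] R iR /=.
  by split=> // u; split=> [|[//|[]]//]; left.
have [iF eF] := step R z iR; have [iS eS] := IH _ iF; split=> // u; rewrite eS eF.
split=> [[[|]|[w ws Qw]]|[|[w + Qw]]].
- by left.
- by right; exists z; rewrite ?mem_head.
- by right; exists w; rewrite // inE ws orbT.
- by left; left.
by rewrite inE => /orP[/eqP<-|ws]; [left; right | right; exists w].
Qed.

Lemma perform_house : [exists u, perform (@input G) [::] house_prog 1 u u] <-> house G.
Proof.
pose Q x y v := exists c d,
  [/\ edge x y, v \in block x y, c \in block x y & d \in block x y] /\
  [/\ edge c d, ~~ edge v c, ~~ edge v d & k4 (block x y :\ v)].
have stepv x y R v : R 0 = @edge G /\ (forall a b, R 2 a b = (a \in block x y)) ->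
  let R' := perform R [:: x; y; v] (Then sweeps_prog (redefine 3 1 (Or (Rel 1 3 4) house_form))) in
  (R' 0 = @edge G /\ (forall a b, R' 2 a b = (a \in block x y))) /\
  forall u, R' 1 u u <-> R 1 u u \/ Q x y v.
  move=> [RE RB]; have [] := perform_sweeps R x y v.
  set R1 := perform R _ sweeps_prog => h0 h1 h2 h5; split.
    by split; [exact: etrans h0 RE | move=> a b; exact: etrans (congr1 (fun S => S a b) h2) (RB a b)].
  move=> u; change (~~ (~~ R1 1 u u && ~~ [&& R1 0 x y, R1 2 v v, [exists u, R1 5 u u] &
    [exists c, exists d, [&& R1 2 c c, R1 2 d d, R1 0 c d, ~~ R1 0 v c & ~~ R1 0 v d]]]) <->
    R 1 u u \/ Q x y v).
  rewrite h1 negb_and !negbK; split.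
    case/orP=> [|/and4P[]]; first by left.
    rewrite h2 h0 RE RB => xy vB /(h5 RE RB) kB /existsP[c /existsP[d]].
    rewrite !RB => /and5P[cB dB cd vc vd]; right; by exists c, d.
  case=> [->//|[c [d [[xy vB cB dB] [cd vc vd kB]]]]]; apply/orP; right.
  rewrite h2 h0 RE RB xy vB; apply/and4P; split=> //; first exact/(h5 RE RB).
  by apply/existsP; exists c; apply/existsP; exists d; rewrite !RB cB dB cd vc vd.
have stepy x R y : R 0 = @edge G ->
  let R' := perform R [:: x; y] (Then block_prog (For (Then sweeps_prog
     (redefine 3 1 (Or (Rel 1 3 4) house_form))))) in
  R' 0 = @edge G /\ forall u, R' 1 u u <-> R 1 u u \/ exists v, Q x y v.
  move=> RE; have [] := perform_block R x y; set R1 := perform R _ block_prog => h0 h1 h2.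
  have [[g0 _] g1] := foldl_disjunction (F := fun R v => perform R [:: x; y; v] _)
    (stepv x y) (rev (enum G))
    (conj (etrans h0 RE) (h2 RE)).
  split; first exact: g0.
  move=> u; apply: iff_trans (g1 u) _; rewrite h1.
  by split=> -[|[v]]; [left | right; exists v | left | right; exists v; rewrite // mem_rev mem_enum].
have stepx R x : R 0 = @edge G ->
  let R' := perform R [:: x] (For (Then block_prog (For (Then sweeps_prog
     (redefine 3 1 (Or (Rel 1 3 4) house_form)))))) in
  R' 0 = @edge G /\ forall u, R' 1 u u <-> R 1 u u \/ exists y v, Q x y v.
  move=> RE; have [g0 g1] := foldl_disjunction (F := fun R y => perform R [:: x; y] _)
    (stepy x) (rev (enum G)) RE.
  split; first exact: g0.
  move=> u; apply: iff_trans (g1 u) _.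
  by split=> -[|[y]]; [left | right; exists y | left | right; exists y; rewrite // mem_rev mem_enum].
have [_ g1] := foldl_disjunction (F := fun R x => perform R [:: x] _) stepx (rev (enum G))
  (erefl : @input G 0 = @edge G).
apply: iff_trans (iff_sym (house_block G)); split.
  by case/existsP=> u /(g1 u)[//|[x _ [y [v h]]]]; exists x, y, v.
move=> [x [y [v h]]]; apply/existsP; exists x; apply/(g1 x); right.
by exists x; rewrite ?mem_rev ?mem_enum //; exists y, v.
Qed.

End Correctness.

Theorem theorem4p4 :
  polytime_decidable adjacency_word (fun G : sgraph => induced_minor full_house G).
Proof.
(* The ten levels are [x], [y], [v], the round, [l], the two arguments of a definition and the three
   quantified neighbours in [low_form]. *)
apply: (@prog_polytime 10 house_prog (Ex (Rel 1 0 0))) => // G.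
exact: iff_trans (perform_house G) (iff_sym (induced_minor_house G)).
Qed.
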